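(* Let $\Omega\subset\mathbb{C}$ be a bounded convex domain, $J\subsetneq\partial\Omega$ a relatively open subset of its boundary, and $p\in\{0,1,2,\dots\}$. Let $\phi:\overline{D}\to\overline{\Omega}$ be a Riemann map (extended homeomorphically to the closed unit disc), and $L=\phi^{-1}(J)$. Then the set of functions $f\in A^p(\Omega,J)$ such that $\operatorname{Re}(f^{(p)}\circ\phi)$ and $\operatorname{Im}(f^{(p)}\circ\phi)$ are nowhere differentiable on $L$ contains a $G_\delta$ and dense subset of $A^p(\Omega,J)$.
   Context: $D$ is the open unit disc. $A^p(\Omega,J)$ is the set of holomorphic functions $f:\Omega\to\mathbb{C}$ such that for every integer $0\le l\le p$ the derivative $f^{(l)}$ extends continuously to $\Omega\cup J$ (extensions are denoted by the same symbol), with the Fréchet topology induced by the seminorms $\sup_{z\in\Delta_m}|f^{(l)}(z)|$, $0\le l\le p$, $m=1,2,\dots$, where $\Delta_m=\{z\in\Omega\cup J:\operatorname{dist}(z,\partial\Omega\setminus J)\ge\frac1m,\ |z|\le m\}$. A function $u:L\to\mathbb{R}$, $L\subset\partial D$ relatively open, is nowhere differentiable if $\theta\mapsto u(e^{i\theta})$ is not differentiable at any real $\theta$ with $e^{i\theta}\in L$. *)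

(* Defs.v *)
From HB Require Import structures.
From mathcomp Require Import all_boot all_order all_algebra.
From mathcomp Require Import all_classical all_reals all_analysis.
From mathcomp Require Import complex.

Set Implicit Arguments.
Unset Strict Implicit.
Unset Printing Implicit Defensive.

Import Order.TTheory GRing.Theory Num.Theory.
Import numFieldNormedType.Exports.

Local Open Scope classical_set_scope.
Local Open Scope ring_scope.

(* R[i] packed as a numClosedFieldType: the topology and the normed module
   structure that a numFieldType carries on itself are inferred for [Cx R], but
   not for the bare carrier R[i].  In particular [derivable f z 1] and
   [derive1n] at f : Cx R -> Cx R are complex differentiation. *)
Definition Cx (R : rcfType) : numClosedFieldType := R[i].

Section Geometry.
Variable R : realType.
Implicit Types (U A : set (Cx R)) (z : Cx R).

(* The library norm `|z| takes its values in Cx R; this is the same number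
   as an element of R. *)
Definition modulus z : R := Normc.normc z.

Definition expi (t : R) : Cx R := (cos t +i* sin t)%C.

Definition unit_disc : set (Cx R) := [set z | modulus z < 1].

Definition boundary U : set (Cx R) := closure U `\` interior U.

Definition relatively_open A U := exists2 V, open V & A = U `&` V.

Definition domain U := [/\ open U, connected U & U !=set0].

Definition bounded_convex_domain U :=
  [/\ domain U, convex_set U & bounded_set U].

(* Meaningful for nonempty A only ([inf set0 = 0]). *)
Definition dist z A : R := inf [set modulus (z - w) | w in A].

Definition holomorphic_on U (f : Cx R -> Cx R) :=
  forall z, U z -> derivable f z 1.

(* h, defined on U, has a continuous extension to U `|` J. *)
Definition extends_continuously U (J : set (Cx R)) (h : Cx R -> Cx R) :=
  exists2 g : Cx R -> Cx R,
    {within U `|` J, continuous g} & forall z, U z -> g z = h z.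

(* When U is open, J is contained in closure U and h extends continuously to
   U `|` J, this is the (unique) extension at every point of U `|` J. *)
Definition extension U (h : Cx R -> Cx R) (z : Cx R) : Cx R :=
  lim (h w @[w --> within U (nbhs z)]).

Definition homeomorphism_on A B (phi : Cx R -> Cx R) :=
  exists psi : Cx R -> Cx R,
    [/\ {within A, continuous phi}, {within B, continuous psi},
        (forall z, A z -> B (phi z) /\ psi (phi z) = z) &
        (forall w, B w -> A (psi w) /\ phi (psi w) = w)].

(* Riemann map of the unit disc onto U, extended to a homeomorphism of the
   closures.  Values of phi outside the closed disc are irrelevant. *)
Definition extended_riemann_map U (phi : Cx R -> Cx R) :=
  [/\ holomorphic_on unit_disc phi, set_bij unit_disc U phi &
      homeomorphism_on (closure unit_disc) (closure U) phi].

Definition nowhere_differentiable_on (L : set (Cx R)) (u : Cx R -> R) :=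
  forall t : R, L (expi t) -> ~ derivable (fun s : R => u (expi s)) t 1.

End Geometry.

(* A^p(Omega, J).  A function on Omega is encoded by its extension by 0 to the
   whole plane, so that equality in [Ap] is equality on Omega. *)
Record Ap (R : realType) (Omega J : set (Cx R)) (p : nat) := MkAp {
  ap_fun :> Cx R -> Cx R;
  ap_holomorphic : holomorphic_on Omega ap_fun;
  ap_extends : forall l, (l <= p)%N ->
    extends_continuously Omega J (derive1n l ap_fun);
  ap_outside : forall z, ~ Omega z -> ap_fun z = 0 }.

Section ApTopology.
Variables (R : realType) (Omega J : set (Cx R)) (p : nat).

Definition Delta (m : nat) : set (Cx R) :=
  [set z | [/\ (Omega `|` J) z,
               m%:R^-1 <= dist z (boundary Omega `\` J) &
               modulus z <= m%:R]].

(* The supremum of the empty set is 0.  For h in A^p(Omega, J), Omega bounded,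
   J relatively open and distinct from the boundary, 0 < m and l <= p, Delta m
   is compact and the supremum is finite. *)
Definition Ap_seminorm (l m : nat) (h : Cx R -> Cx R) : R :=
  sup [set modulus (extension Omega (derive1n l h) z) | z in Delta m].

(* Basic neighbourhoods of f: every finite family of seminorms is contained in
   one of the families {(l, m) | l <= p, 0 < m <= M}. *)
Definition Ap_ball (f : Ap Omega J p) (M : nat) (e : R) : set (Ap Omega J p) :=
  [set g | forall l m, (l <= p)%N -> (0 < m <= M)%N ->
     Ap_seminorm l m (g \- f) < e].

Definition Ap_open (V : set (Ap Omega J p)) :=
  forall f, V f -> exists M, exists2 e, 0 < e & Ap_ball f M e `<=` V.

Lemma Ap_openT : Ap_open setT.
Proof. by move=> f _; exists 0%N, 1. Qed.

Lemma Ap_openI : setI_closed Ap_open.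
Proof.
move=> V W oV oW f [/oV[M [e e0 sV]] /oW[N [d d0 sW]]].
exists (maxn M N), (Num.min e d); first by rewrite lt_min e0 d0.
move=> g gball; split; [apply: sV|apply: sW] => l m lp /andP[m0 mM].
  have := gball l m lp.
  by rewrite m0 leq_max mM lt_min => /(_ isT)/andP[].
have := gball l m lp.
by rewrite m0 leq_max mM orbT lt_min => /(_ isT)/andP[].
Qed.

Lemma Ap_open_bigU (I : Type) (V : I -> set (Ap Omega J p)) :
  (forall i, Ap_open (V i)) -> Ap_open (\bigcup_i V i).
Proof.
move=> oV f [i _ /(oV i)[M [e e0 sV]]]; exists M, e => // g /sV Vg.
by exists i.
Qed.

HB.instance Definition _ := gen_eqMixin (Ap Omega J p).
HB.instance Definition _ := gen_choiceMixin (Ap Omega J p).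
HB.instance Definition _ := isOpenTopological.Build (Ap Omega J p)
  Ap_openT Ap_openI Ap_open_bigU.

End ApTopology.

(* Main.v *)
Require Import Defs.
From HB Require Import structures.
From mathcomp Require Import all_boot all_order all_algebra.
From mathcomp Require Import all_classical all_reals all_analysis.
From mathcomp Require Import borel_hierarchy.
From mathcomp Require Import complex ring lra.

Set Implicit Arguments.
Unset Strict Implicit.
Unset Printing Implicit Defensive.

Import Order.TTheory GRing.Theory Num.Theory.
Import numFieldNormedType.Exports.

Local Open Scope classical_set_scope.
Local Open Scope ring_scope.

(** Why the theorem holds.

    Write u_f for the function sending t to the real (or imaginary) part of
    f^(p)(phi(e^it)).  The G_delta set is the intersection over n of the sets of
    those f for which, uniformly over all t with phi(e^it) in the n-th compact
    piece of J, there is s at distance less than 1/n from t with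
       |u_f(s) - u_f(t)| >= n (|s - t| + |phi(e^is) - phi(e^it)|) + eta
    for some eta > 0 independent of t ([steep]).  The margin eta makes these
    sets open ([steep_open]), and a function with slopes of every size at
    arbitrarily small scale is not differentiable ([steep_not_derivable]).  The
    summand |phi(e^is) - phi(e^it)| costs nothing there, and thanks to it a
    function that is Lipschitz in the variable z = phi(e^it) changes these slopes
    by a bounded amount only, although phi itself need not be Lipschitz.

    For density, one explicit function near a given f belongs to all these sets
    at once ([perturbation]). First f is replaced by its dilation
    f(a + r(z - a)), with a in Omega and r < 1 close to 1. Convexity makes the dilation
    smooth up to the boundary, so that its p-th derivative is Lipschitz on the
    closure of Omega ([dilate_lipschitz]), and compactness makes it close to f
    ([dilate_uniform]). Then a small multiple of H is added, where H^(p) = Lam o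
    psi, psi is the inverse of phi and Lam is the lacunary series sum 8^-k
    w^(N_k). The exponents N_k grow so fast, relative to the modulus of
    continuity of phi, that at scale pi/N_k the oscillation 8^-k of the k-th
    term dominates both the other terms and the displacement of phi(e^it)
    ([lacunary_function]).

    That H exists is a matter of one-variable complex analysis: psi is
    holomorphic ([hol_inverse]), hence so is the uniform limit Lam o psi
    ([weierstrass]), and p successive primitives exist because Omega is convex.
    As Lam o psi and Omega are bounded, the primitives are bounded and Lipschitz
    ([iterated_primitive]), hence extend continuously to the boundary.

    The complex analysis uses only integrals along segments.  Goursat's argument
    gives primitives on convex sets ([holomorphic_primitive]).  A difference
    quotient (F(x) - F(z)) / (x - z) of a twice differentiable F is again
    differentiable at x = z ([slope_at_cder]), so its integral around a square
    vanishes; this is Cauchy's formula ([cauchy_formula]), with the integral of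
    dx / (x - z) around the square in the place of 2 pi i; it does not depend on
    z ([winding_const]) and is not zero ([winding_ge]).  The formula yields the
    differentiability of derivatives ([hol_derive]), removable singularities
    ([removable]) and the isolation of zeros ([zeros_isolated]); the last two
    together give the holomorphy of psi, including at the images of
    possible critical points of phi. *)

(** * Modulus and complex derivative in epsilon-delta form *)

Reserved Notation "mod[ z ]" (format "mod[ z ]").
Notation "mod[ z ]" := (modulus z) : ring_scope.

Section Modulus.
Variable R : realType.
Implicit Types z w : Cx R.

Lemma mod_ge0 z : 0 <= mod[z].
Proof. by case: z => a b; rewrite /modulus /= sqrtr_ge0. Qed.

Lemma normE z : `|z| = (mod[z])%:C%C.
Proof. by []. Qed.

Lemma mod0 : mod[0 : Cx R] = 0.
Proof. exact: Normc.normc0. Qed.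

Lemma mod1 : mod[1 : Cx R] = 1.
Proof. exact: Normc.normc1. Qed.

Lemma mod_eq0 z : mod[z] = 0 -> z = 0.
Proof. exact: Normc.eq0_normc. Qed.

Lemma mod_gt0 z : (0 < mod[z]) = (z != 0).
Proof.
rewrite lt0r mod_ge0 andbT; congr (~~ _); apply/eqP/eqP => [/mod_eq0//|->].
exact: mod0.
Qed.

Lemma modM z w : mod[z * w] = mod[z] * mod[w].
Proof. exact: Normc.normcM. Qed.

Lemma modV z : mod[z^-1] = mod[z]^-1.
Proof. exact: Normc.normcV. Qed.

Lemma modN z : mod[- z] = mod[z].
Proof. exact: normcN. Qed.

Lemma modC z w : mod[z - w] = mod[w - z].
Proof. by rewrite -modN opprB. Qed.

Lemma modD z w : mod[z + w] <= mod[z] + mod[w].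
Proof. exact: le_normcD. Qed.

Lemma modB z w : mod[z - w] <= mod[z] + mod[w].
Proof. by rewrite -(modN w); exact: modD. Qed.

Lemma mod_tri u z w : mod[z - w] <= mod[z - u] + mod[u - w].
Proof. by have := modD (z - u) (u - w); rewrite addrA subrK. Qed.

Lemma mod_triB z w : mod[z] - mod[w] <= mod[z - w].
Proof. by have := modD (z - w) w; rewrite subrK lerBlDr. Qed.

Lemma modX z n : mod[z ^+ n] = mod[z] ^+ n.
Proof. by elim: n => [|n IH]; rewrite ?expr0 ?mod1// !exprS modM IH. Qed.

Lemma modR (x : R) : mod[(x%:C)%C : Cx R] = `|x|.
Proof. by rewrite /modulus /= expr0n /= addr0 sqrtr_sqr. Qed.

Lemma mod_nat n : mod[n%:R : Cx R] = n%:R.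
Proof.
have -> : (n%:R : Cx R) = (n%:R : R)%:C%C by rewrite rmorph_nat.
by rewrite modR ger0_norm.
Qed.

Lemma Re_sub z w : complex.Re (z - w) = complex.Re z - complex.Re w.
Proof. by case: z w => [a b] [c d]. Qed.
Lemma Im_sub z w : complex.Im (z - w) = complex.Im z - complex.Im w.
Proof. by case: z w => [a b] [c d]. Qed.
Lemma Re_add z w : complex.Re (z + w) = complex.Re z + complex.Re w.
Proof. by case: z w => [a b] [c d]. Qed.
Lemma Im_add z w : complex.Im (z + w) = complex.Im z + complex.Im w.
Proof. by case: z w => [a b] [c d]. Qed.
Lemma Re_mul z w : complex.Re (z * w) =
  complex.Re z * complex.Re w - complex.Im z * complex.Im w.
Proof. by case: z w => [a b] [c d]. Qed.
Lemma Im_mul z w : complex.Im (z * w) =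
  complex.Re z * complex.Im w + complex.Im z * complex.Re w.
Proof. by case: z w => [a b] [c d]. Qed.

Lemma Re_le_mod z : `|complex.Re z| <= mod[z].
Proof.
case: z => a b; rewrite /modulus /= -sqrtr_sqr ler_wsqrtr// lerDl.
exact: sqr_ge0.
Qed.

Lemma Im_le_mod z : `|complex.Im z| <= mod[z].
Proof.
case: z => a b; rewrite /modulus /= -sqrtr_sqr ler_wsqrtr// lerDr.
exact: sqr_ge0.
Qed.

Lemma mod_le_ReIm z : mod[z] <= `|complex.Re z| + `|complex.Im z|.
Proof.
case: z => a b; rewrite /modulus /=.
rewrite -[leRHS]ger0_norm ?addr_ge0// -sqrtr_sqr ler_wsqrtr//.
rewrite sqrrD !real_normK ?num_real//.
have : 0 <= `|a| * `|b| *+ 2 by rewrite mulrn_wge0// mulr_ge0.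
lra.
Qed.

Lemma complex_ext z w : complex.Re z = complex.Re w ->
  complex.Im z = complex.Im w -> z = w.
Proof. by case: z w => [a b] [c d] /= -> ->. Qed.

Lemma posC (e : Cx R) : 0 < e -> exists2 e' : R, 0 < e' & e = (e'%:C)%C.
Proof.
case: e => a b; rewrite ltcE /= => /andP[/eqP ->] a0; by exists a.
Qed.

Lemma ltcR' (a b : R) : (((a%:C)%C : Cx R) < (b%:C)%C) = (a < b).
Proof. exact: ltcR. Qed.

Lemma mod_small_eq0 z : (forall e : R, 0 < e -> mod[z] <= e) -> z = 0.
Proof.
move=> h; apply/eqP; apply: contraT; rewrite -mod_gt0 => z0.
have := h (mod[z] / 2); rewrite divr_gt0// => /(_ isT); lra.
Qed.

End Modulus.

Section EpsilonDelta.
Variable R : realType.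
Local Notation C := (Cx R).
Implicit Types (z w : C) (A U : set C) (f g : C -> C).

Definition cball z (r : R) : set C := [set w | mod[w - z] < r].

Definition ccont A f z := forall e : R, 0 < e ->
  exists2 d : R, 0 < d & forall w, A w -> mod[w - z] < d -> mod[f w - f z] < e.

(** Complex differentiability with real-valued error bounds; the norm of [Cx R]
    takes values in [Cx R] itself, which makes estimates against real numbers
    awkward.  The two notions agree by [is_deriveCP]. *)
Definition cder f z (l : C) := forall e : R, 0 < e ->
  exists2 d : R, 0 < d & forall w, mod[w - z] < d ->
    mod[f w - f z - l * (w - z)] <= e * mod[w - z].

Lemma nbhsCP z (P : set C) :
  nbhs z P <-> exists2 e : R, 0 < e & forall w, mod[w - z] < e -> P w.
Proof.
split=> [/nbhs_ballP[e /= /posC[e' e0 ->]] H|[e e0 H]].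
  exists e' => // w wz; apply: H; rewrite -ball_normE /= normE modC ltcR'.
  exact: wz.
apply/nbhs_ballP; exists (e%:C)%C; rewrite /= ?ltcR// => w.
by rewrite -ball_normE /= normE modC ltcR'; exact: H.
Qed.

Lemma cvgCP (T : Type) (F : set_system T) (FF : Filter F) (h : T -> C) (l : C) :
  h @ F --> l <-> forall e : R, 0 < e -> \forall x \near F, mod[h x - l] < e.
Proof.
split=> [/cvgrPdist_lt H e e0|H].
  have := H (e%:C)%C; rewrite ltcR' => /(_ e0).
  by apply: filterS => x; rewrite normE modC ltcR'.
apply/cvgrPdist_lt => _ /posC[e e0 ->].
by have := H e e0; apply: filterS => x; rewrite normE modC ltcR'.
Qed.

Lemma openCP U : open U <->
  forall z, U z -> exists2 e : R, 0 < e & forall w, mod[w - z] < e -> U w.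
Proof.
rewrite openE; split=> [H z /H/nbhsCP//|H z /H Hz]; exact/nbhsCP.
Qed.

Lemma closureCP A z : closure A z <->
  forall e : R, 0 < e -> exists2 w, A w & mod[w - z] < e.
Proof.
split=> [H e e0|H B /nbhsCP[e e0 Be]].
  have /H[w [Aw wB]] : nbhs z (cball z e) by apply/nbhsCP; exists e.
  by exists w.
by have [w Aw wz] := H e e0; exists w; split => //; exact: Be.
Qed.

Lemma within_contP A f : {within A, continuous f} <->
  forall z, A z -> ccont A f z.
Proof.
split=> [/subspace_continuousP H z Az e e0|H].
  have /cvgCP/(_ e e0)/nbhsCP[d d0 Hd] := H z Az.
  by exists d => // w Aw wz; exact: Hd.
apply/subspace_continuousP => z Az; apply/cvgCP => e e0.
have [d d0 Hd] := H z Az e e0; apply/nbhsCP; exists d => // w wz Aw.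
exact: Hd.
Qed.

Lemma is_deriveCP f z l : is_derive z 1 f l <-> cder f z l.
Proof.
have E w : w != 0 -> mod[w^-1 * (f (w + z) - f z) - l] =
    mod[f (w + z) - f z - l * w] / mod[w].
  move=> w0; rewrite -modV -modM; congr modulus.
  by rewrite mulrBl mulfK// mulrC.
have key : (h^-1 *: ((f \o shift z) (h *: (1 : C)) - f z) @[h --> 0^'] --> l) <->
    cder f z l.
  split=> [/cvgCP H e e0|H].
    have /nbhsCP[d d0 Hd] := H e e0.
    exists d => // w wz; have [->|wz0] := eqVneq w z.
      by rewrite !subrr mulr0 subr0 mod0 mulr0.
    have w0 : w - z != 0 by rewrite subr_eq0.
    have := Hd (w - z); rewrite subr0 => /(_ wz w0) /=.
    rewrite -[_ *: 1]/(_ * 1) mulr1 -[_ *: _]/(_ * _) E// subrK.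
    by rewrite ltr_pdivrMr ?mod_gt0// => /ltW.
  apply/cvgCP => e e0; have [|d d0 Hd] := H (e / 2); first by rewrite divr_gt0.
  apply/nbhsCP; exists d => // w; rewrite subr0 => wd w0 /=.
  rewrite -[_ *: 1]/(_ * 1) mulr1 -[_ *: _]/(_ * _) E//.
  have := Hd (w + z); rewrite addrK => /(_ wd).
  rewrite ltr_pdivrMr ?mod_gt0// => /le_lt_trans; apply.
  by rewrite ltr_pM2r ?mod_gt0//; lra.
split=> [[df dv]|H]; first by apply: (proj1 key); rewrite -dv; exact: df.
move: H => /(proj2 key) H.
split; first by apply/cvg_ex; exists l.
exact: (@cvg_lim C).
Qed.

Lemma derivableCP f z : derivable f z 1 <-> exists l, cder f z l.
Proof.
split=> [/derivableP/is_deriveCP H|[l /is_deriveCP[]//]]; by eexists; exact: H.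
Qed.

Lemma derive1_cder f z l : cder f z l -> derive1 f z = l.
Proof. by move=> /is_deriveCP H; rewrite derive1E derive_val. Qed.

Lemma cder_unique f z l l' : cder f z l -> cder f z l' -> l = l'.
Proof. by move=> /derive1_cder <- /derive1_cder <-. Qed.

Lemma cder_ext f g z l U : open U -> U z -> (forall w, U w -> f w = g w) ->
  cder f z l -> cder g z l.
Proof.
move=> /openCP oU Uz fg H e e0; have [d d0 Hd] := H e e0.
have [r r0 Hr] := oU z Uz; exists (Num.min d r); first by rewrite lt_min d0.
by move=> w; rewrite lt_min => /andP[wd wr]; rewrite -!fg ?Hd//; exact: Hr.
Qed.

Lemma cder_cont f z l : cder f z l -> ccont setT f z.
Proof.
move=> /(_ 1 ltr01)[d d0 Hd] e e0.
exists (Num.min d (e / (2 + mod[l]))).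
  by rewrite lt_min d0 divr_gt0// ltr_wpDr ?mod_ge0.
move=> w _; rewrite lt_min => /andP[/Hd H].
have l0 := mod_ge0 l; rewrite ltr_pdivlMr; last by lra.
have := mod_ge0 (w - z); have := modD (f w - f z - l * (w - z)) (l * (w - z)).
rewrite subrK modM; move: H; nra.
Qed.

Lemma ccontW A B f z : B `<=` A -> ccont A f z -> ccont B f z.
Proof.
by move=> BA H e /H[d d0 Hd]; exists d => // w /BA Aw; exact: Hd.
Qed.

Lemma cder_cst c z : cder (fun=> c) z 0.
Proof.
move=> e e0; exists 1 => // w _; rewrite mul0r !subrr mod0.
by rewrite mulr_ge0 ?mod_ge0// ltW.
Qed.

Lemma cder_id z : cder id z 1.
Proof.
move=> e e0; exists 1 => // w _; rewrite mul1r subrr mod0.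
by rewrite mulr_ge0 ?mod_ge0// ltW.
Qed.

Lemma cderD f g z l m : cder f z l -> cder g z m ->
  cder (fun w => f w + g w) z (l + m).
Proof. by move=> /is_deriveCP ? /is_deriveCP ?; apply/is_deriveCP; exact: is_deriveD. Qed.

Lemma cderB f g z l m : cder f z l -> cder g z m ->
  cder (fun w => f w - g w) z (l - m).
Proof. by move=> /is_deriveCP ? /is_deriveCP ?; apply/is_deriveCP; exact: is_deriveB. Qed.

Lemma cderM f g z l m : cder f z l -> cder g z m ->
  cder (fun w => f w * g w) z (l * g z + f z * m).
Proof.
move=> /is_deriveCP ? /is_deriveCP ?; apply/is_deriveCP.
by apply: is_derive_eq; rewrite addrC mulrC.
Qed.

Lemma cderZ f z l c : cder f z l -> cder (fun w => c * f w) z (c * l).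
Proof.
by move=> H; have := cderM (cder_cst c z) H; rewrite mul0r add0r.
Qed.

Lemma cderMr f z l c : cder f z l -> cder (fun w => f w * c) z (l * c).
Proof.
by move=> H; have := cderM H (cder_cst c z); rewrite mulr0 addr0.
Qed.

Lemma cderX f z l n : cder f z l ->
  cder (fun w => f w ^+ n) z (n%:R * f z ^+ n.-1 * l).
Proof.
move=> H; elim: n => [|n IH].
  by rewrite !mul0r; exact: cder_cst.
have := cderM H IH; under [X in cder X]eq_fun do rewrite -exprS.
congr cder; rewrite /=; case: n {IH} => [|n] /=; first by rewrite expr0; ring.
by rewrite exprS -[n.+2%:R]natr1; ring.
Qed.

Lemma cder_comp f g z l m : cder g z m -> cder f (g z) l ->
  cder (f \o g) z (l * m).
Proof.
move=> gm fl e e0.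
pose K := mod[m] + mod[l] + 2.
have l0 := mod_ge0 l; have m0 := mod_ge0 m.
have K0 : 0 < K by rewrite /K; lra.
have [|d1 d10 H1] := fl (Num.min 1 (e / (2 * K))).
  by rewrite lt_min ltr01 divr_gt0// mulr_gt0.
have [d2 d20 H2] := cder_cont gm d10.
have [|d3 d30 H3] := gm (Num.min 1 (e / (2 * K))).
  by rewrite lt_min ltr01 divr_gt0// mulr_gt0.
exists (Num.min d2 d3); first by rewrite lt_min d20.
move=> w; rewrite lt_min => /andP[w2 w3] /=.
have {}H1 := H1 _ (H2 w I w2); have {}H3 := H3 w w3.
have -> : f (g w) - f (g z) - l * m * (w - z) =
  (f (g w) - f (g z) - l * (g w - g z)) + l * (g w - g z - m * (w - z)) by ring.
apply: (le_trans (modD _ _)); rewrite modM.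
have gw : mod[g w - g z] <= (1 + mod[m]) * mod[w - z].
  have := modD (g w - g z - m * (w - z)) (m * (w - z)); rewrite subrK modM.
  have : Num.min 1 (e / (2 * K)) <= 1 by rewrite ge_min lexx.
  have := mod_ge0 (w - z); nra.
set t := Num.min _ _ in H1 H3.
have t0 : 0 <= t by rewrite le_min ler01 divr_ge0// ltW// mulr_gt0.
have tK : t * K <= e / 2.
  have : t <= e / (2 * K) by rewrite ge_min lexx orbT.
  rewrite invfM mulrA ler_pdivlMr//.
have wz := mod_ge0 (w - z).
apply: (@le_trans _ _ (t * ((1 + mod[m]) * mod[w - z]) + mod[l] * (t * mod[w - z]))).
  by apply: lerD; [apply: (le_trans H1); exact: ler_wpM2l|exact: ler_wpM2l].
have -> : t * ((1 + mod[m]) * mod[w - z]) + mod[l] * (t * mod[w - z]) =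
  (t * (K - 1)) * mod[w - z] by rewrite /K; ring.
by rewrite ler_wpM2r//; lra.
Qed.

Lemma cderV z : z != 0 -> cder (fun w => w^-1) z (- z^-2).
Proof.
move=> z0 e e0; have zp : 0 < mod[z] by rewrite mod_gt0.
set r := mod[z] in zp.
exists (Num.min (r / 2) (e * r ^+ 3 / 2)).
  by rewrite lt_min !divr_gt0// mulr_gt0// exprn_gt0.
move=> w; rewrite lt_min => /andP[w1 w2].
have wr : r / 2 <= mod[w].
  have := mod_triB z (z - w); rewrite subKr modC -/r; lra.
have w0 : w != 0 by rewrite -mod_gt0; lra.
have -> : w^-1 - z^-1 - - z^-2 * (w - z) = (w - z) ^+ 2 / (z ^+ 2 * w).
  by field; rewrite w0 z0.
rewrite modM modX modV modM modX -/r expr2 mulrAC ler_wpM2r ?mod_ge0//.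
rewrite ler_pdivrMr; last by rewrite mulr_gt0 ?exprn_gt0//; lra.
apply: (le_trans (ltW w2)); rewrite -mulrA ler_pM2l//.
by rewrite exprSr -mulrA ler_pM2l// exprn_gt0.
Qed.

End EpsilonDelta.

(** * Integrals along segments *)

Section RealParameter.
Variable R : realType.
Local Notation C := (Cx R).

Lemma is_deriveRP (f : R -> R) (z l : R) : is_derive z 1 f l <->
  forall e : R, 0 < e -> exists2 d : R, 0 < d & forall w, `|w - z| < d ->
    `|f w - f z - l * (w - z)| <= e * `|w - z|.
Proof.
have E w : w != 0 -> `|w^-1 * (f (w + z) - f z) - l| =
    `|f (w + z) - f z - l * w| / `|w|.
  move=> w0; rewrite -normfV -normrM; congr Num.norm.
  by rewrite mulrBl mulfK// mulrC.
have key : (h^-1 *: ((f \o shift z) (h *: (1 : R)) - f z) @[h --> 0^'] --> l) <->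
    forall e : R, 0 < e -> exists2 d : R, 0 < d & forall w, `|w - z| < d ->
    `|f w - f z - l * (w - z)| <= e * `|w - z|.
  split=> [/cvgrPdist_lt H e e0|H].
    have /nbhs_ballP[d /= d0 Hd] := H e e0.
    exists d => // w wz; have [->|wz0] := eqVneq w z.
      by rewrite !subrr mulr0 subr0 normr0 mulr0.
    have w0 : w - z != 0 by rewrite subr_eq0.
    have := Hd (w - z); rewrite -ball_normE /= sub0r normrN => /(_ wz w0) /=.
    rewrite -[_ *: 1]/(_ * 1) mulr1 -[_ *: _]/(_ * _) distrC E// subrK.
    by rewrite ltr_pdivrMr ?normr_gt0// => /ltW.
  apply/cvgrPdist_lt => e e0; have [|d d0 Hd] := H (e / 2); first by rewrite divr_gt0.
  apply/nbhs_ballP; exists d => //= w.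
  rewrite -ball_normE /= sub0r normrN => wd w0 /=.
  rewrite -[_ *: 1]/(_ * 1) mulr1 -[_ *: _]/(_ * _) distrC E//.
  have := Hd (w + z); rewrite addrK => /(_ wd).
  rewrite ltr_pdivrMr ?normr_gt0// => /le_lt_trans; apply.
  by rewrite ltr_pM2r ?normr_gt0//; lra.
split=> [[df dv]|H]; first by apply: (proj1 key); rewrite -dv; exact: df.
move: H => /(proj2 key) H.
split; first by apply/cvg_ex; exists l.
exact: (@cvg_lim R).
Qed.

Definition rcder (G : R -> C) (t : R) (l : C) := forall e : R, 0 < e ->
  exists2 d : R, 0 < d & forall s, `|s - t| < d ->
    mod[G s - G t - l * ((s - t)%:C)%C] <= e * `|s - t|.

Lemma rcder_Re G t l : rcder G t l ->
  is_derive t 1 (fun s => complex.Re (G s)) (complex.Re l).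
Proof.
move=> H; apply/is_deriveRP => e /H[d d0 Hd]; exists d => // s /Hd.
move=> /(le_trans (Re_le_mod _)); rewrite !Re_sub Re_mul /= mulr0 subr0.
exact.
Qed.

Lemma rcder_Im G t l : rcder G t l ->
  is_derive t 1 (fun s => complex.Im (G s)) (complex.Im l).
Proof.
move=> H; apply/is_deriveRP => e /H[d d0 Hd]; exists d => // s /Hd.
move=> /(le_trans (Im_le_mod _)); rewrite !Im_sub Im_mul /= mulr0 add0r.
exact.
Qed.

Lemma rcder_ReIm (g h : R -> R) (t : R) (l : C) :
  is_derive t 1 g (complex.Re l) -> is_derive t 1 h (complex.Im l) ->
  rcder (fun s => (g s +i* h s)%C) t l.
Proof.
move=> /is_deriveRP dg /is_deriveRP dh e e0.
have e2 : 0 < e / 2 by rewrite divr_gt0.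
have [d1 d10 H1] := dg _ e2; have [d2 d20 H2] := dh _ e2.
exists (Num.min d1 d2); first by rewrite lt_min d10.
move=> s; rewrite lt_min => /andP[/H1 {}H1 /H2 {}H2].
apply: (le_trans (mod_le_ReIm _)).
rewrite !Re_sub !Im_sub Re_mul Im_mul /= !mulr0 subr0 add0r.
by apply: (le_trans (lerD H1 H2)); rewrite -mulrDl; lra.
Qed.

Lemma rcderD G H t l m : rcder G t l -> rcder H t m ->
  rcder (fun s => G s + H s) t (l + m).
Proof.
move=> dG dH e e0; have e2 : 0 < e / 2 by rewrite divr_gt0.
have [d1 d10 H1] := dG _ e2; have [d2 d20 H2] := dH _ e2.
exists (Num.min d1 d2); first by rewrite lt_min d10.
move=> s; rewrite lt_min => /andP[/H1 {}H1 /H2 {}H2].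
have := modD (G s - G t - l * ((s - t)%:C)%C) (H s - H t - m * ((s - t)%:C)%C).
have -> : forall a b c d x y z : C, a - b - x * z + (c - d - y * z) =
  a + c - (b + d) - (x + y) * z by move=> *; ring.
by move=> /le_trans; apply; apply: (le_trans (lerD H1 H2)); rewrite -mulrDl; lra.
Qed.

Lemma rcderZ G t l c : rcder G t l -> rcder (fun s => c * G s) t (c * l).
Proof.
move=> dG e e0; have c1 : 0 < mod[c] + 1 by have := mod_ge0 c; lra.
have [|d d0 H] := dG (e / (mod[c] + 1)); first by rewrite divr_gt0.
exists d => // s /H {}H.
have -> : c * G s - c * G t - c * l * ((s - t)%:C)%C =
  c * (G s - G t - l * ((s - t)%:C)%C) by ring.
rewrite modM; apply: (le_trans (ler_wpM2l (mod_ge0 _) H)).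
rewrite mulrA ler_wpM2r// mulrA ler_pdivrMr// mulrC ler_pM2l//; lra.
Qed.

Lemma rcder_affine G (al be t : R) l : rcder G (al + be * t) l ->
  rcder (fun s => G (al + be * s)) t (l * (be%:C)%C).
Proof.
move=> dG e e0; have b1 : 0 < `|be| + 1 by have := normr_ge0 be; lra.
have [|d d0 H] := dG (e / (`|be| + 1)); first by rewrite divr_gt0.
exists (d / (`|be| + 1)); first by rewrite divr_gt0.
move=> s; rewrite ltr_pdivlMr// => sd.
have E : al + be * s - (al + be * t) = be * (s - t) by ring.
have := H (al + be * s); rewrite E normrM rmorphM mulrA.
have st := normr_ge0 (s - t); have bb := normr_ge0 be.
move=> /(_ _)/le_trans; apply; first by move: sd; nra.
rewrite mulrA ler_wpM2r// mulrAC ler_pdivrMr// ler_pM2l//; lra.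
Qed.

(** Integrals over [0, 1] are handled as increments G 1 - G 0 of primitives: by the
    mean value theorem the increment is determined by g and bounded by g, and all
    changes of variables become the chain rule. *)
Definition path_prim (g G : R -> C) := forall t : R, 0 <= t <= 1 -> rcder G t (g t).

Lemma mean_value (G : R -> R) (g : R -> R) :
  (forall t : R, 0 <= t <= 1 -> is_derive t 1 G (g t)) ->
  exists2 t, 0 <= t <= 1 & G 1 - G 0 = g t.
Proof.
move=> H.
have [] := @MVT R G g 0 1 ltr01.
- by move=> x; rewrite in_itv /= => /andP[x0 x1]; apply: H; rewrite !ltW.
- apply: derivable_within_continuous => x; rewrite in_itv /= => x01.
  by have [] := H x x01.
move=> c; rewrite in_itv /= => /andP[c0 c1] E; exists c; first by rewrite !ltW.
by rewrite E subr0 mulr1.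
Qed.

Lemma path_prim_bound g G M : path_prim g G ->
  (forall t : R, 0 <= t <= 1 -> mod[g t] <= M) -> mod[G 1 - G 0] <= 2 * M.
Proof.
move=> H gM.
have [t t01 Et] := mean_value (fun s s01 => rcder_Re (H s s01)).
have [s s01 Es] := mean_value (fun s s01 => rcder_Im (H s s01)).
apply: (le_trans (mod_le_ReIm _)); rewrite Re_sub Im_sub Et Es.
have := le_trans (Re_le_mod _) (gM t t01).
have := le_trans (Im_le_mod _) (gM s s01); lra.
Qed.

Lemma path_prim_Im g G m : path_prim g G ->
  (forall t : R, 0 <= t <= 1 -> m <= complex.Im (g t)) -> m <= complex.Im (G 1 - G 0).
Proof.
move=> H gM; have [s s01 Es] := mean_value (fun s s01 => rcder_Im (H s s01)).
by rewrite Im_sub Es; exact: gM.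
Qed.

(** The integrand is extended to the whole line by the 1-Lipschitz retraction [cl] of
    the line onto [0, 1], so that the fundamental theorem of calculus applies at the
    end points too. *)
Lemma real_prim (g : R -> R) : (forall t : R, 0 <= t <= 1 -> {for t, continuous g}) ->
  exists G : R -> R, forall t : R, 0 <= t <= 1 -> is_derive t 1 G (g t).
Proof.
move=> gc; pose cl (t : R) := Num.min 1 (Num.max 0 t).
have clP t : 0 <= cl t <= 1.
  by rewrite le_min ler01 le_max lexx ge_min lexx.
have clE t : 0 <= t <= 1 -> cl t = t.
  by move=> /andP[t0 t1]; rewrite /cl max_r// min_r.
have cl1 s t : `|cl s - cl t| <= `|s - t|.
  rewrite /cl /Num.min /Num.max; case: (ltP 0 s) => ?; case: (ltP 0 t) => ?;
  repeat case: ifPn => ?; rewrite ler_norml; apply/andP; split;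
    have := ler_norm (s - t); have := ler_norm (- (s - t)); rewrite normrN; lra.
pose h := g \o cl.
have hc : continuous h.
  move=> t; apply/cvgrPdist_lt => e e0.
  have /cvgrPdist_lt/(_ e e0)/nbhs_ballP[d /= d0 Hd] := gc _ (clP t).
  apply/nbhs_ballP; exists d => //= s ts; apply: Hd.
  move: ts; rewrite -!ball_normE /=; exact: le_lt_trans.
pose G (x : R) : R := \int[lebesgue_measure]_(t in `[(-1), x]) h t.
exists G => t t01.
have : derivable G t 1 /\ derive1 G t = h t.
  apply: (@continuous_FTC1_closed _ h (-1) t 2).
  - by move: t01; lra.
  - apply: continuous_compact_integrable; first exact: segment_compact.
    exact: continuous_subspaceT.
  - by move: t01; lra.
  - exact: hc.
rewrite derive1E /h /= clE// => -[d E]; rewrite -E; exact/derivableP.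
Qed.

Definition rccont (g : R -> C) (t : R) := forall e : R, 0 < e ->
  exists2 d : R, 0 < d & forall s, `|s - t| < d -> mod[g s - g t] < e.

Lemma continuousRP (h : R -> R) (t : R) : (forall e : R, 0 < e ->
  exists2 d : R, 0 < d & forall s, `|s - t| < d -> `|h s - h t| < e) ->
  {for t, continuous h}.
Proof.
move=> H; suff : h @ nbhs t --> h t by [].
apply/cvgrPdist_lt => e /H[d d0 Hd]; apply/nbhs_ballP; exists d => //= s.
by rewrite -ball_normE /= distrC => /Hd; rewrite distrC.
Qed.

Lemma path_prim_ex g : (forall t : R, 0 <= t <= 1 -> rccont g t) ->
  exists G, path_prim g G.
Proof.
move=> gc.
have [|G1 H1] := @real_prim (fun t => complex.Re (g t)).
  move=> t t01; apply: continuousRP => e /(gc t t01)[d d0 Hd].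
  exists d => // s /Hd; rewrite -Re_sub; exact: le_lt_trans (Re_le_mod _).
have [|G2 H2] := @real_prim (fun t => complex.Im (g t)).
  move=> t t01; apply: continuousRP => e /(gc t t01)[d d0 Hd].
  exists d => // s /Hd; rewrite -Im_sub; exact: le_lt_trans (Im_le_mod _).
exists (fun s => (G1 s +i* G2 s)%C) => t t01.
by apply: rcder_ReIm; [exact: H1|exact: H2].
Qed.

End RealParameter.

Section SegmentIntegral.
Variable R : realType.
Local Notation C := (Cx R).
Implicit Types (a b c z : C) (f g F : C -> C).

Definition seg a b (t : R) : C := a + (t%:C)%C * (b - a).

Lemma seg0 a b : seg a b 0 = a. Proof. by rewrite /seg mul0r addr0. Qed.
Lemma seg1 a b : seg a b 1 = b. Proof. by rewrite /seg mul1r addrC subrK. Qed.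

Lemma seg_rev a b t : seg b a t = seg a b (1 - t).
Proof. by rewrite /seg rmorphB /= rmorph1; ring. Qed.

Lemma seg_dist a b z (t : R) : 0 <= t <= 1 ->
  mod[seg a b t - z] <= (1 - t) * mod[a - z] + t * mod[b - z].
Proof.
move=> /andP[t0 t1].
have -> : seg a b t - z = ((1 - t)%:C)%C * (a - z) + (t%:C)%C * (b - z).
  by rewrite /seg rmorphB /= rmorph1; ring.
apply: (le_trans (modD _ _)); rewrite !modM !modR.
by rewrite (ger0_norm t0) ger0_norm ?subr_ge0.
Qed.

Lemma seg_dist_sum a b z (t : R) : 0 <= t <= 1 ->
  mod[seg a b t - z] <= mod[a - z] + mod[b - z].
Proof.
move=> t01; apply: (le_trans (seg_dist _ _ _ t01)).
by have := mod_ge0 (a - z); have := mod_ge0 (b - z); move: t01; nra.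
Qed.

Definition seg_prim f a b := path_prim (fun t => f (seg a b t) * (b - a)).

(** The integral of f(z) dz over the segment from a to b. *)
Definition segint f a b : C :=
  xget 0 [set v | exists2 G, seg_prim f a b G & v = G 1 - G 0].

Definition seg_cont f a b := forall t : R, 0 <= t <= 1 ->
  ccont setT f (seg a b t).

Lemma path_prim_unique (R' := R) (g G H : R' -> C) :
  path_prim g G -> path_prim g H -> G 1 - G 0 = H 1 - H 0.
Proof.
move=> pG pH; apply/eqP; rewrite -subr_eq0; apply/eqP/mod_small_eq0 => e e0.
have pp : path_prim (fun=> 0) (fun s => G s + -1 * H s).
  move=> t t01; have := rcderD (pG t t01) (rcderZ (-1) (pH t t01)).
  by rewrite mulN1r subrr.
have := path_prim_bound pp (M := 0).
rewrite mulr0 mod0 !mulN1r => /(_ (fun _ _ => lexx _)) h.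
apply: le_trans (ltW e0); move: h; rewrite le_eqVlt.
have -> // : G 1 - G 0 - (H 1 - H 0) = G 1 - H 1 - (G 0 - H 0) by ring.
by rewrite le_eqVlt.
Qed.

Lemma segintE f a b G : seg_prim f a b G -> segint f a b = G 1 - G 0.
Proof.
move=> pG; rewrite /segint; case: xgetP => [v _ [H pH ->]|/(_ (G 1 - G 0))[]].
  exact: path_prim_unique pH pG.
by exists G.
Qed.

Lemma rcder_seg F a b t l : cder F (seg a b t) l ->
  rcder (F \o seg a b) t (l * (b - a)).
Proof.
move=> H e e0; have b1 : 0 < mod[b - a] + 1 by have := mod_ge0 (b - a); lra.
have [|d d0 Hd] := H (e / (mod[b - a] + 1)); first by rewrite divr_gt0.
exists (d / (mod[b - a] + 1)); first by rewrite divr_gt0.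
move=> s; rewrite ltr_pdivlMr// => sd.
have E : seg a b s - seg a b t = (b - a) * ((s - t)%:C)%C.
  by rewrite /seg rmorphB /=; ring.
have := Hd (seg a b s); rewrite E modM modR mulrA.
have st := normr_ge0 (s - t); have bb := mod_ge0 (b - a).
move=> /(_ _)/le_trans; apply; first by move: sd; nra.
rewrite mulrA ler_wpM2r// mulrAC ler_pdivrMr// ler_pM2l//; lra.
Qed.

Lemma rccont_seg f a b t : ccont setT f (seg a b t) ->
  rccont (fun s => f (seg a b s) * (b - a)) t.
Proof.
move=> H e e0; have b1 : 0 < mod[b - a] + 1 by have := mod_ge0 (b - a); lra.
have [|d d0 Hd] := H (e / (mod[b - a] + 1)); first by rewrite divr_gt0.
exists (d / (mod[b - a] + 1)); first by rewrite divr_gt0.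
move=> s; rewrite ltr_pdivlMr// => sd.
have E : seg a b s - seg a b t = (b - a) * ((s - t)%:C)%C.
  by rewrite /seg rmorphB /=; ring.
have := Hd (seg a b s) I; rewrite E modM modR -mulrBl modM ltr_pdivlMr//.
have st := normr_ge0 (s - t); have bb := mod_ge0 (b - a).
have ff := mod_ge0 (f (seg a b s) - f (seg a b t)).
move=> /(_ _)H1; apply: le_lt_trans (H1 _); last by move: sd; nra.
by rewrite ler_wpM2l//; lra.
Qed.

Lemma seg_prim_ex f a b : seg_cont f a b -> exists G, seg_prim f a b G.
Proof. by move=> H; apply: path_prim_ex => t /H; exact: rccont_seg. Qed.

Lemma segint_FTC F f a b :
  (forall t : R, 0 <= t <= 1 -> cder F (seg a b t) (f (seg a b t))) ->
  segint f a b = F b - F a.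
Proof.
move=> H; rewrite (@segintE _ _ _ (F \o seg a b)) /= ?seg0 ?seg1//.
by move=> t t01; exact/rcder_seg/H.
Qed.

Lemma segint_rev f a b : seg_cont f a b -> segint f b a = - segint f a b.
Proof.
move=> /seg_prim_ex[G pG]; rewrite (segintE pG).
rewrite (@segintE _ _ _ (fun t => G (1 + (-1) * t))).
  by rewrite mulr0 addr0 mulr1 subrr opprB.
move=> t t01; have := @rcder_affine _ G 1 (-1) t; rewrite /seg_prim.
have -> : f (seg b a t) * (a - b) =
    f (seg a b (1 + -1 * t)) * (b - a) * ((-1)%:C)%C.
  by rewrite seg_rev mulN1r rmorphN /= rmorph1; ring.
by apply; apply: pG; move: t01; lra.
Qed.

Lemma half_C : ((2^-1 : R)%:C)%C = 2^-1 :> C.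
Proof. by rewrite fmorphV rmorph_nat. Qed.

Definition mid a b : C := (a + b) / 2.

Lemma segint_mid f a b : seg_cont f a b ->
  segint f a b = segint f a (mid a b) + segint f (mid a b) b.
Proof.
move=> /seg_prim_ex[G pG]; rewrite (segintE pG).
rewrite (@segintE _ _ (mid a b) (fun t => G (0 + 2^-1 * t))); last first.
  move=> t t01; have := @rcder_affine _ G 0 2^-1 t; rewrite /seg_prim.
  have -> : f (seg a (mid a b) t) * (mid a b - a) =
      f (seg a b (0 + 2^-1 * t)) * (b - a) * ((2^-1)%:C)%C.
    rewrite add0r /seg /mid rmorphM /= half_C.
    by rewrite -mulrA; congr (f _ * _); field.
  by apply; apply: pG; move: t01; lra.
rewrite (@segintE _ (mid a b) b (fun t => G (2^-1 + 2^-1 * t))); last first.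
  move=> t t01; have := @rcder_affine _ G 2^-1 2^-1 t; rewrite /seg_prim.
  have -> : f (seg (mid a b) b t) * (b - mid a b) =
      f (seg a b (2^-1 + 2^-1 * t)) * (b - a) * ((2^-1)%:C)%C.
    rewrite /seg /mid rmorphD rmorphM /= half_C.
    by rewrite -mulrA; congr (f _ * _); field.
  by apply; apply: pG; move: t01; lra.
rewrite !mulr0 !mulr1 !addr0 add0r.
have -> : 2^-1 + 2^-1 = 1 :> R by field.
by rewrite [RHS]addrC subrKA.
Qed.

Lemma segint_lin f g a b c : seg_cont f a b -> seg_cont g a b ->
  segint (fun z => f z + c * g z) a b = segint f a b + c * segint g a b.
Proof.
move=> /seg_prim_ex[G pG] /seg_prim_ex[H pH].
rewrite (segintE pG) (segintE pH) (@segintE _ _ _ (fun t => G t + c * H t)).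
  by ring.
move=> t t01; have := rcderD (pG t t01) (rcderZ c (pH t t01)).
by rewrite mulrA -mulrDl.
Qed.

Lemma segint_bound f a b M : seg_cont f a b ->
  (forall t : R, 0 <= t <= 1 -> mod[f (seg a b t)] <= M) ->
  mod[segint f a b] <= 2 * M * mod[b - a].
Proof.
move=> /seg_prim_ex[G pG] fM; rewrite (segintE pG) -mulrA.
apply: (path_prim_bound pG) => t t01.
by rewrite modM ler_wpM2r ?mod_ge0//; exact: fM.
Qed.

Lemma segint_ext f g a b :
  (forall t : R, 0 <= t <= 1 -> f (seg a b t) = g (seg a b t)) ->
  segint f a b = segint g a b.
Proof.
move=> fg; rewrite /segint; congr xget; apply/seteqP; split => v [G pG ->];
  exists G => // t t01; have := pG t t01; rewrite fg//.
Qed.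

End SegmentIntegral.

(** * Goursat's theorem *)

Section Goursat.
Variable R : realType.
Local Notation C := (Cx R).
Implicit Types (a b c z : C) (f g F : C -> C) (U : set C).

Definition seg_convex U := forall a b (t : R), U a -> U b -> 0 <= t <= 1 ->
  U (seg a b t).

Definition cont_on U f := forall z, U z -> ccont setT f z.

Definition tri f a b c := segint f a b + segint f b c + segint f c a.

Lemma seg_cont_in U f a b : seg_convex U -> cont_on U f -> U a -> U b ->
  seg_cont f a b.
Proof. by move=> cU fc Ua Ub t t01; apply: fc; exact: cU. Qed.

Lemma mid_seg a b : mid a b = seg a b 2^-1.
Proof.
by rewrite /mid /seg half_C; field.
Qed.

Lemma mid_in U a b : seg_convex U -> U a -> U b -> U (mid a b).
Proof. by move=> cU Ua Ub; rewrite mid_seg; apply: cU => //; lra. Qed.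

Lemma tri_subdivide U f a b c : seg_convex U -> cont_on U f ->
  U a -> U b -> U c ->
  tri f a b c = tri f a (mid a b) (mid a c) + tri f (mid a b) b (mid b c) +
    tri f (mid a c) (mid b c) c + tri f (mid b c) (mid a c) (mid a b).
Proof.
move=> cU fc Ua Ub Uc; have sc := seg_cont_in cU fc.
have Uab := mid_in cU Ua Ub; have Ubc := mid_in cU Ub Uc.
have Uac := mid_in cU Ua Uc.
rewrite /tri (segint_mid (sc _ _ Ua Ub)) (segint_mid (sc _ _ Ub Uc)).
rewrite (segint_rev (sc _ _ Ua Uc)) (segint_mid (sc _ _ Ua Uc)).
rewrite (segint_rev (sc _ _ Uac Uc)) (segint_rev (sc _ _ Ua Uac)).
rewrite (segint_rev (sc _ _ Uab Uac)) (segint_rev (sc _ _ Uac Ubc)).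
by rewrite (segint_rev (sc _ _ Uab Ubc)); ring.
Qed.

Lemma tri_lin U f g a b c k : seg_convex U -> cont_on U f -> cont_on U g ->
  U a -> U b -> U c ->
  tri (fun z => f z + k * g z) a b c = tri f a b c + k * tri g a b c.
Proof.
move=> cU fc gc Ua Ub Uc; have sf := seg_cont_in cU fc.
have sg := seg_cont_in cU gc; rewrite /tri.
rewrite (segint_lin _ (sf _ _ Ua Ub) (sg _ _ Ua Ub)).
rewrite (segint_lin _ (sf _ _ Ub Uc) (sg _ _ Ub Uc)).
by rewrite (segint_lin _ (sf _ _ Uc Ua) (sg _ _ Uc Ua)); ring.
Qed.

Lemma tri_FTC U f F a b c : seg_convex U -> (forall z, U z -> cder F z (f z)) ->
  U a -> U b -> U c -> tri f a b c = 0.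
Proof.
move=> cU dF Ua Ub Uc; rewrite /tri.
have H x y : U x -> U y -> segint f x y = F y - F x.
  by move=> Ux Uy; apply: segint_FTC => t t01; apply: dF; exact: cU.
by rewrite !H//; ring.
Qed.

Lemma tri_bound U f a b c M : seg_convex U -> cont_on U f ->
  U a -> U b -> U c ->
  (forall z x y (t : R), [\/ x = a, x = b | x = c] -> [\/ y = a, y = b | y = c] ->
    0 <= t <= 1 -> z = seg x y t -> mod[f z] <= M) ->
  mod[tri f a b c] <= 2 * M * (mod[b - a] + mod[c - b] + mod[a - c]).
Proof.
move=> cU fc Ua Ub Uc fM; have sf := seg_cont_in cU fc; rewrite /tri.
apply: (le_trans (modD _ _)).
apply: (le_trans (lerD (modD _ _) (lexx _))); rewrite !mulrDr.
apply: lerD; first apply: lerD; apply: segint_bound; try exact: sf;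
  move=> t t01.
- by apply: fM t01 erefl; [constructor 1|constructor 2].
- by apply: fM t01 erefl; [constructor 2|constructor 3].
- by apply: fM t01 erefl; [constructor 3|constructor 1].
Qed.

(** The intervals of centre x n and radius e n are nested, so they have a common point.
    It serves both for the nested triangles below and for the sum of a series. *)
Lemma nested_limit (x e : nat -> R) : (forall n, 0 <= e n) ->
  (forall n, `|x n.+1 - x n| <= e n - e n.+1) ->
  exists l, forall n, `|l - x n| <= e n.
Proof.
move=> e0 H.
have lo n k : x n - e n <= x (n + k)%N - e (n + k)%N.
  elim: k => [|k IH]; first by rewrite addn0.
  apply: (le_trans IH); rewrite addnS; have := H (n + k)%N.
  by rewrite ler_norml; lra.
have hi n k : x (n + k)%N + e (n + k)%N <= x n + e n.
  elim: k => [|k IH]; first by rewrite addn0.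
  apply: le_trans IH; rewrite addnS; have := H (n + k)%N.
  by rewrite ler_norml; lra.
have lohi m n : x m - e m <= x n + e n.
  apply: (le_trans (lo m n)); rewrite addnC; apply: le_trans (hi n m).
  by have := e0 (n + m)%N; lra.
pose A := [set x n - e n | n in setT].
have A0 : A !=set0 by exists (x 0%N - e 0%N), 0%N.
exists (sup A) => n; rewrite ler_norml; apply/andP; split; last first.
  by rewrite lerBlDl; apply: ge_sup => // _ [m _ <-].
have : x n - e n <= sup A; last by lra.
apply: ub_le_sup; last by exists n.
by exists (x 0%N + e 0%N) => _ [m _ <-].
Qed.

Lemma pow_half_small (y : R) : 0 < y -> exists n, (2^-1 : R) ^+ n < y.
Proof.
move=> y0; have := @cvg_expr R 2^-1; rewrite ger0_norm ?invr_ge0//.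
rewrite invf_lt1// ltr1n => /(_ isT)/cvgrPdist_lt/(_ y y0)[n _ Hn].
exists n; have := Hn n (leqnn n).
by rewrite /= sub0r normrN ger0_norm ?exprn_ge0 ?invr_ge0.
Qed.

Section Triangle.
Variables (U : set C) (f : C -> C).
Hypothesis cU : seg_convex U.
Hypothesis fd : forall z, U z -> exists l, cder f z l.

Let fc : cont_on U f.
Proof. by move=> z /fd[l]; exact: cder_cont. Qed.

Variables a u v : C.
(** Repeated bisection of a triangle with edges u and v only produces homothetic copies
    of it: [subtri (s, t, h)] is the integral over the copy with vertex [pt s t] and
    ratio h, which is negative for a middle triangle.  In real
    coordinates the limit point is found by nested intervals. *)
Definition pt (s t : R) : C := a + (s%:C)%C * u + (t%:C)%C * v.
Definition simplex (s t : R) := [&& 0 <= s, 0 <= t & s + t <= 1].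
Hypothesis Upt : forall s t, simplex s t -> U (pt s t).

Definition subtri (x : R * R * R) : C :=
  tri f (pt x.1.1 x.1.2) (pt (x.1.1 + x.2) x.1.2) (pt x.1.1 (x.1.2 + x.2)).

Definition in_simplex (x : R * R * R) :=
  [/\ simplex x.1.1 x.1.2, simplex (x.1.1 + x.2) x.1.2 &
      simplex x.1.1 (x.1.2 + x.2)].

Lemma mid_pt s t s' t' : mid (pt s t) (pt s' t') = pt ((s + s') / 2) ((t + t') / 2).
Proof.
by rewrite /mid /pt !rmorphM !rmorphD /= half_C; field.
Qed.

Lemma in_simplex_children s t h : in_simplex (s, t, h) ->
  [/\ in_simplex (s, t, h / 2), in_simplex (s + h / 2, t, h / 2),
      in_simplex (s, t + h / 2, h / 2) &
      in_simplex (s + h / 2, t + h / 2, - (h / 2))].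
Proof.
case=> /and3P[/= ? ? ?] /and3P[? _ ?] /and3P[_ ? ?].
by split; split; apply/and3P; split => /=; lra.
Qed.

Lemma subtri_subdivide s t h : in_simplex (s, t, h) ->
  subtri (s, t, h) = subtri (s, t, h / 2) + subtri (s + h / 2, t, h / 2) +
    subtri (s, t + h / 2, h / 2) + subtri (s + h / 2, t + h / 2, - (h / 2)).
Proof.
case=> /= i0 i1 i2; rewrite /subtri /=.
rewrite (tri_subdivide cU fc (Upt i0) (Upt i1) (Upt i2)) !mid_pt.
have E (x : R) : (x + x) / 2 = x by lra.
have F (x : R) : (x + (x + h)) / 2 = x + h / 2 by lra.
have G (x : R) : (x + h + x) / 2 = x + h / 2 by lra.
have H (x : R) : x + h / 2 + h / 2 = x + h by lra.
by rewrite !E !F !G !H !addrK.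
Qed.

(** One of the four pieces carries at least a quarter of the integral, and the square of
    the ratio is divided by four as well. *)
Lemma goursat_step K x : in_simplex x -> K * x.2 ^+ 2 < mod[subtri x] ->
  exists y, [/\ in_simplex y, K * y.2 ^+ 2 < mod[subtri y],
    `|y.2| = `|x.2| / 2, `|y.1.1 - x.1.1| <= `|x.2| / 2 &
    `|y.1.2 - x.1.2| <= `|x.2| / 2].
Proof.
case: x => [[s t] h] ix Kx; apply: contrapT => /forallNP noy.
have n2 : `|h / 2| = `|h| / 2 by rewrite normrM [`|2^-1|]ger0_norm// invr_ge0.
have h0 : 0 <= `|h| / 2 by rewrite divr_ge0.
have small y : in_simplex y -> `|y.2| = `|h| / 2 ->
    `|y.1.1 - s| <= `|h| / 2 -> `|y.1.2 - t| <= `|h| / 2 ->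
    mod[subtri y] <= K * (h ^+ 2 / 4).
  move=> iy y1 y2 y3; rewrite leNgt; apply/negP => big; apply: (noy y); split => //.
  rewrite -(real_normK (num_real y.2)) y1 exprMn real_normK ?num_real//.
  by rewrite exprVn; have -> : 2 ^+ 2 = 4 :> R by rewrite -natrX.
have [i1 i2 i3 i4] := in_simplex_children ix.
have d1 (x : R) : `|x - x| <= `|h| / 2 by rewrite subrr normr0.
have d2 (x : R) : `|x + h / 2 - x| <= `|h| / 2 by rewrite [x + _]addrC addrK n2.
have := small _ i1 n2 (d1 _) (d1 _); have := small _ i2 n2 (d2 _) (d1 _).
have := small _ i3 n2 (d1 _) (d2 _).
have := small _ i4 (etrans (normrN _) n2) (d2 _) (d2 _).
move: Kx; rewrite (subtri_subdivide ix) /=.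
have M4 (x y z w : C) : mod[x + y + z + w] <= mod[x] + mod[y] + mod[z] + mod[w].
  apply: (le_trans (modD _ _)).
  apply: (le_trans (lerD (modD _ _) (lexx _))).
  exact: (le_trans (lerD (lerD (modD _ _) (lexx _)) (lexx _))).
have := M4 (subtri (s, t, h / 2)) (subtri (s + h / 2, t, h / 2))
  (subtri (s, t + h / 2, h / 2)) (subtri (s + h / 2, t + h / 2, - (h / 2))).
set A := mod[_ + _]; set B := K * _; have -> : K * (h ^+ 2 / 4) = B / 4.
  by rewrite mulrA.
clear; move=> ? ? ? ? ? ?; lra.
Qed.

Lemma pt_dist s t s' t' :
  mod[pt s t - pt s' t'] <= `|s - s'| * mod[u] + `|t - t'| * mod[v].
Proof.
have -> : pt s t - pt s' t' = ((s - s')%:C)%C * u + ((t - t')%:C)%C * v.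
  by rewrite /pt !rmorphB /=; ring.
by apply: (le_trans (modD _ _)); rewrite !modM !modR.
Qed.

(** Near z the function f differs from its affine approximation, whose integral vanishes,
    by a small multiple of the distance to z. *)
Lemma tri_small z (K : R) : U z -> 0 < K -> exists2 d : R, 0 < d &
  forall p q w r, U p -> U q -> U w -> r < d ->
    mod[p - z] <= r -> mod[q - z] <= r -> mod[w - z] <= r ->
    mod[tri f p q w] <= K * r ^+ 2.
Proof.
move=> Uz K0; have [l dl] := fd Uz.
have [|d d0 Hd] := dl (K / 24); first by rewrite divr_gt0.
exists (d / 2); first by rewrite divr_gt0.
move=> p1 p2 p3 r U1 U2 U3 rd n1 n2 n3.
have r0 : 0 <= r := le_trans (mod_ge0 _) n1.
have near p : [\/ p = p1, p = p2 | p = p3] -> mod[p - z] <= r by case=> ->.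
pose A w := f z + l * (w - z).
have dA w : cder A w (0 + l * (1 - 0)).
  apply: cderD; first exact: cder_cst.
  by apply: cderZ; apply: cderB; [exact: cder_id|exact: cder_cst].
have Ac : cont_on U A by move=> w _; exact: cder_cont (dA w).
have TA : tri A p1 p2 p3 = 0.
  apply: (tri_FTC (U := U) (F := fun w => f z * w + l * ((w - z) ^+ 2 / 2))) => //.
  move=> w _.
  have -> : A w = f z * 1 + l * (2^-1 * (2%:R * (w - z) ^+ 1 * (1 - 0))).
    by rewrite /A; field.
  apply: cderD; first by apply: cderZ; exact: cder_id.
  apply: cderZ; under [X in cder X]eq_fun do rewrite mulrC.
  apply: cderZ.
  by apply: cderX; apply: cderB; [exact: cder_id|exact: cder_cst].
have -> : tri f p1 p2 p3 = tri (fun w => f w + -1 * A w) p1 p2 p3.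
  by rewrite (tri_lin _ cU)// TA mulr0 addr0.
apply: le_trans (_ : _ <= 2 * (K / 24 * (2 * r)) *
    (mod[p2 - p1] + mod[p3 - p2] + mod[p1 - p3])) _.
  apply: (tri_bound cU) => //.
    move=> w Uw; have [m dm] := fd Uw.
    by apply: cder_cont; apply: cderD dm _; apply: cderZ; exact: dA.
  move=> w p q th hp hq th01 ->.
  have dw : mod[seg p q th - z] <= 2 * r.
    apply: (le_trans (seg_dist_sum _ _ _ th01)).
    by rewrite mulr_natl mulr2n lerD// near.
  have -> : forall y, f y + -1 * A y = f y - f z - l * (y - z).
    by move=> y; rewrite /A; ring.
  apply: le_trans (Hd _ _) _; last by rewrite ler_wpM2l// ltW// divr_gt0.
  by apply: (le_lt_trans dw); move: rd; lra.
have H p q : [\/ p = p1, p = p2 | p = p3] -> [\/ q = p1, q = p2 | q = p3] ->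
    mod[p - q] <= 2 * r.
  move=> hp hq; apply: (le_trans (mod_tri z _ _)); rewrite (modC z).
  by rewrite mulr_natl mulr2n lerD// near.
have := H p2 p1 (Or32 _ _ erefl) (Or31 _ _ erefl).
have := H p3 p2 (Or33 _ _ erefl) (Or32 _ _ erefl).
have := H p1 p3 (Or31 _ _ erefl) (Or33 _ _ erefl).
set x1 := mod[_]; set x2 := mod[_]; set x3 := mod[_] => h1 h2 h3.
have Kr : 0 <= K * r by rewrite mulr_ge0// ltW.
have {h1 h2 h3} : x3 + x2 + x1 <= 6 * r by lra.
move=> hx; have -> : 2 * (K / 24 * (2 * r)) = K * r / 6 by field.
apply: le_trans (ler_wpM2l _ hx) _; first by rewrite divr_ge0.
by have -> : K * r / 6 * (6 * r) = K * r ^+ 2 by field.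
Qed.

Lemma goursat_nested K : K < mod[subtri (0, 0, 1)] ->
  exists2 st : R * R, simplex st.1 st.2 & forall n, exists x : R * R * R,
    [/\ in_simplex x, K * x.2 ^+ 2 < mod[subtri x], `|x.2| = 2^-1 ^+ n,
        `|st.1 - x.1.1| <= 2^-1 ^+ n & `|st.2 - x.1.2| <= 2^-1 ^+ n].
Proof.
move=> KT.
pose good x := in_simplex x /\ K * x.2 ^+ 2 < mod[subtri x].
have nextP (x : {x | good x}) : exists y : {y | good y},
    [/\ `|(sval y).2| = `|(sval x).2| / 2,
    `|(sval y).1.1 - (sval x).1.1| <= `|(sval x).2| / 2 &
    `|(sval y).1.2 - (sval x).1.2| <= `|(sval x).2| / 2].
  case: x => x [ix Kx]; have [y [iy Ky y1 y2 y3]] := goursat_step ix Kx.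
  by exists (exist _ y (conj iy Ky)).
have g0 : good (0, 0, 1).
  split; last by rewrite /= expr1n mulr1.
  by split; rewrite /= /simplex ?addr0 ?add0r ?lexx ?ler01.
pose x n := sval (iter n (fun x => projT1 (cid (nextP x))) (exist _ _ g0)).
have xg n : good (x n) by rewrite /x; case: (iter _ _ _).
have xS n : [/\ `|(x n.+1).2| = `|(x n).2| / 2,
    `|(x n.+1).1.1 - (x n).1.1| <= `|(x n).2| / 2 &
    `|(x n.+1).1.2 - (x n).1.2| <= `|(x n).2| / 2].
  by rewrite /x iterS; case: cid.
have x0 : `|(x 0%N).2| = 1 by rewrite normr1.
clearbody x; clear g0 nextP.
have xh n : `|(x n).2| = 2^-1 ^+ n.
  elim: n => [|n IH]; first by rewrite x0 expr0.
  by have [-> _ _] := xS n; rewrite IH exprS mulrC.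
have e0 n : 0 <= 2^-1 ^+ n :> R by rewrite exprn_ge0// invr_ge0.
have half n : 2^-1 ^+ n / 2 = 2^-1 ^+ n - 2^-1 ^+ n.+1 :> R.
  by rewrite exprS mulrC -{2}[_ ^+ n]mul1r -mulrBl; congr (_ * _); lra.
have [s Hs] : exists s, forall n, `|s - (x n).1.1| <= 2^-1 ^+ n.
  apply: (@nested_limit (fun n => (x n).1.1)) => // n.
  by have [_ + _] := xS n; rewrite xh half.
have [t Ht] : exists s, forall n, `|s - (x n).1.2| <= 2^-1 ^+ n.
  apply: (@nested_limit (fun n => (x n).1.2)) => // n.
  by have [_ _] := xS n; rewrite xh half.
exists (s, t) => /=; last first.
  by move=> n; exists (x n); have [] := xg n; split.
have le0 (y z : nat -> R) (l : R) : (forall n, 0 <= y n) ->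
    (forall n, `|l - y n| <= 2 * 2^-1 ^+ n) -> 0 <= l.
  move=> y0 yl; rewrite leNgt; apply/negP => l0.
  have [|n] := pow_half_small (_ : 0 < - l / 2); first by lra.
  by have := yl n; have := y0 n; rewrite ler_norml; lra.
rewrite /simplex; apply/and3P; split.
- apply: (le0 (fun n => (x n).1.1)) => // n.
    by have [[/and3P[? _ _] _ _] _] := xg n.
  by apply: (le_trans (Hs n)); have := e0 n; lra.
- apply: (le0 (fun n => (x n).1.2)) => // n.
    by have [[/and3P[_ ? _] _ _] _] := xg n.
  by apply: (le_trans (Ht n)); have := e0 n; lra.
- rewrite -subr_ge0.
  apply: (le0 (fun n => 1 - ((x n).1.1 + (x n).1.2))) => // n.
    by have [[/and3P[_ _ ?] _ _] _] := xg n; rewrite subr_ge0.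
  have -> : 1 - (s + t) - (1 - ((x n).1.1 + (x n).1.2)) =
    - (s - (x n).1.1) - (t - (x n).1.2) by ring.
  apply: (le_trans (ler_normB _ _)); rewrite normrN mulr_natl mulr2n.
  by apply: lerD.
Qed.

Lemma goursat_simplex : subtri (0, 0, 1) = 0.
Proof.
apply/eqP; apply: contraT; rewrite -mod_gt0 => T0.
have [|[s t] /= st H] := @goursat_nested (mod[subtri (0, 0, 1)] / 2); first by lra.
set K := mod[_] / 2 in H.
have K0 : 0 < K by rewrite divr_gt0.
pose L := mod[u] + mod[v]; have L0 : 0 <= L by rewrite addr_ge0// mod_ge0.
have L1 : 0 < 2 * L + 1 by lra.
have [|d d0 Hd] := tri_small (Upt st) (_ : 0 < K / (2 * L + 1) ^+ 2).
  by rewrite divr_gt0// exprn_gt0.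
have [|n Hn] := pow_half_small (_ : 0 < d / (2 * L + 1)); first by rewrite divr_gt0.
have [x [[i1 i2 i3] big xh Hs Ht]] := H n.
set r := (2^-1 : R) ^+ n in Hn xh Hs Ht.
have r0 : 0 <= r by rewrite exprn_ge0// invr_ge0.
have near (s' t' : R) : `|s' - s| <= 2 * r -> `|t' - t| <= 2 * r ->
    mod[pt s' t' - pt s t] <= r * (2 * L + 1).
  move=> h1 h2; apply: (le_trans (pt_dist _ _ _ _)).
  apply: (@le_trans _ _ (2 * r * mod[u] + 2 * r * mod[v])).
    by apply: lerD; rewrite ler_wpM2r// mod_ge0.
  have -> : 2 * r * mod[u] + 2 * r * mod[v] = r * (2 * L) by rewrite /L; ring.
  by rewrite ler_wpM2l// lerDl.
have dx (y y' : R) : `|y - y'| <= r -> `|y' - y| <= 2 * r.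
  by rewrite distrC => /le_trans; apply; rewrite mulr_natl mulr2n lerDl.
have dxh (y y' : R) : `|y - y'| <= r -> `|y' + x.2 - y| <= 2 * r.
  rewrite distrC addrAC => h; apply: (le_trans (ler_normD _ _)).
  by rewrite xh mulr_natl mulr2n lerD2r.
move: Hn; rewrite ltr_pdivlMr// => Hn.
have := Hd _ _ _ _ (Upt i1) (Upt i2) (Upt i3) Hn
  (near _ _ (dx _ _ Hs) (dx _ _ Ht)) (near _ _ (dxh _ _ Hs) (dx _ _ Ht))
  (near _ _ (dx _ _ Hs) (dxh _ _ Ht)).
rewrite exprMn mulrCA divfK ?expf_neq0 ?gt_eqF// mulrC => small.
have : K * r ^+ 2 < K * r ^+ 2; last by rewrite ltxx.
by apply: lt_le_trans small; move: big; rewrite -(real_normK (num_real x.2)) xh.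
Qed.

End Triangle.

Theorem goursat U f a b c : seg_convex U -> (forall z, U z -> exists l, cder f z l) ->
  U a -> U b -> U c -> tri f a b c = 0.
Proof.
move=> cU fd Ua Ub Uc.
have := @goursat_simplex U f cU fd a (b - a) (c - a).
rewrite /subtri /pt /= !add0r !mul0r !mul1r !addr0 ![a + _]addrC !subrK.
apply=> s t /and3P[s0 t0 st].
have [st0|st0] := eqVneq (s + t) 0.
  have [-> ->] : s = 0 /\ t = 0 by split; lra.
  by rewrite !mul0r !addr0.
have stp : 0 < s + t by rewrite lt0r st0; lra.
have -> : a + (s%:C)%C * (b - a) + (t%:C)%C * (c - a) =
    seg a (seg b c (t / (s + t))) (s + t).
  rewrite /seg rmorphM fmorphV !rmorphD /=; field.
  by rewrite -rmorphD /=; apply: contra_neq st0; move=> [].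
apply: (cU) => //; last by lra.
by apply: cU => //; rewrite divr_ge0// ?ler_pdivrMr//; lra.
Qed.

(** The primitive is the integral along the segment from a fixed base point; the vanishing
    of the integral over a triangle turns its increment from z to w into the integral over
    the segment from z to w. *)
Lemma triangle_primitive U f : open U -> seg_convex U -> cont_on U f ->
  (forall a b c, U a -> U b -> U c -> tri f a b c = 0) ->
  exists F, forall z, U z -> cder F z (f z).
Proof.
move=> oU cU fc T0.
have [[z0 U0]|noU] := pselect (U !=set0); last first.
  by exists f => z Uz; case: noU; exists z.
exists (segint f z0) => z Uz e e0.
have e4 : 0 < e / 2 by rewrite divr_gt0.
have [r r0 Hr] := proj1 (openCP U) oU z Uz.
have [d d0 Hd] := fc z Uz _ e4.
exists (Num.min r d); first by rewrite lt_min r0.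
move=> w; rewrite lt_min => /andP[wr wd].
have Uw := Hr _ wr.
have sf := seg_cont_in cU fc.
have E : segint f z0 w - segint f z0 z = segint f z w.
  have := T0 _ _ _ U0 Uz Uw; rewrite /tri (segint_rev (sf _ _ U0 Uw)) => /eqP.
  by rewrite subr_eq0 => /eqP <-; ring.
have cstc : cont_on U (fun=> f z).
  by move=> y _; exact: cder_cont (cder_cst _ _).
have -> : segint f z0 w - segint f z0 z - f z * (w - z) =
    segint (fun y => f y + -1 * f z) z w.
  rewrite E segint_lin; [|exact: sf|exact: (seg_cont_in cU)].
  rewrite (@segint_FTC _ (fun y => f z * y) (fun=> f z)); first by ring.
  by move=> t _; rewrite -[X in cder _ _ X]mulr1; apply: cderZ; exact: cder_id.
apply: (le_trans (segint_bound (M := e / 2) _ _)).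
- apply: (seg_cont_in cU) => // y Uy eps /(fc y Uy)[dd dd0 Hdd].
  exists dd => // x _ /Hdd; rewrite opprD addrACA -mulrBr subrr mulr0 addr0.
  exact.
- move=> t t01; rewrite mulN1r; apply/ltW/Hd => //.
  apply: (le_lt_trans (seg_dist z w z t01)); rewrite subrr mod0 mulr0 add0r.
  by have := mod_ge0 (w - z); move: t01 wd; nra.
- by rewrite [2 * _]mulrC divfK.
Qed.

Theorem holomorphic_primitive U f : open U -> seg_convex U ->
  (forall z, U z -> exists l, cder f z l) ->
  exists F, forall z, U z -> cder F z (f z).
Proof.
move=> oU cU fd; apply: triangle_primitive => //; last by move=> *; exact: (goursat cU).
by move=> z /fd[l]; exact: cder_cont.
Qed.

End Goursat.

(** * Cauchy kernels and integrals around a square *)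

Section CauchyKernel.
Variable R : realType.
Local Notation C := (Cx R).
Implicit Types (a b c z w : C) (f g F : C -> C) (U : set C).

Lemma ccontM f g z : ccont setT f z -> ccont setT g z ->
  ccont setT (fun w => f w * g w) z.
Proof.
move=> cf cg e e0.
have f1 : 0 < mod[f z] + 1 by rewrite ltr_wpDl ?mod_ge0.
have g1 : 0 < mod[g z] + 1 by rewrite ltr_wpDl ?mod_ge0.
have [|d d0 Hd] := cf (e / 2 / (mod[g z] + 1)); first by rewrite !divr_gt0.
have [|d' d'0 Hd'] := cg (Num.min 1 (e / 2 / (mod[f z] + 1))).
  by rewrite lt_min ltr01 !divr_gt0.
exists (Num.min d d'); first by rewrite lt_min d0.
move=> w _; rewrite lt_min => /andP[/(Hd w I) h1 /(Hd' w I)].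
rewrite lt_min => /andP[h2 h3].
have -> : f w * g w - f z * g z = (f w - f z) * g w + f z * (g w - g z) by ring.
apply: (le_lt_trans (modD _ _)); rewrite !modM.
have gw : mod[g w] <= mod[g z] + 1 by have := mod_triB (g w) (g z); lra.
rewrite [ltRHS](_ : _ = e / 2 / (mod[g z] + 1) * (mod[g z] + 1) +
  e / 2 / (mod[f z] + 1) * (mod[f z] + 1)); last by rewrite !divfK ?gt_eqF//; lra.
apply: ltr_leD.
  apply: le_lt_trans (ler_wpM2l (mod_ge0 _) gw) _.
  by rewrite ltr_pM2r.
by rewrite mulrC; apply: ler_pM; rewrite ?mod_ge0 ?(ltW h3)// lerDl.
Qed.

Lemma ccontD f g z : ccont setT f z -> ccont setT g z ->
  ccont setT (fun w => f w + g w) z.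
Proof.
move=> cf cg e e0; have e2 : 0 < e / 2 by rewrite divr_gt0.
have [d d0 Hd] := cf _ e2; have [d' d'0 Hd'] := cg _ e2.
exists (Num.min d d'); first by rewrite lt_min d0.
move=> w _; rewrite lt_min => /andP[/(Hd w I) h1 /(Hd' w I) h2].
by rewrite opprD addrACA; apply: (le_lt_trans (modD _ _)); lra.
Qed.

Lemma cder_sum n (F : nat -> C -> C) (l : nat -> C) z :
  (forall k, (k < n)%N -> cder (F k) z (l k)) ->
  cder (fun w => \sum_(k < n) F k w) z (\sum_(k < n) l k).
Proof.
elim: n => [_|n IH H].
  rewrite big_ord0 (_ : (fun _ => _) = fun=> 0); first exact: cder_cst.
  by apply/funext => w; rewrite big_ord0.
rewrite big_ord_recr (_ : (fun _ => _) = fun w => \sum_(k < n) F k w + F n w).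
  by apply: cderD; [apply: IH => k /ltnW kn; exact: H|exact: H].
by apply/funext => w; rewrite big_ord_recr.
Qed.

Lemma cder_mod_le F f a b (M : R) :
  (forall t, 0 <= t <= 1 -> cder F (seg a b t) (f (seg a b t))) ->
  (forall t, 0 <= t <= 1 -> mod[f (seg a b t)] <= M) ->
  mod[F b - F a] <= 2 * M * mod[b - a].
Proof.
move=> dF fM; have := @path_prim_bound R (fun t => f (seg a b t) * (b - a))
  (F \o seg a b) (M * mod[b - a]).
rewrite /= seg0 seg1 mulrA; apply => t t01; first exact/rcder_seg/dF.
by rewrite modM ler_wpM2r ?mod_ge0//; exact: fM.
Qed.

Lemma seg_bounded f a b : seg_cont f a b ->
  exists2 M : R, 0 <= M & forall t, 0 <= t <= 1 -> mod[f (seg a b t)] <= M.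
Proof.
move=> fc; pose h (t : R) := mod[f (seg a b t)].
have hc : {within `[0, 1], continuous h}.
  apply: continuous_in_subspaceT => t; rewrite inE /= in_itv /= => t01.
  apply: continuousRP => e /(fc t t01)[d d0 Hd].
  have b1 : 0 < mod[b - a] + 1 by have := mod_ge0 (b - a); lra.
  exists (d / (mod[b - a] + 1)); first by rewrite divr_gt0.
  move=> s; rewrite ltr_pdivlMr// => sd.
  have E : seg a b s - seg a b t = (b - a) * ((s - t)%:C)%C.
    by rewrite /seg rmorphB /=; ring.
  apply: le_lt_trans (Hd (seg a b s) I _).
    rewrite ler_norml; apply/andP; split; last exact: mod_triB.
    by rewrite lerNl opprB modC; exact: mod_triB.
  rewrite E modM modR mulrC; apply: le_lt_trans sd.
  by rewrite ler_wpM2l// lerDl.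
have [t t01 Ht] := EVT_max ler01 hc.
exists (h t); first exact: mod_ge0.
by move=> s s01; apply: Ht; rewrite in_itv.
Qed.

(** Differentiation under the integral sign, for a kernel with a second order Taylor bound
    that is uniform along the segment. *)
Lemma segint_param f (k : C -> C -> C) k' a b z (r B : R) :
  seg_cont f a b -> 0 < r -> 0 <= B ->
  (forall w, mod[w - z] < r -> seg_cont (k w) a b) -> seg_cont k' a b ->
  (forall w t, mod[w - z] < r -> 0 <= t <= 1 ->
    mod[k w (seg a b t) - k z (seg a b t) - k' (seg a b t) * (w - z)]
      <= B * mod[w - z] ^+ 2) ->
  cder (fun w => segint (fun x => f x * k w x) a b) z
    (segint (fun x => f x * k' x) a b).
Proof.
move=> fc r0 B0 kc kc' H e e0.
have [M M0 fM] := seg_bounded fc.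
pose K := 2 * (M * B) * mod[b - a].
have K0 : 0 <= K by rewrite !mulr_ge0// mod_ge0.
have K1 : 0 < K + 1 by lra.
exists (Num.min r (e / (K + 1))); first by rewrite lt_min r0 divr_gt0.
move=> w; rewrite lt_min => /andP[wr]; rewrite ltr_pdivlMr// => we.
have c1 v : mod[v - z] < r -> seg_cont (fun x => f x * k v x) a b.
  by move=> vr t t01; apply: ccontM; [exact: fc|exact: kc].
have cz : seg_cont (fun x => f x * k z x) a b by apply: c1; rewrite subrr mod0.
have c2 : seg_cont (fun x => f x * k' x) a b.
  by move=> t t01; apply: ccontM; [exact: fc|exact: kc'].
have c3 : seg_cont (fun x => f x * k z x + (w - z) * (f x * k' x)) a b.
  move=> t t01; apply: ccontD; first exact: cz.
  by apply: ccontM (c2 _ t01); exact: cder_cont (cder_cst _ _).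
have -> : segint (fun x => f x * k w x) a b - segint (fun x => f x * k z x) a b -
    segint (fun x => f x * k' x) a b * (w - z) =
  segint (fun x => f x * k w x + -1 * (f x * k z x + (w - z) * (f x * k' x))) a b.
  by rewrite (segint_lin _ (c1 _ wr) c3) (segint_lin _ cz c2); ring.
apply: (le_trans (segint_bound (M := M * (B * mod[w - z] ^+ 2)) _ _)).
- move=> t t01; apply: ccontD; first exact: (c1 _ wr).
  by apply: ccontM (c3 _ t01); exact: cder_cont (cder_cst _ _).
- move=> t t01; set x := seg a b t.
  have -> : f x * k w x + -1 * (f x * k z x + (w - z) * (f x * k' x)) =
    f x * (k w x - k z x - k' x * (w - z)) by ring.
  by rewrite modM; apply: ler_pM; rewrite ?mod_ge0 ?fM ?H.
have -> : 2 * (M * (B * mod[w - z] ^+ 2)) * mod[b - a] =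
    K * mod[w - z] * mod[w - z] by rewrite /K; ring.
rewrite ler_wpM2r ?mod_ge0//; apply: le_trans (ltW we); rewrite mulrC.
by rewrite ler_wpM2l ?mod_ge0// lerDl.
Qed.

Lemma cder_subV w z : z - w != 0 -> cder (fun x => (x - w)^-1) z (- (z - w)^-2).
Proof.
move=> zw; rewrite -[X in cder _ _ X]mulr1 -[X in _ * X]subr0.
apply: (@cder_comp _ (fun x => x^-1) (fun x => x - w)).
  by apply: cderB; [exact: cder_id|exact: cder_cst].
exact: cderV.
Qed.

Lemma ccont_subV w z n : z - w != 0 -> ccont setT (fun x => (x - w) ^- n) z.
Proof.
move=> zw; under [X in ccont _ X]eq_fun do rewrite -exprVn.
exact: cder_cont (cderX n (cder_subV zw)).
Qed.

Section Off.
Variables (f : C -> C) (a b z : C) (d : R).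
Hypotheses (fc : seg_cont f a b) (d0 : 0 < d).
Hypothesis off : forall t, 0 <= t <= 1 -> d <= mod[seg a b t - z].

Let off_w w t : mod[w - z] < d / 2 -> 0 <= t <= 1 -> d / 2 <= mod[seg a b t - w].
Proof.
move=> wz t01; have := off t01; have := mod_tri w (seg a b t) z; lra.
Qed.

Let neq0 w t : mod[w - z] < d / 2 -> 0 <= t <= 1 -> seg a b t - w != 0.
Proof.
by move=> wz t01; rewrite -mod_gt0; apply: lt_le_trans (off_w wz t01); rewrite divr_gt0.
Qed.

Let zz : mod[z - z] < d / 2. Proof. by rewrite subrr mod0 divr_gt0. Qed.

Lemma cauchy_kernel1 : cder (fun w => segint (fun x => f x * (x - w) ^- 1) a b) z
  (segint (fun x => f x * (x - z) ^- 2) a b).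
Proof.
apply: (@segint_param f (fun w x => (x - w) ^- 1) _ a b z (d / 2) (2 / d ^+ 3)) => //.
- by rewrite divr_gt0.
- by rewrite divr_ge0// exprn_ge0// ltW.
- by move=> w wz t t01; apply: ccont_subV; exact: neq0.
- by move=> t t01; apply: ccont_subV; exact: neq0.
move=> w t wz t01; set x := seg a b t.
have n1 : x - w != 0 by exact: neq0.
have n2 : x - z != 0 by exact: neq0.
have -> : (x - w) ^- 1 - (x - z) ^- 1 - (x - z) ^- 2 * (w - z) =
   (w - z) ^+ 2 / ((x - z) ^+ 2 * (x - w)).
  by rewrite !expr1; field; rewrite n1 n2.
rewrite modM modX modV modM modX mulrC ler_wpM2r ?exprn_ge0 ?mod_ge0//.
have -> : 2 / d ^+ 3 = (d ^+ 2 * (d / 2))^-1.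
  by field; rewrite gt_eqF.
rewrite lef_pV2 ?posrE ?mulr_gt0 ?exprn_gt0 ?divr_gt0 ?mod_gt0//.
apply: ler_pM; rewrite ?exprn_ge0 ?divr_ge0 ?(ltW d0)//.
  by rewrite lerXn2r ?nnegrE ?mod_ge0 ?(ltW d0)//; exact: off.
exact: off_w.
Qed.

Lemma cauchy_kernel2 : cder (fun w => segint (fun x => f x * (x - w) ^- 2) a b) z
  (segint (fun x => f x * (2 * (x - z) ^- 3)) a b).
Proof.
apply: (@segint_param f (fun w x => (x - w) ^- 2) _ a b z (d / 2) (16 / d ^+ 4)) => //.
- by rewrite divr_gt0.
- by rewrite divr_ge0// exprn_ge0// ltW.
- by move=> w wz t t01; apply: ccont_subV; exact: neq0.
- move=> t t01; apply: ccontM; first exact: cder_cont (cder_cst _ _).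
  by apply: ccont_subV; exact: neq0.
move=> w t wz t01; set x := seg a b t.
have n1 : x - w != 0 by exact: neq0.
have n2 : x - z != 0 by exact: neq0.
have -> : (x - w) ^- 2 - (x - z) ^- 2 - 2 * (x - z) ^- 3 * (w - z) =
   (w - z) ^+ 2 * ((3 * (x - z) - 2 * (w - z)) / ((x - z) ^+ 3 * (x - w) ^+ 2)).
  by field; rewrite n1 n2.
rewrite modM modX mulrC ler_wpM2r ?exprn_ge0 ?mod_ge0// modM modV modM !modX.
have o1 := off t01; have o2 := off_w wz t01; rewrite -/x in o1 o2.
have : mod[3 * (x - z) - 2 * (w - z)] <= 4 * mod[x - z].
  apply: (le_trans (modB _ _)); rewrite !modM !mod_nat.
  by move: wz o1; lra.
move=> h; set u := mod[x - z] in h o1 *; set v := mod[x - w] in o2 *.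
have u0 : 0 < u by apply: lt_le_trans o1.
have v0 : 0 < v by apply: lt_le_trans o2; rewrite divr_gt0.
apply: le_trans (_ : _ <= 4 * u / (u ^+ 3 * v ^+ 2)) _.
  by rewrite ler_wpM2r// invr_ge0 mulr_ge0// exprn_ge0// ltW.
have -> : 4 * u / (u ^+ 3 * v ^+ 2) = 4 * (u ^+ 2 * v ^+ 2)^-1.
  by field; rewrite !gt_eqF.
have -> : 16 / d ^+ 4 = 4 * (d ^+ 2 * (d / 2) ^+ 2)^-1.
  by field; rewrite gt_eqF.
rewrite ler_wpM2l// lef_pV2 ?posrE ?mulr_gt0 ?exprn_gt0 ?divr_gt0//.
have d20 : 0 <= d / 2 by rewrite divr_ge0// ltW.
by apply: ler_pM; rewrite ?exprn_ge0 ?(ltW d0)// lerXn2r ?nnegrE ?(ltW d0) ?(ltW u0) ?(ltW v0).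
Qed.

End Off.
End CauchyKernel.

Section Square.
Variable R : realType.
Local Notation C := (Cx R).
Implicit Types (a b c z w : C) (f g F : C -> C) (U : set C).

Definition ii : C := (0 +i* 1)%C.

Lemma ii2 : ii ^+ 2 = -1.
Proof. by apply: complex_ext; rewrite /ii /= ?mulr0 ?mul0r ?mulr1; lra. Qed.

Lemma mod_ii : mod[ii] = 1.
Proof. by rewrite /modulus /= expr0n expr1n /= add0r sqrtr1. Qed.

(** Side k of the square runs from corner k to corner k + 1.  It is the side
    c + r (1 + i s), -1 <= s <= 1, turned around c by i^k, so that the four sides contribute
    equally to the integral of dx / (x - c). *)
Definition corner c (r : R) (k : nat) : C := c + (r%:C)%C * ii ^+ k * (1 - ii).

Lemma side_pt c r k t : seg (corner c r k) (corner c r k.+1) t =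
  c + (r%:C)%C * ii ^+ k * (1 + ii * ((2 * t - 1)%:C)%C).
Proof.
rewrite /seg /corner exprS rmorphB rmorphM rmorph1 rmorph_nat /=.
have -> : forall x y z T : C, z + x * y * (1 - ii) + T *
    (z + x * (ii * y) * (1 - ii) - (z + x * y * (1 - ii))) =
    z + x * y * (1 - ii + T * (2 * ii - 1 - ii ^+ 2)) by move=> *; ring.
by rewrite ii2; congr (_ + _ * _); ring.
Qed.

Lemma side_dist c r k t : 0 < r -> 0 <= t <= 1 ->
  r <= mod[seg (corner c r k) (corner c r k.+1) t - c] <= 2 * r.
Proof.
move=> r0 t01; rewrite side_pt addrAC subrr add0r !modM modX mod_ii expr1n mulr1.
rewrite modR gtr0_norm//; set s := 2 * t - 1; set x := 1 + _.
have Rx : complex.Re x = 1 by rewrite /x /ii /=; lra.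
have Ix : complex.Im x = s by rewrite /x /ii /=; lra.
apply/andP; split.
  rewrite -[leLHS]mulr1 ler_wpM2l ?(ltW r0)//.
  by have := Re_le_mod x; rewrite Rx normr1.
rewrite mulrC ler_wpM2r ?(ltW r0)//; have := mod_le_ReIm x.
rewrite Rx Ix normr1 => /le_trans; apply.
have : `|s| <= 1 by rewrite ler_norml /s; lra.
by lra.
Qed.

Definition sqint f c r := \sum_(k < 4) segint f (corner c r k) (corner c r k.+1).

Definition on_square c r z := exists k t, 0 <= t <= 1 /\
  z = seg (corner c r k) (corner c r k.+1) t.

Lemma corner4 c r : corner c r 4 = corner c r 0.
Proof.
by rewrite /corner (exprM ii 2 2) ii2 sqrrN expr1n expr0.
Qed.

Lemma sqint_FTC F f c r : (forall z, on_square c r z -> cder F z (f z)) ->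
  sqint f c r = 0.
Proof.
move=> dF; rewrite /sqint (eq_bigr (fun k : 'I_4 =>
  F (corner c r k.+1) - F (corner c r k))); last first.
  by move=> k _; apply: segint_FTC => t t01; apply: dF; exists k, t.
rewrite -(big_mkord xpredT (fun k => F (corner c r k.+1) - F (corner c r k))).
by rewrite telescope_sumr// corner4 subrr.
Qed.

Lemma on_square_dist c r z : 0 < r -> on_square c r z -> r <= mod[z - c] <= 2 * r.
Proof. by move=> r0 [k [t [t01 ->]]]; exact: side_dist. Qed.

Lemma sqint_lin f g c r k : (forall z, on_square c r z -> ccont setT f z) ->
  (forall z, on_square c r z -> ccont setT g z) ->
  sqint (fun z => f z + k * g z) c r = sqint f c r + k * sqint g c r.
Proof.
move=> fc gc; rewrite /sqint mulr_sumr -big_split /=; apply: eq_bigr => j _.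
by apply: segint_lin => t t01; [apply: fc|apply: gc]; exists j, t.
Qed.

Lemma sqint_ext f g c r : (forall z, on_square c r z -> f z = g z) ->
  sqint f c r = sqint g c r.
Proof.
by move=> fg; apply: eq_bigr => k _; apply: segint_ext => t t01; apply: fg; exists k, t.
Qed.

Lemma corner_dist c r k : 0 < r -> mod[corner c r k.+1 - corner c r k] <= 4 * r.
Proof.
move=> r0; rewrite -[corner c r k](seg0 _ (corner c r k.+1)).
rewrite -[X in modulus (X - _)](seg1 (corner c r k)).
apply: (le_trans (mod_tri c _ _)); rewrite (modC c).
have /andP[_ h0] := @side_dist c r k 0 r0 (introT andP (conj (lexx _) ler01)).
have /andP[_ h1] := @side_dist c r k 1 r0 (introT andP (conj ler01 (lexx _))).
by lra.
Qed.

Lemma sqint_bound f c r M : 0 < r -> (forall z, on_square c r z -> ccont setT f z) ->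
  (forall z, on_square c r z -> mod[f z] <= M) -> mod[sqint f c r] <= 32 * M * r.
Proof.
move=> r0 fc fM; have M0 : 0 <= M.
  apply: le_trans (mod_ge0 _) (fM (corner c r 0) _); exists 0%N, 0.
  by rewrite seg0 lexx ler01.
have H k : mod[segint f (corner c r k) (corner c r k.+1)] <= 8 * M * r.
  apply: (le_trans (segint_bound (M := M) _ _)).
  - by move=> t t01; apply: fc; exists k, t.
  - by move=> t t01; apply: fM; exists k, t.
  apply: (le_trans (ler_wpM2l _ (corner_dist c k r0))); first by rewrite mulr_ge0.
  by rewrite le_eqVlt; apply/orP; left; apply/eqP; ring.
rewrite /sqint !big_ord_recl big_ord0 addr0 /=.
have := modD (segint f (corner c r 0) (corner c r 1)) (segint f (corner c r 1) (corner c r 2) +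
  (segint f (corner c r 2) (corner c r 3) + segint f (corner c r 3) (corner c r 4))).
have := modD (segint f (corner c r 1) (corner c r 2))
  (segint f (corner c r 2) (corner c r 3) + segint f (corner c r 3) (corner c r 4)).
have := modD (segint f (corner c r 2) (corner c r 3)) (segint f (corner c r 3) (corner c r 4)).
have := H 0%N; have := H 1%N; have := H 2%N; have := H 3%N.
by rewrite /bump /=; lra.
Qed.

Lemma square_bounded f c r : (forall z, on_square c r z -> ccont setT f z) ->
  exists2 M : R, 0 <= M & forall z, on_square c r z -> mod[f z] <= M.
Proof.
move=> fc.
have Hk k : exists M : R, 0 <= M /\ forall t, 0 <= t <= 1 ->
    mod[f (seg (corner c r k) (corner c r k.+1) t)] <= M.
  have [|M M0 HM] := @seg_bounded _ f (corner c r k) (corner c r k.+1).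
    by move=> t t01; apply: fc; exists k, t.
  by exists M.
have [M HM] := choice Hk.
exists (M 0%N + M 1%N + M 2%N + M 3%N).
  by rewrite !addr_ge0// (proj1 (HM _)).
move=> z [k [t [t01 ->]]].
have per k' : corner c r (k' + 4)%N = corner c r k'.
  by rewrite /corner exprD (exprM ii 2 2) ii2 sqrrN expr1n mulr1.
have perm q k' : corner c r (q * 4 + k')%N = corner c r k'.
  by elim: q => [|q IH]; rewrite ?mul0n// mulSn addnAC -addnA addnC per addnC.
rewrite (divn_eq k 4) -addnS !perm.
have h0 := proj1 (HM 0%N); have h1 := proj1 (HM 1%N).
have h2 := proj1 (HM 2%N); have h3 := proj1 (HM 3%N).
have : (k %% 4 < 4)%N by rewrite ltn_mod.
case: (k %% 4)%N => [|[|[|[|//]]]] _; apply: (le_trans (proj2 (HM _) _ t01)); lra.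
Qed.

Definition winding c r z := sqint (fun x => 1 * (x - z) ^- 1) c r.

Lemma sqint_cder1 f c r z : 0 < r -> (forall z, on_square c r z -> ccont setT f z) ->
  mod[z - c] < r ->
  cder (fun w => sqint (fun x => f x * (x - w) ^- 1) c r) z
    (sqint (fun x => f x * (x - z) ^- 2) c r).
Proof.
move=> r0 fc zr.
apply: (@cder_sum _ 4 (fun k w => segint (fun x => f x * (x - w) ^- 1) (corner c r k) (corner c r k.+1))
  (fun k => segint (fun x => f x * (x - z) ^- 2) (corner c r k) (corner c r k.+1))) => n _.
apply: (@cauchy_kernel1 _ _ _ _ _ (r - mod[z - c])).
- by move=> t t01; apply: fc; exists n, t.
- by lra.
move=> t t01; have /andP[h _] := @side_dist c r n t r0 t01.
by have := mod_tri z (seg (corner c r n) (corner c r n.+1) t) c; lra.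
Qed.

Lemma sqint_cder2 f c r z : 0 < r -> (forall z, on_square c r z -> ccont setT f z) ->
  mod[z - c] < r ->
  cder (fun w => sqint (fun x => f x * (x - w) ^- 2) c r) z
    (sqint (fun x => f x * (2 * (x - z) ^- 3)) c r).
Proof.
move=> r0 fc zr.
apply: (@cder_sum _ 4 (fun k w => segint (fun x => f x * (x - w) ^- 2) (corner c r k) (corner c r k.+1))
  (fun k => segint (fun x => f x * (2 * (x - z) ^- 3)) (corner c r k) (corner c r k.+1))) => n _.
apply: (@cauchy_kernel2 _ _ _ _ _ (r - mod[z - c])).
- by move=> t t01; apply: fc; exists n, t.
- by lra.
move=> t t01; have /andP[h _] := @side_dist c r n t r0 t01.
by have := mod_tri z (seg (corner c r n) (corner c r n.+1) t) c; lra.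
Qed.

Lemma square_neq c r z x : 0 < r -> mod[z - c] < r -> on_square c r x -> x - z != 0.
Proof.
move=> r0 zr /(on_square_dist r0)/andP[h _]; rewrite subr_eq0.
by apply: contraTneq zr => <-; rewrite -leNgt.
Qed.

(** The derivative in z is the integral around a closed path of (x - z)^-2, which has a
    primitive. *)
Lemma winding_const c r z : 0 < r -> mod[z - c] < r -> winding c r z = winding c r c.
Proof.
move=> r0 zr; apply/eqP; rewrite -subr_eq0; apply/eqP/mod_small_eq0 => e e0.
have := @cder_mod_le R (winding c r) (fun=> 0) c z 0.
rewrite mulr0 mul0r => H; apply: le_trans (ltW e0); apply: H => [t t01|t _]; last by rewrite mod0.
have sr : mod[seg c z t - c] < r.
  apply: le_lt_trans (seg_dist _ _ _ t01) _; rewrite subrr mod0 mulr0 add0r.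
  by have := mod_ge0 (z - c); move: t01 zr; nra.
have := @sqint_cder1 (fun=> 1) c r _ r0 _ sr.
rewrite (_ : sqint _ c r = 0).
  by apply => x _; exact: cder_cont (cder_cst _ _).
apply: (@sqint_FTC (fun x => -1 * (x - seg c z t)^-1)) => x xs.
have := cderZ (-1) (cder_subV (square_neq r0 sr xs)).
by rewrite mulN1r opprK mul1r.
Qed.

(** On each side dx / (x - c) = i ds / (1 + i s), whose imaginary part is
    ds / (1 + s^2) >= ds / 2, for s from -1 to 1. *)
Lemma winding_ge c r : 0 < r -> 4 <= mod[winding c r c].
Proof.
move=> r0; apply: le_trans (Im_le_mod _); apply: le_trans (ler_norm _).
have side k : 1 <= complex.Im (segint (fun x => 1 * (x - c) ^- 1)
    (corner c r k) (corner c r k.+1)).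
  have [|G pG] := @seg_prim_ex _ (fun x => 1 * (x - c) ^- 1) (corner c r k) (corner c r k.+1).
    move=> t t01; apply: ccontM; first exact: cder_cont (cder_cst _ _).
    apply: ccont_subV; rewrite -mod_gt0; apply: (lt_le_trans r0).
    by have /andP[] := @side_dist c r k t r0 t01.
  rewrite (segintE pG); apply: (path_prim_Im pG) => t t01.
  rewrite side_pt addrAC subrr add0r expr1 mul1r /corner exprS.
  set s := 2 * t - 1.
  have iik : ii ^+ k != 0 by rewrite -mod_gt0 modX mod_ii expr1n.
  have rC : (r%:C)%C != 0 :> C by rewrite -mod_gt0 modR normr_gt0 gt_eqF.
  have xs : 1 + ii * (s%:C)%C != 0.
    by apply/eqP => /(congr1 (@complex.Re R)) /=; lra.
  have E (x y w : C) : x != 0 -> y != 0 -> w != 0 ->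
    (x * y * w)^-1 * (c + x * (ii * y) * (1 - ii) - (c + x * y * (1 - ii))) =
     (ii * 2 - (1 + ii ^+ 2)) / w by move=> x0 y0 w0; field; rewrite x0 y0 w0.
  rewrite E// ii2 subrr subr0.
  have -> : ii * 2 / (1 + ii * (s%:C)%C) =
      (2 * (s / (1 + s ^+ 2)) +i* (2 / (1 + s ^+ 2)))%C.
    have s2 : 1 + s ^+ 2 != 0 by rewrite gt_eqF//; have := sqr_ge0 s; lra.
    apply: (mulIf xs); rewrite divfK//.
    by apply: complex_ext; rewrite /ii /=; field.
  rewrite /= ler_pdivlMr; last by have := sqr_ge0 s; lra.
  by rewrite /s; move: t01; nra.
rewrite /winding /sqint !big_ord_recl big_ord0 addr0 /= !Im_add /bump /=.
have := side 0%N; have := side 1%N; have := side 2%N; have := side 3%N; lra.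
Qed.

End Square.

(** * Holomorphic functions *)

Section Holomorphic.
Variable R : realType.
Local Notation C := (Cx R).
Implicit Types (a b c z w : C) (f g F : C -> C) (U : set C).

Definition hol U f := forall z, U z -> exists l, cder f z l.

Lemma hol_cont U f : hol U f -> cont_on U f.
Proof. by move=> H z /H[l]; exact: cder_cont. Qed.

Lemma cball_open c (r : R) : open (cball c r).
Proof.
apply/openCP => z; rewrite /cball /= => zr; exists (r - mod[z - c]).
  by rewrite subr_gt0.
by move=> w wz /=; have := mod_tri z w c; lra.
Qed.

Lemma cball_convex c (r : R) : seg_convex (cball c r).
Proof.
move=> a b t /= ar br t01; apply: (le_lt_trans (seg_dist _ _ _ t01)).
have : Num.max mod[a - c] mod[b - c] < r by rewrite gt_max ar br.
apply: le_lt_trans; set m := Num.max _ _.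
have am : mod[a - c] <= m by rewrite le_max lexx.
have bm : mod[b - c] <= m by rewrite le_max lexx orbT.
by move: t01 am bm; nra.
Qed.

Lemma cball_center c (r : R) : 0 < r -> cball c r c.
Proof. by rewrite /cball /= subrr mod0. Qed.

Lemma neq_open z : open [set w : C | w != z].
Proof.
apply/openCP => w /= wz; exists (mod[w - z]); first by rewrite mod_gt0 subr_eq0.
by move=> v vw; apply: contraTneq vw => ->; rewrite modC ltxx.
Qed.

Definition slope_at F z (l : C) x := if x == z then l else (F x - F z) / (x - z).

Lemma slope_at_cder_ne F z l x m : x != z -> cder F x m ->
  exists m', cder (slope_at F z l) x m'.
Proof.
move=> xz dF; eexists.
apply: (@cder_ext _ (fun y => (F y - F z) * (y - z)^-1) _ _ _ _ (@neq_open z) xz).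
  by move=> w /= wz; rewrite /slope_at (negbTE wz).
apply: cderM; first by apply: cderB; [exact: dF|exact: cder_cst].
by apply: cder_subV; rewrite subr_eq0.
Qed.

(** Second order Taylor expansion: the function F - f(z) x - l (x - z)^2 / 2 has
    derivative o(x - z), hence increment o((x - z)^2) by the mean value inequality. *)
Lemma slope_at_cder U F f z l : open U -> U z -> (forall w, U w -> cder F w (f w)) ->
  cder f z l -> cder (slope_at F z (f z)) z (l / 2).
Proof.
move=> /openCP oU Uz dF df e e0.
have [r r0 Hr] := oU z Uz.
have [|d d0 Hd] := df (e / 2); first by rewrite divr_gt0.
exists (Num.min r d); first by rewrite lt_min r0.
move=> x; rewrite lt_min => /andP[xr xd]; rewrite /slope_at eqxx.
case: eqP => [->|/eqP xz]; first by rewrite !subrr mulr0 subrr mod0 mulr0.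
pose E w := F w - (f z * w + l * (2^-1 * (w - z) ^+ 2)).
have near t : 0 <= t <= 1 -> mod[seg z x t - z] <= mod[x - z].
  move=> t01; apply: (le_trans (seg_dist z x z t01)).
  by rewrite subrr mod0 mulr0 add0r; have := mod_ge0 (x - z); move: t01; nra.
have := @cder_mod_le R E (fun w => f w - (f z * 1 + l * (2^-1 * (2%:R * (w - z) ^+ 1 * (1 - 0)))))
  z x (e / 2 * mod[x - z]).
have -> : E x - E z = (x - z) * (
    (F x - F z) / (x - z) - f z - l / 2 * (x - z)).
  by rewrite /E; field; rewrite subr_eq0.
rewrite modM (_ : 2 * (e / 2 * mod[x - z]) * mod[x - z] =
  mod[x - z] * (e * mod[x - z])); last by field.
rewrite ler_pM2l ?mod_gt0 ?subr_eq0//; apply => t t01.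
  have Us : U (seg z x t) by apply: Hr; apply: le_lt_trans (near _ t01) xr.
  apply: cderB; first exact: dF.
  apply: cderD; first by apply: cderZ; exact: cder_id.
  do 2! apply: cderZ.
  by apply: cderX; apply: cderB; [exact: cder_id|exact: cder_cst].
set w := seg z x t.
have -> : f w - (f z * 1 + l * (2^-1 * (2%:R * (w - z) ^+ 1 * (1 - 0)))) =
  f w - f z - l * (w - z) by field.
have wn := near _ t01; apply: (le_trans (Hd w (le_lt_trans wn xd))).
by rewrite ler_wpM2l// ltW// divr_gt0.
Qed.

(** The slopes of a primitive F of f are holomorphic, so their integral around the square
    vanishes; this is the formula for F.  Differentiating it in z gives f(z) as an integral
    of F(x) / (x - z)^2, which equals that of f(x) / (x - z) since the difference of the
    integrands is the derivative of F(x) / (x - z). *)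
Lemma cauchy_formula U f c (r : R) z : open U -> seg_convex U -> hol U f ->
  0 < r -> (forall w, mod[w - c] <= 2 * r -> U w) -> mod[z - c] < r ->
  f z * winding c r c = sqint (fun x => f x * (x - z) ^- 1) c r.
Proof.
move=> oU cU hf r0 sU zr.
have [F dF] := holomorphic_primitive oU cU hf.
have Us x : on_square c r x -> U x.
  by move=> /(on_square_dist r0)/andP[_ h]; exact: sU.
have Ub x : cball c r x -> U x.
  by rewrite /cball /= => h; apply: sU; lra.
have fc x : on_square c r x -> ccont setT f x by move=> /Us/hf[l]; exact: cder_cont.
have Fc x : on_square c r x -> ccont setT F x by move=> /Us/dF; exact: cder_cont.
have Vc (w : C) n x : mod[w - c] < r -> on_square c r x ->
    ccont setT (fun x => (x - w) ^- n) x.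
  by move=> wr xs; apply: ccont_subV; exact: square_neq r0 wr xs.
have FE w : mod[w - c] < r ->
    F w * winding c r c = sqint (fun x => F x * (x - w) ^- 1) c r.
  move=> wr; have Uw : U w by exact: Ub.
  have [l dl] := hf w Uw.
  have hq : hol U (slope_at F w (f w)).
    move=> x Ux; have [->|xw] := eqVneq x w.
      by exists (l / 2); exact: slope_at_cder oU Uw dF dl.
    exact: slope_at_cder_ne xw (dF _ Ux).
  have [Q dQ] := holomorphic_primitive oU cU hq.
  have : sqint (slope_at F w (f w)) c r = 0.
    by apply: sqint_FTC => x /Us; exact: dQ.
  rewrite (@sqint_ext _ _ (fun x => F x * (x - w) ^- 1 +
      - F w * (1 * (x - w) ^- 1))); last first.
    move=> x xs; have xw := square_neq r0 wr xs.
    rewrite /slope_at -subr_eq0 (negbTE xw) expr1; ring.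
  rewrite sqint_lin => [/eqP||]; last first.
  - move=> x xs; apply: ccontM; first exact: cder_cont (cder_cst _ _).
    exact: Vc.
  - by move=> x xs; apply: ccontM; [exact: Fc|exact: Vc].
  by rewrite mulNr subr_eq0 -/(winding c r w) (winding_const r0 wr) => /eqP.
have d1 : cder (fun w => F w * winding c r c) z (f z * winding c r c).
  by apply: cderMr; apply: dF; exact: Ub.
have d2 : cder (fun w => F w * winding c r c) z
    (sqint (fun x => F x * (x - z) ^- 2) c r).
  apply: (@cder_ext _ (fun w => sqint (fun x => F x * (x - w) ^- 1) c r) _ _ _
    _ (@cball_open c r) zr) => [w wr|]; first by rewrite FE.
  exact: sqint_cder1.
rewrite (cder_unique d1 d2).
have : sqint (fun x => f x * (x - z) ^- 1 + (-1) * (F x * (x - z) ^- 2)) c r = 0.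
  apply: (@sqint_FTC _ (fun x => F x * (x - z)^-1)) => x xs.
  have := cderM (dF _ (Us x xs)) (cder_subV (square_neq r0 zr xs)).
  by rewrite mulrN mulN1r expr1.
rewrite sqint_lin => [/eqP||]; last first.
- by move=> x xs; apply: ccontM; [exact: Fc|exact: Vc].
- by move=> x xs; apply: ccontM; [exact: fc|exact: Vc].
by rewrite mulN1r subr_eq0 => /eqP.
Qed.

Lemma winding_neq0 c (r : R) : 0 < r -> winding c r c != 0.
Proof. by move=> r0; rewrite -mod_gt0; have := winding_ge c r0; lra. Qed.

Theorem hol_derive U f : open U -> hol U f -> hol U (derive1 f).
Proof.
move=> oU hf c Uc; have [rho rho0 Hr] := proj1 (openCP U) oU c Uc.
pose V := cball c rho; have VU : V `<=` U by move=> w; exact: Hr.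
have hV : hol V f by move=> w /VU; exact: hf.
pose r := rho / 4; have r0 : 0 < r by rewrite divr_gt0.
have sV w : mod[w - c] <= 2 * r -> V w.
  by rewrite /V /cball /r /=; lra.
set W := winding c r c; have W0 : W != 0 by exact: winding_neq0.
have fE z : mod[z - c] < r -> W^-1 * sqint (fun x => f x * (x - z) ^- 1) c r = f z.
  move=> zr; rewrite -(cauchy_formula (@cball_open c rho) (@cball_convex c rho) hV r0 sV zr).
  by rewrite mulrCA mulVf// mulr1.
have fc x : on_square c r x -> ccont setT f x.
  move=> /(on_square_dist r0)/andP[_ /sV]; exact: hol_cont.
have dE z : mod[z - c] < r ->
    W^-1 * sqint (fun x => f x * (x - z) ^- 2) c r = derive1 f z.
  move=> zr; apply/esym/derive1_cder.
  apply: (@cder_ext _ (fun z => W^-1 * sqint (fun x => f x * (x - z) ^- 1) c r) _ _ _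
    _ (@cball_open c r) zr) => [w wr|]; first exact: fE.
  by apply: cderZ; exact: sqint_cder1.
have cc : mod[c - c] < r by rewrite subrr mod0.
eexists; apply: (@cder_ext _ (fun z => W^-1 * sqint (fun x => f x * (x - z) ^- 2) c r) _ _ _
    _ (@cball_open c r) cc) => [w wr|]; first exact: dE.
by apply: cderZ; apply: sqint_cder2.
Qed.

Lemma hol_derive1 U f z : hol U f -> U z -> cder f z (derive1 f z).
Proof. by move=> hf /hf[l dl]; rewrite (derive1_cder dl). Qed.

Lemma primitive_hol U F f : open U -> (forall z, U z -> cder F z (f z)) -> hol U f.
Proof.
move=> oU dF; have hF : hol U F by move=> z /dF dz; exists (f z).
move=> z Uz; have [l dl] := hol_derive oU hF Uz; exists l.
apply: (@cder_ext _ (derive1 F) _ _ _ U) => // w Uw.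
exact: derive1_cder (dF w Uw).
Qed.

Lemma cauchy_bound U f c (r M : R) z : open U -> seg_convex U -> hol U f ->
  0 < r -> (forall w, mod[w - c] <= 2 * r -> U w) -> mod[z - c] < r / 2 ->
  (forall x, on_square c r x -> mod[f x] <= M) -> mod[f z] <= 16 * M.
Proof.
move=> oU cU hf r0 sU zr fM.
have zr' : mod[z - c] < r by lra.
have fc x : on_square c r x -> ccont setT f x.
  move=> /(on_square_dist r0)/andP[_ /sU]; exact: hol_cont.
have M0 : 0 <= M.
  apply: le_trans (mod_ge0 _) (fM (corner c r 0) _); exists 0%N, 0.
  by rewrite seg0 lexx ler01.
have := @sqint_bound R (fun x => f x * (x - z) ^- 1) c r (M * (r / 2)^-1) r0.
rewrite -(cauchy_formula oU cU hf r0 sU zr') modM.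
have -> : 32 * (M * (r / 2)^-1) * r = 64 * M by field; rewrite gt_eqF.
move=> H; have {}H : mod[f z] * mod[winding c r c] <= 64 * M.
  apply: H => x xs.
    by apply: ccontM (fc _ xs) _; apply: ccont_subV; exact: square_neq r0 zr' xs.
  rewrite modM expr1 modV; apply: ler_pM; rewrite ?mod_ge0 ?invr_ge0 ?mod_ge0//.
    exact: fM.
  have /andP[h _] := on_square_dist r0 xs.
  have xz : r / 2 <= mod[x - z] by have := mod_tri z x c; lra.
  by rewrite lef_pV2 ?posrE ?divr_gt0//; apply: lt_le_trans xz; rewrite divr_gt0.
have := winding_ge c r0; have := mod_ge0 (f z); nra.
Qed.

(** Integrals over triangles pass to the uniform limit, so f has a primitive, and f is then
    holomorphic as a derivative. *)
Theorem weierstrass U f : open U -> seg_convex U ->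
  (forall e : R, 0 < e -> exists2 g, hol U g & forall z, U z -> mod[f z - g z] <= e) ->
  hol U f.
Proof.
move=> oU cU H.
have fc : cont_on U f.
  move=> z Uz e e0; have e3 : 0 < e / 3 by rewrite divr_gt0.
  have [g hg fg] := H _ e3.
  have [d d0 Hd] := hol_cont hg Uz e3.
  have [r r0 Hr] := proj1 (openCP U) oU z Uz.
  exists (Num.min r d); first by rewrite lt_min r0.
  move=> w _; rewrite lt_min => /andP[/Hr/fg h1 /(Hd w I) h2].
  have h3 := fg z Uz.
  have -> : f w - f z = (f w - g w) + (g w - g z) - (f z - g z) by ring.
  apply: le_lt_trans (modB _ _) _; have := modD (f w - g w) (g w - g z); lra.
have [|F dF] := triangle_primitive oU cU fc; last exact: primitive_hol dF.
move=> a b c Ua Ub Uc; apply: mod_small_eq0 => e e0.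
pose P := 2 * (mod[b - a] + mod[c - b] + mod[a - c]).
have P0 : 0 <= P by rewrite mulr_ge0// !addr_ge0// mod_ge0.
have P1 : 0 < P + 1 by lra.
have [|g hg fg] := H (e / (P + 1)); first by rewrite divr_gt0.
have -> : tri f a b c = tri (fun z => f z + -1 * g z) a b c.
  rewrite (tri_lin _ cU fc (hol_cont hg) Ua Ub Uc) (goursat cU hg Ua Ub Uc).
  by rewrite mulr0 addr0.
apply: (le_trans (tri_bound (M := e / (P + 1)) cU _ Ua Ub Uc _)).
- move=> z Uz; apply: ccontD; first exact: fc.
  apply: ccontM; first exact: cder_cont (cder_cst _ _).
  exact: hol_cont hg _ Uz.
- move=> z x y t hx hy t01 ->; rewrite mulN1r; apply: fg.
  by apply: cU => //; [case: hx|case: hy] => ->.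
rewrite mulrAC -/P mulrCA -[leRHS]mulr1 ler_pM2l//.
by rewrite ler_pdivrMr// mul1r lerDl.
Qed.

(** The function (z - z0) f(z) is differentiable at z0 as well, by continuity of f, and f is
    its slope at z0. *)
Theorem removable U f z0 : open U -> U z0 ->
  (forall z, U z -> z != z0 -> exists l, cder f z l) -> ccont setT f z0 ->
  exists l, cder f z0 l.
Proof.
move=> oU Uz0 hf fc; pose g z := (z - z0) * f z.
have dz z : cder (fun w => w - z0) z (1 - 0).
  by apply: cderB; [exact: cder_id|exact: cder_cst].
have g0 : cder g z0 (f z0).
  move=> e e0; have [d d0 Hd] := fc e e0; exists d => // w wd.
  have -> : g w - g z0 - f z0 * (w - z0) = (f w - f z0) * (w - z0).
    by rewrite /g; ring.
  by rewrite modM ler_wpM2r ?mod_ge0// ltW// Hd.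
have hg : hol U g.
  move=> z Uz; have [->|zz0] := eqVneq z z0; first by exists (f z0).
  by have [l dl] := hf z Uz zz0; eexists; exact: cderM (dz z) dl.
have [l dl] := hol_derive oU hg Uz0; exists (l / 2).
have := slope_at_cder oU Uz0 (fun w Uw => hol_derive1 hg Uw) dl.
rewrite (derive1_cder g0).
apply: cder_ext oU Uz0 _ => w Uw; rewrite /slope_at.
case: eqP => [->//|/eqP wz]; rewrite /g subrr mul0r subr0 [_ * f w]mulrC mulfK//.
by rewrite subr_eq0.
Qed.

(** If zeros accumulate at z0, f is divisible by every power (w - z0)^k.  Cauchy's bound for
    the quotient on a square of half-side r, where |w - z0| >= r, gives
    |f(w)| <= C (|w - z0| / r)^k, and k is arbitrary. *)
Lemma zeros_isolated U f z0 : open U -> U z0 -> hol U f ->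
  (exists2 r : R, 0 < r & forall w, w != z0 -> mod[w - z0] < r -> f w != 0) \/
  (exists2 r : R, 0 < r & forall w, mod[w - z0] < r -> f w = 0).
Proof.
move=> oU Uz0 hf; have [|noacc] := pselect (exists2 r : R, 0 < r &
  forall w, w != z0 -> mod[w - z0] < r -> f w != 0); [by left|right].
have acc (r : R) : 0 < r -> exists w, [/\ w != z0, mod[w - z0] < r & f w = 0].
  move=> r0; apply: contrapT => /forallNP H; apply: noacc; exists r => // w wz wr.
  by apply/eqP => fw; apply: (H w).
have [rho rho0 Hr] := proj1 (openCP U) oU z0 Uz0.
pose V := cball z0 rho; have VU : V `<=` U by move=> w; exact: Hr.
have Vz0 : V z0 by exact: cball_center.
have oV : open V := @cball_open z0 rho.
(* divisibility by every power of w - z0 *)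
have div k : exists2 g, hol V g & forall w, V w -> f w = (w - z0) ^+ k * g w.
  elim: k => [|k [g hg fg]].
    by exists f => [w /VU|w _]; [exact: hf|rewrite mul1r].
  have g0 : g z0 = 0.
    apply: mod_small_eq0 => e e0; have [d d0 Hd] := hol_cont hg Vz0 e0.
    have [|w [wz wd fw]] := acc (Num.min d rho); first by rewrite lt_min d0.
    move: wd; rewrite lt_min => /andP[/(Hd w I) + wV].
    have /eqP : g w == 0.
      move: (fg w wV); rewrite fw => /esym/eqP; rewrite mulf_eq0 expf_eq0.
      by rewrite subr_eq0 (negbTE wz) andbF.
    by move=> ->; rewrite sub0r modN => /ltW.
  have [l dl] := hol_derive oV hg Vz0.
  exists (slope_at g z0 (derive1 g z0)).
    move=> w Vw; have [->|wz] := eqVneq w z0.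
      by exists (l / 2); exact: slope_at_cder oV Vz0 (fun w Uw => hol_derive1 hg Uw) dl.
    by have [m dm] := hg w Vw; exact: slope_at_cder_ne wz dm.
  move=> w Vw; rewrite fg// exprSr -mulrA; congr (_ * _); rewrite /slope_at.
  case: eqP => [->|/eqP wz]; first by rewrite subrr mul0r g0.
  by rewrite g0 subr0 mulrC divfK// subr_eq0.
pose r := rho / 4; have r0 : 0 < r by rewrite divr_gt0.
have sV w : mod[w - z0] <= 2 * r -> V w by rewrite /V /cball /r /=; lra.
have [M M0 fM] : exists2 M : R, 0 <= M & forall z, on_square z0 r z -> mod[f z] <= M.
  apply: square_bounded => z /(on_square_dist r0)/andP[_ /sV/VU].
  exact: hol_cont.
exists (r / 2); first by rewrite divr_gt0.
move=> w wr; have Vw : V w by apply: sV; have := mod_ge0 (w - z0); lra.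
apply: mod_small_eq0 => e e0.
have M1 : 0 < 16 * M + 1 by lra.
have [|k Hk] := @pow_half_small R (e / (16 * M + 1)); first by rewrite divr_gt0.
have [g hg fg] := div k.
have gM : mod[g w] <= 16 * (M / r ^+ k).
  apply: (cauchy_bound oV (@cball_convex z0 rho) hg r0 sV wr) => x xs.
  have /andP[xr x2r] := on_square_dist r0 xs.
  rewrite ler_pdivlMr ?exprn_gt0// mulrC; apply: le_trans (fM x xs).
  rewrite fg ?modM ?modX; last exact: sV.
  by rewrite ler_wpM2r ?mod_ge0// lerXn2r ?nnegrE ?mod_ge0// ltW.
rewrite fg// modM modX.
apply: le_trans (_ : _ <= (r / 2) ^+ k * (16 * (M / r ^+ k))) _.
  apply: ler_pM; rewrite ?exprn_ge0 ?mod_ge0//.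
  by rewrite lerXn2r ?nnegrE ?mod_ge0 ?(ltW wr)// divr_ge0// ltW.
have -> : (r / 2) ^+ k * (16 * (M / r ^+ k)) = 16 * M * 2^-1 ^+ k.
  by rewrite exprMn; field; rewrite expf_neq0// gt_eqF.
move: Hk; rewrite ltr_pdivlMr// => Hk.
have p0 : 0 <= (2^-1 : R) ^+ k by rewrite exprn_ge0.
by move: Hk p0; lra.
Qed.

Lemma inverse_cder (phi psi : C -> C) U w l : open U -> U w ->
  (forall v, U v -> phi (psi v) = v) -> ccont setT psi w ->
  cder phi (psi w) l -> l != 0 -> cder psi w l^-1.
Proof.
move=> /openCP oU Uw inv pc dl l0 e e0.
have L0 : 0 < mod[l] by rewrite mod_gt0.
set L := mod[l] in L0.
have [|d d0 Hd] := dl (Num.min (L / 2) (e * L ^+ 2 / 2)).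
  by rewrite lt_min !divr_gt0// mulr_gt0// exprn_gt0.
have [d' d'0 Hd'] := pc d d0.
have [r r0 Hr] := oU w Uw.
exists (Num.min r d'); first by rewrite lt_min r0.
move=> v; rewrite lt_min => /andP[/Hr Uv /(Hd' v I)/Hd].
rewrite !inv//; set x := psi v - psi w; set y := v - w.
set m := Num.min _ _ => H.
have m1 : m <= L / 2 by rewrite ge_min lexx.
have m2 : m <= e * L ^+ 2 / 2 by rewrite ge_min lexx orbT.
have -> : x - l^-1 * y = - (l^-1 * (y - l * x)) by field.
rewrite modN modM modV -/L.
have x0 := mod_ge0 x; have y0 := mod_ge0 y.
have xy : mod[x] <= 2 / L * mod[y].
  rewrite mulrAC ler_pdivlMr//.
  have := mod_triB (l * x) (l * x - y); rewrite subKr (modC _ y) modM -/L.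
  by move: H m1; nra.
rewrite mulrC ler_pdivrMr//; apply: (le_trans H).
apply: (le_trans (ler_pM _ x0 m2 xy)).
  by rewrite le_min !divr_ge0 ?mulr_ge0 ?exprn_ge0 ?(ltW e0) ?(ltW L0).
rewrite le_eqVlt; apply/orP; left; apply/eqP; field.
by rewrite gt_eqF.
Qed.

(** At a point psi w where phi' vanishes, either phi' does not vanish nearby, and the
    singularity of psi at w is removable, or phi' vanishes identically nearby, which
    contradicts injectivity. *)
Theorem hol_inverse (D Omega : set C) (phi psi : C -> C) : open D -> open Omega ->
  hol D phi -> (forall z, D z -> psi (phi z) = z) ->
  (forall w, Omega w -> D (psi w) /\ phi (psi w) = w) ->
  cont_on Omega psi -> hol Omega psi.
Proof.
move=> oD oO hphi psiK phiK psic.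
have phiK' w : Omega w -> phi (psi w) = w by move=> /phiK[].
have reg w : Omega w -> derive1 phi (psi w) != 0 -> exists l, cder psi w l.
  move=> Ow d0; eexists.
  apply: (inverse_cder oO Ow phiK' (psic w Ow) _ d0).
  by apply: (hol_derive1 hphi); exact: (phiK w Ow).1.
move=> w Ow; have [d0|] := eqVneq (derive1 phi (psi w)) 0; last exact: reg.
have Dw := (phiK w Ow).1.
have [[r r0 Hr]|[r r0 Hr]] := zeros_isolated oD Dw (hol_derive oD hphi).
  have [d d0' Hd] := psic w Ow r r0.
  have [s s0 Hs] := proj1 (openCP _) oO w Ow.
  apply: (@removable (cball w (Num.min d s))).
  - exact: cball_open.
  - by apply: cball_center; rewrite lt_min d0'.
  - move=> v; rewrite /cball /= lt_min => /andP[vd vs] vw.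
    apply: reg; first exact: Hs.
    apply: Hr; last exact: Hd.
    by apply: contra vw => /eqP E; rewrite -(phiK' v (Hs _ vs)) E phiK'.
  - exact: psic.
have [s s0 Hs] := proj1 (openCP _) oD _ Dw.
pose m := Num.min r s; have m0 : 0 < m by rewrite lt_min r0.
pose z1 := psi w + ((m / 2)%:C)%C.
have z1d : mod[z1 - psi w] = m / 2.
  by rewrite /z1 addrAC subrr add0r modR gtr0_norm// divr_gt0.
have near t : 0 <= t <= 1 -> mod[seg (psi w) z1 t - psi w] < m.
  move=> t01; apply: (le_lt_trans (seg_dist _ _ _ t01)).
  by rewrite subrr mod0 mulr0 add0r z1d; move: t01; nra.
have mr : m <= r by rewrite ge_min lexx.
have ms : m <= s by rewrite ge_min lexx orbT.
have E : phi z1 - phi (psi w) = 0.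
  apply: mod_small_eq0 => e e0.
  apply: le_trans (ltW e0); have := @cder_mod_le R phi (derive1 phi) (psi w) z1 0.
  rewrite mulr0 mul0r; apply => t t01.
    by apply: (hol_derive1 hphi); apply: Hs; apply: lt_le_trans (near t t01) ms.
  by rewrite Hr ?mod0//; apply: lt_le_trans (near t t01) mr.
move/eqP: E; rewrite subr_eq0 => /eqP E.
have Dz1 : D z1 by apply: Hs; rewrite z1d; apply: lt_le_trans ms; lra.
move: z1d; rewrite -(psiK _ Dz1) E phiK'// subrr mod0 => /eqP.
by rewrite eq_sym gt_eqF// divr_gt0.
Qed.

End Holomorphic.

(** * Compactness and bounded convex domains *)

Section Compactness.
Variable R : realType.
Local Notation C := (Cx R).
Implicit Types (a b c z w : C) (f g F : C -> C) (U K : set C).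

Lemma closed_bounded_compact K (B : R) : closed K ->
  (forall z, K z -> mod[z] <= B) -> compact K.
Proof.
move=> cK KB; pose h (x : R * R) : C := (x.1 +i* x.2)%C.
have hc : continuous h.
  move=> x; apply/cvgCP => e e0; have e2 : 0 < e / 2 by rewrite divr_gt0.
  exists (ball x.1 (e / 2), ball x.2 (e / 2)) => /=.
    by split; exact: nbhsx_ballx.
  move=> y [/=]; rewrite -!ball_normE /= distrC => h1; rewrite distrC => h2.
  suff : mod[h y - h x] < e by [].
  apply: (le_lt_trans (mod_le_ReIm _)).
  by rewrite Re_sub Im_sub /=; lra.
apply: (subclosed_compact cK (B := h @` (`[- B, B] `*` `[- B, B]))).
  apply: continuous_compact; first exact: continuous_subspaceT.
  by apply: compact_setX; exact: segment_compact.
move=> z /KB zB; exists (complex.Re z, complex.Im z); last by case: z {zB}.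
by split; rewrite /= in_itv /= -ler_norml; apply: le_trans zB;
  [exact: Re_le_mod|exact: Im_le_mod].
Qed.

(** The form in which compactness of plane sets is used: a property of points at scale d that
    persists at smaller scales and holds locally at some scale holds on K at one scale. *)
Lemma compact_uniform K (P : R -> C -> Prop) : compact K ->
  (forall z (d d' : R), 0 < d' <= d -> P d z -> P d' z) ->
  (forall x, K x -> exists2 d : R, 0 < d & forall w, mod[w - x] < d -> P d w) ->
  exists2 d : R, 0 < d & forall w, K w -> P d w.
Proof.
move=> /compact_near_coveringP cK mono loc.
have := cK R (0^'+) P _.
case=> [x Kx|d /= d0 Hd].
  have [d d0 Hd] := loc x Kx.
  exists (cball x d, [set e | 0 < e <= d]) => /=.
    split; first by apply/nbhsCP; exists d.
    exists d => //= e; rewrite /ball_ /= sub0r normrN => ed e0; rewrite e0.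
    by rewrite ltW//; apply: le_lt_trans ed; exact: ler_norm.
  move=> [w e] /= [wx e01]; apply: (mono _ d) => //; exact: Hd.
have d2 : 0 < d / 2 by rewrite divr_gt0.
exists (d / 2) => // w Kw; apply: (Hd (d / 2)) => //=.
by rewrite /ball_ /= sub0r normrN gtr0_norm//; move: d0; rewrite /=; lra.
Qed.

Lemma compact_unif_cont K f : compact K -> (forall z, K z -> ccont K f z) ->
  forall e : R, 0 < e -> exists2 d : R, 0 < d & forall z w, K z -> K w ->
    mod[w - z] < d -> mod[f w - f z] < e.
Proof.
move=> cK fc e e0; have e2 : 0 < e / 2 by rewrite divr_gt0.
have [||d d0 Hd] := @compact_uniform K (fun d z => K z -> forall w, K w ->
    mod[w - z] < d -> mod[f w - f z] < e) cK.
- by move=> z d d' /andP[_ d'd] H Kz w Kw wz; apply: H => //; exact: lt_le_trans d'd.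
- move=> x Kx; have [d d0 Hd] := fc x Kx _ e2.
  exists (d / 2); first by rewrite divr_gt0.
  move=> z zx Kz w Kw wz; have h1 := Hd z Kz; have h2 := Hd w Kw.
  apply: (le_lt_trans (mod_tri (f x) _ _)); rewrite (modC (f x)).
  have h3 := mod_tri z w x.
  have := h1 _; have := h2 _ => h4 h5.
  have {}h4 : mod[f w - f x] < e / 2 by apply: h4; lra.
  have {}h5 : mod[f z - f x] < e / 2 by apply: h5; lra.
  by lra.
- by exists d => // z w Kz Kw; exact: Hd.
Qed.

Lemma closure_disc : closure (@unit_disc R) = [set z : C | mod[z] <= 1].
Proof.
apply/seteqP; split => z /= H.
  rewrite leNgt; apply/negP => z1.
  have [|w w1 wz] := proj1 (closureCP _ _) H (mod[z] - 1); first by lra.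
  have := mod_triB z w; rewrite modC; move: w1; rewrite /unit_disc /=; lra.
apply/closureCP => e e0.
pose t : R := 1 - Num.min 1 (e / 2) / 2.
have m0 : 0 < Num.min 1 (e / 2) by rewrite lt_min ltr01 divr_gt0.
have m1 : Num.min 1 (e / 2) <= 1 by rewrite ge_min lexx.
have m2 : Num.min 1 (e / 2) <= e / 2 by rewrite ge_min lexx orbT.
exists ((t%:C)%C * z).
  rewrite /unit_disc /= modM modR ger0_norm; last by rewrite /t; lra.
  by rewrite /t; have := mod_ge0 z; nra.
have E (s : R) : (s%:C)%C * z - z = ((s - 1)%:C)%C * z.
  by rewrite rmorphB rmorph1; ring.
rewrite E.
rewrite modM modR distrC ger0_norm; last by rewrite /t; lra.
by rewrite /t; have := mod_ge0 z; nra.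
Qed.

End Compactness.

Section Domain.
Variable R : realType.
Local Notation C := (Cx R).
Implicit Types (a b c z w : C) (f g F : C -> C).
Variable U : set C.
Hypothesis bcd : bounded_convex_domain U.

Lemma dom_open : open U. Proof. by case: bcd => -[]. Qed.

Lemma dom_convex : seg_convex U.
Proof.
have [_ cU _] := bcd; move=> a b t Ua Ub /andP[t0 t1].
have t0' : 0 <= (t%:C)%C :> C by rewrite lecR.
have t1' : (t%:C)%C <= 1 :> C by rewrite -(rmorph1 (real_complex R)) lecR.
have := cU b a (Itv01 t0' t1'); rewrite !inE => /(_ Ub Ua).
congr U; rewrite /conv /= /seg /unstable.onem.
rewrite -[_ *: b]/(_ * b) -[_ *: a]/(_ * a) /=; ring.
Qed.

Lemma dom_bounded : exists2 B : R, 0 < B & forall z, U z -> mod[z] <= B.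
Proof.
have [_ _ [M [Mr HM]]] := bcd.
have [m Mm] : exists m : R, M = (m%:C)%C.
  by exists (complex.Re M); apply: complex_ext => //=; move: Mr => /complex_realP[x ->].
exists (`|m| + 1); first by rewrite ltr_wpDl.
move=> z Uz; have := HM ((`|m| + 1)%:C)%C.
rewrite Mm ltcR'; have mm := ler_norm m.
move=> /(_ _ _ Uz) /=; rewrite normE lecR; apply.
by lra.
Qed.

Lemma dom_compact : compact (closure U).
Proof.
have [B B0 HB] := dom_bounded.
apply: (closed_bounded_compact (B := B + 1)); first exact: closed_closure.
move=> z /closureCP /(_ 1 ltr01)[w /HB wB wz].
by have := mod_triB z w; rewrite modC; lra.
Qed.

(** A point z' of U close to z is joined to a point a' close to a: the segment from a' to
    z' passes through the given point at the same parameter t. *)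
Lemma dom_star a z t : U a -> closure U z -> 0 <= t < 1 -> U (seg a z t).
Proof.
move=> Ua /closureCP cz /andP[t0 t1].
have [rho rho0 Hr] := proj1 (openCP U) dom_open a Ua.
have [|z' Uz' z'z] := cz (rho * (1 - t)); first by rewrite mulr_gt0// subr_gt0.
have t1C : ((1 - t)%:C)%C != 0 :> C.
  by rewrite -mod_gt0 modR normr_gt0 subr_eq0 gt_eqF.
pose a' := a + (t%:C)%C * (z - z') / ((1 - t)%:C)%C.
have Ua' : U a'.
  apply: Hr; rewrite /a' addrAC subrr add0r modM modV modM !modR modC.
  rewrite (ger0_norm t0) ger0_norm ?subr_ge0 ?(ltW t1)//.
  rewrite ltr_pdivrMr ?subr_gt0//; apply: le_lt_trans z'z.
  by rewrite ler_piMl ?mod_ge0// ltW.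
have -> : seg a z t = seg a' z' t.
  rewrite /seg /a'; move: t1C; rewrite rmorphB rmorph1 => t1C.
  by field.
by apply: dom_convex => //; rewrite t0 ltW.
Qed.

Lemma boundaryE : boundary U = closure U `\` U.
Proof. by rewrite /boundary; congr (_ `\` _); exact/interior_id/dom_open. Qed.

Lemma extensionE (V : set C) (h g : C -> C) z : V `<=` closure U ->
  U `<=` V -> V z ->
  (forall w, V w -> ccont V g w) -> (forall w, U w -> g w = h w) ->
  extension U h z = g z.
Proof.
move=> VU UV Vz gc gh; rewrite /extension.
have pf : ProperFilter (within U (nbhs z)) by apply: within_nbhs_proper; exact: VU.
apply: cvg_lim; first exact: norm_hausdorff.
apply/cvgCP => e e0; have [d d0 Hd] := gc z Vz e e0.
apply/nbhsCP; exists d => // w wz Uw; rewrite -gh//.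
by apply: Hd => //; exact: UV.
Qed.

End Domain.

(** * Iterated derivatives and primitives *)

Section Iterated.
Variable R : realType.
Local Notation C := (Cx R).
Implicit Types (a b c z w : C) (f g h F H : C -> C) (U : set C).

Lemma derive1n_ext U f g n : open U -> (forall z, U z -> f z = g z) ->
  hol U f -> forall z, U z -> derive1n n f z = derive1n n g z.
Proof.
move=> oU fg hf; elim: n f g fg hf => [//|n IH] f g fg hf z Uz.
rewrite !derive1Sn; apply: (IH _ _ _ (hol_derive oU hf) z Uz).
move=> w Uw; apply/esym/derive1_cder.
exact: cder_ext oU Uw fg (hol_derive1 hf Uw).
Qed.

Lemma hol_derive1n U f n : open U -> hol U f -> hol U (derive1n n f).
Proof. by move=> oU hf; elim: n => [//|n IH]; exact: hol_derive. Qed.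

Lemma hol_ext U f g : open U -> (forall z, U z -> f z = g z) -> hol U f -> hol U g.
Proof.
by move=> oU fg hf z Uz; have [l dl] := hf z Uz; exists l; exact: cder_ext oU Uz fg dl.
Qed.

Lemma hol_lin U f g c : hol U f -> hol U g -> hol U (fun z => f z + c * g z).
Proof.
move=> hf hg z Uz; have [l dl] := hf z Uz; have [m dm] := hg z Uz.
by eexists; apply: cderD dl _; apply: cderZ; exact: dm.
Qed.

Lemma derive1n_lin U f g c n : open U -> hol U f -> hol U g -> forall z, U z ->
  derive1n n (fun z => f z + c * g z) z = derive1n n f z + c * derive1n n g z.
Proof.
move=> oU hf hg; elim: n => [//|n IH] z Uz.
rewrite !derive1nS; apply: derive1_cder.
apply: (@cder_ext _ (fun z => derive1n n f z + c * derive1n n g z) _ _ _ U) => //.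
  by move=> w Uw; rewrite IH.
apply: cderD; first exact: hol_derive1 (hol_derive1n n oU hf) Uz.
by apply: cderZ; exact: hol_derive1 (hol_derive1n n oU hg) Uz.
Qed.

Lemma hol_dilate U f a b (V : set C) : hol U f -> (forall z, V z -> U (a + b * z)) ->
  hol V (fun z => f (a + b * z)).
Proof.
move=> hf VU z Vz; have [l dl] := hf _ (VU z Vz); eexists.
apply: (@cder_comp _ f (fun z => a + b * z)); last exact: dl.
by apply: cderD; [exact: cder_cst|apply: cderZ; exact: cder_id].
Qed.

Lemma derive1n_dilate U f a b (V : set C) n : open U -> open V -> hol U f ->
  (forall z, V z -> U (a + b * z)) -> forall z, V z ->
  derive1n n (fun z => f (a + b * z)) z = b ^+ n * derive1n n f (a + b * z).
Proof.
move=> oU oV hf VU; elim: n => [|n IH] z Vz; first by rewrite mul1r.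
rewrite !derive1nS; apply: derive1_cder.
apply: (@cder_ext _ (fun z => b ^+ n * derive1n n f (a + b * z)) _ _ _ V) => //.
  by move=> w Vw; rewrite IH.
rewrite exprS mulrC mulrA mulrC; apply: cderZ.
apply: (@cder_comp _ (derive1n n f) (fun z => a + b * z)).
  rewrite -[X in cder _ _ X]mulr1 -[X in cder _ _ X]add0r.
  by apply: cderD; [exact: cder_cst|apply: cderZ; exact: cder_id].
exact: hol_derive1 (hol_derive1n n oU hf) (VU z Vz).
Qed.

(** Each primitive is Lipschitz because its derivative is bounded, and bounded because U is. *)
Lemma iterated_primitive U h p (B K : R) : open U -> seg_convex U ->
  (forall z, U z -> mod[z] <= B) -> hol U h -> (forall z, U z -> mod[h z] <= K) ->
  exists H (K' : R), [/\ hol U H, forall z, U z -> derive1n p H z = h z,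
    forall l z, (l <= p)%N -> U z -> mod[derive1n l H z] <= K' &
    forall l z w, (l < p)%N -> U z -> U w ->
      mod[derive1n l H w - derive1n l H z] <= K' * mod[w - z]].
Proof.
move=> oU cU UB; elim: p h K => [|p IH] h K hh hK.
  exists h, K; split => // l z; rewrite leqn0 => /eqP ->; exact: hK.
have [P dP] := holomorphic_primitive oU cU hh.
have hP : hol U P by move=> z /dP; exists (h z).
have PL z w : U z -> U w -> mod[P w - P z] <= 2 * K * mod[w - z].
  move=> Uz Uw; apply: (cder_mod_le (f := h)) => t t01.
    by apply: dP; exact: cU.
  by apply: hK; exact: cU.
have [PK HPK] : exists PK : R, forall z, U z -> mod[P z] <= PK.
  have [[z0 U0]|noU] := pselect (U !=set0); last first.
    by exists 0 => z Uz; case: noU; exists z.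
  exists (mod[P z0] + 2 * K * (2 * B)) => z Uz.
  have K0 : 0 <= K := le_trans (mod_ge0 _) (hK z Uz).
  have := mod_triB (P z) (P z0); have := PL z0 z U0 Uz.
  have : mod[z - z0] <= 2 * B.
    by have := modB z z0; have := UB z Uz; have := UB z0 U0; lra.
  by nra.
have [H [K' [hH Hp HK' HL]]] := IH P PK hP HPK.
have HpS z : U z -> derive1n p.+1 H z = h z.
  move=> Uz; rewrite derive1nS; apply: derive1_cder.
  by apply: (cder_ext oU Uz _ (dP z Uz)) => w Uw; rewrite Hp.
exists H, (Num.max (Num.max K' K) (2 * K)); split => //.
- move=> l z; rewrite leq_eqVlt => /orP[/eqP ->|lp] Uz.
    by rewrite HpS// !le_max hK ?orbT.
  by apply: (le_trans (HK' l z lp Uz)); rewrite !le_max lexx.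
- move=> l z w; rewrite ltnS leq_eqVlt => /orP[/eqP ->|lp] Uz Uw.
    rewrite !Hp//; apply: (le_trans (PL _ _ Uz Uw)).
    by rewrite ler_wpM2r ?mod_ge0// le_max lexx orbT.
  apply: (le_trans (HL l z w lp Uz Uw)).
  by rewrite ler_wpM2r ?mod_ge0// !le_max lexx.
Qed.

(** McShane's formula: the largest K-Lipschitz function below k on U is the infimum of the
    cones k(w) + K |z - w|. *)
Lemma mcshane U (k : C -> R) (K : R) : U !=set0 -> 0 <= K ->
  (forall z w, U z -> U w -> `|k w - k z| <= K * mod[w - z]) ->
  exists2 g : C -> R, (forall z w, `|g w - g z| <= K * mod[w - z]) &
    forall z, U z -> g z = k z.
Proof.
move=> [z0 U0] K0 kL.
pose A z := [set k w + K * mod[z - w] | w in U].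
have A0 z : A z !=set0 by exists (k z0 + K * mod[z - z0]), z0.
have lbA z w : U w -> lbound (A z) (k w - K * mod[z - w]).
  move=> Uw _ [v Uv <-]; have := kL w v Uw Uv; rewrite ler_norml => /andP[h _].
  have := mod_tri z v w; rewrite (modC v z) => /(ler_wpM2l K0); rewrite mulrDr.
  by lra.
have hA z : has_lbound (A z) by exists (k z0 - K * mod[z - z0]); exact: lbA.
exists (fun z => inf (A z)).
  have half z w : inf (A z) - inf (A w) <= K * mod[w - z].
    rewrite lerBlDl -lerBlDr; apply: lb_le_inf => // _ [v Uv <-].
    rewrite lerBlDr; have : inf (A z) <= k v + K * mod[z - v].
      by apply: ge_inf => //; exists v.
    move=> /le_trans; apply; rewrite -addrA lerD2l -mulrDr ler_wpM2l//.
    by have := mod_tri w z v; rewrite (modC z w); lra.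
  move=> z w; rewrite ler_norml; apply/andP; split; last by rewrite modC; exact: half.
  by rewrite lerNl opprB; exact: half.
move=> z Uz; apply/eqP; rewrite eq_le; apply/andP; split.
  apply: ge_inf => //; exists z => //.
  by rewrite subrr mod0 mulr0 addr0.
apply: lb_le_inf => //; have := lbA z z Uz.
by rewrite subrr mod0 mulr0 subr0.
Qed.

Lemma lipschitz_extension U f (K : R) : U !=set0 ->
  (forall z w, U z -> U w -> mod[f w - f z] <= K * mod[w - z]) ->
  exists2 g : C -> C, (forall z, ccont setT g z) & forall z, U z -> g z = f z.
Proof.
move=> U0 fL; pose K' := Num.max K 0.
have K'0 : 0 <= K' by rewrite le_max lexx orbT.
have fL' z w : U z -> U w -> mod[f w - f z] <= K' * mod[w - z].
  move=> Uz Uw; apply: (le_trans (fL z w Uz Uw)).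
  by rewrite ler_wpM2r ?mod_ge0// le_max lexx.
have [|g1 g1L g1E] := @mcshane U (fun z => complex.Re (f z)) K' U0 K'0.
  move=> z w Uz Uw; rewrite -Re_sub; apply: le_trans (fL' z w Uz Uw).
  exact: Re_le_mod.
have [|g2 g2L g2E] := @mcshane U (fun z => complex.Im (f z)) K' U0 K'0.
  move=> z w Uz Uw; rewrite -Im_sub; apply: le_trans (fL' z w Uz Uw).
  exact: Im_le_mod.
exists (fun z => (g1 z +i* g2 z)%C); last first.
  by move=> z Uz; apply: complex_ext; rewrite /= ?g1E ?g2E.
move=> z e e0; have K1 : 0 < 2 * K' + 1 by lra.
exists (e / (2 * K' + 1)); first by rewrite divr_gt0.
move=> w _; rewrite ltr_pdivlMr// => we.
apply: (le_lt_trans (mod_le_ReIm _)); rewrite Re_sub Im_sub /=.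
have := g1L z w; have := g2L z w; have := mod_ge0 (w - z).
by move: we; lra.
Qed.

End Iterated.

(** * A lacunary series *)

Section Lacunary.
Variable R : realType.
Local Notation C := (Cx R).

Lemma mod_expi (t : R) : mod[expi t] = 1.
Proof. by rewrite /modulus /= cos2Dsin2 sqrtr1. Qed.

Lemma expiX (t : R) n : expi t ^+ n = expi (n%:R * t).
Proof.
elim: n => [|n IH]; first by rewrite expr0 mul0r /expi cos0 sin0.
rewrite exprS IH -natr1 mulrDl mul1r addrC /expi cosD sinD.
by apply: complex_ext => /=; ring.
Qed.

Lemma trig_lip (g dg : R -> R) (s t : R) : (forall x : R, is_derive x 1 g (dg x)) ->
  (forall x, `|dg x| <= 1) -> `|g s - g t| <= `|s - t|.
Proof.
move=> gd dg1.
have H (a b : R) : a <= b -> `|g b - g a| <= `|b - a|.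
  move=> ab; have [x _ ->] := @MVT_segment R g dg a b ab (fun x _ => gd x)
    (derivable_within_continuous (fun x _ => @ex_derive _ _ _ _ _ _ _ (gd x))).
  by rewrite normrM ler_piMl.
by have [st|/ltW st] := leP s t; last exact: H; rewrite distrC (distrC s); exact: H.
Qed.

Lemma cos_lip (s t : R) : `|cos s - cos t| <= `|s - t|.
Proof.
apply: (@trig_lip _ (fun x => - sin x)) => x; rewrite normrN.
by rewrite ler_norml sin_geN1 sin_le1.
Qed.

Lemma sin_lip (s t : R) : `|sin s - sin t| <= `|s - t|.
Proof.
apply: (@trig_lip _ cos) => x.
by rewrite ler_norml cos_geN1 cos_le1.
Qed.

Lemma expi_lip (s t : R) : mod[expi s - expi t] <= 2 * `|s - t|.
Proof.
apply: (le_trans (mod_le_ReIm _)); rewrite Re_sub Im_sub /=.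
by have := cos_lip s t; have := sin_lip s t; lra.
Qed.

(** A quarter period forwards or backwards changes cos x into -sin x or sin x, and
    (-sin x - cos x)^2 + (sin x - cos x)^2 = 2. *)
Lemma quarter_period (x : R) :
  exists2 e : R, `|e| = pi / 2 & 1 <= `|cos (x + e) - cos x|.
Proof.
have p0 : 0 <= (pi : R) / 2 by rewrite divr_ge0// pi_ge0.
have key : 1 <= `|- sin x - cos x| \/ 1 <= `|sin x - cos x|.
  have sc := cos2Dsin2 x.
  have [h|h] := leP 1 `|- sin x - cos x|; [by left|right].
  rewrite leNgt; apply/negP => h'.
  have : `|- sin x - cos x| ^+ 2 < 1 by rewrite expr_lt1.
  have : `|sin x - cos x| ^+ 2 < 1 by rewrite expr_lt1.
  by rewrite !real_normK ?num_real//; move: sc; nra.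
case: key => h; [exists (pi / 2)|exists (- (pi / 2))].
- by rewrite ger0_norm.
- by rewrite cosDpihalf.
- by rewrite normrN ger0_norm.
- by rewrite cosBpihalf.
Qed.

Lemma quarter_period_sin (x : R) :
  exists2 e : R, `|e| = pi / 2 & 1 <= `|sin (x + e) - sin x|.
Proof.
have [e ep] := quarter_period (x - pi / 2); exists e => //.
by rewrite -!cosBpihalf addrAC.
Qed.

Definition amp (k : nat) : R := 8^-1 ^+ k.

Lemma amp_gt0 k : 0 < amp k.
Proof. by rewrite exprn_gt0. Qed.
#[local] Hint Resolve amp_gt0 : core.

Definition lacunary_sum (N : nat -> nat) n (w : C) : C :=
  \sum_(k < n) ((amp k)%:C)%C * w ^+ N k.

Lemma lacunary_limit (N : nat -> nat) : exists Lam : C -> C,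
  forall w, mod[w] <= 1 -> forall n,
    `|complex.Re (Lam w - lacunary_sum N n w)| <= 8 / 7 * amp n /\
    `|complex.Im (Lam w - lacunary_sum N n w)| <= 8 / 7 * amp n.
Proof.
suff H w : exists l : C, mod[w] <= 1 -> forall n,
    `|complex.Re (l - lacunary_sum N n w)| <= 8 / 7 * amp n /\
    `|complex.Im (l - lacunary_sum N n w)| <= 8 / 7 * amp n.
  by have [Lam HL] := choice H; exists Lam.
have [w1|w1] := pselect (mod[w] <= 1); last by exists 0.
have e0 n : 0 <= 8 / 7 * amp n by rewrite mulr_ge0// ltW.
have eS n : amp n = 8 / 7 * amp n - 8 / 7 * amp n.+1.
  by rewrite /amp exprS; field.
have step n : mod[((amp n)%:C)%C * w ^+ N n] <= amp n.
  rewrite modM modR modX gtr0_norm//.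
  by rewrite ler_piMr ?(ltW (amp_gt0 _))// exprn_ile1// mod_ge0.
have sumS n : lacunary_sum N n.+1 w = lacunary_sum N n w + ((amp n)%:C)%C * w ^+ N n.
  by rewrite /lacunary_sum big_ord_recr.
have [|l1 H1] := @nested_limit R (fun n => complex.Re (lacunary_sum N n w)) _ e0.
  move=> n; rewrite sumS Re_add addrAC subrr add0r -eS.
  exact: le_trans (Re_le_mod _) (step n).
have [|l2 H2] := @nested_limit R (fun n => complex.Im (lacunary_sum N n w)) _ e0.
  move=> n; rewrite sumS Im_add addrAC subrr add0r -eS.
  exact: le_trans (Im_le_mod _) (step n).
by exists (l1 +i* l2)%C => _ n; rewrite Re_sub Im_sub.
Qed.

(** N k is chosen after the earlier exponents, which enter only through the Lipschitz
    constant S k of the earlier partial sum. *)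
Lemma lacunary_exponents (Q : nat -> R -> Prop) :
  (forall k, exists2 d : R, 0 < d & forall d', 0 < d' <= d -> Q k d') ->
  exists N : nat -> nat, forall k, [/\ (0 < N k)%N, Q k (pi / (N k)%:R) &
    pi / (N k)%:R * \sum_(j < k) amp j * (N j)%:R <= amp k / 4].
Proof.
move=> HQ.
have pi0 : 0 < (pi : R) := pi_gt0 R.
have /choice[T HT] : forall ks : nat * R, exists n : nat, 0 <= ks.2 -> [/\ (0 < n)%N,
    Q ks.1 (pi / n%:R) & pi / n%:R * ks.2 <= amp ks.1 / 4].
  move=> [k s]; have [d d0 Hd] := HQ k.
  pose m := Num.min d (amp k / 4 / (s + 1)).
  have [s0|s0] := pselect (0 <= s); last by exists 0%N.
  have s1 : 0 < s + 1 by lra.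
  have m0 : 0 < m by rewrite lt_min d0 !divr_gt0.
  exists (Num.bound (pi / m)) => /= _.
  have n1 : pi / m < (Num.bound (pi / m))%:R by apply: archi_boundP; rewrite divr_ge0// ltW.
  set n := Num.bound _ in n1 *.
  have n0 : 0 < n%:R :> R by apply: lt_trans n1; rewrite divr_gt0.
  have nm : pi / n%:R <= m.
    by rewrite ler_pdivrMr// mulrC -ler_pdivrMr// ltW.
  have p0 : 0 < pi / n%:R :> R by rewrite divr_gt0.
  split.
  - by rewrite -(ltr0n R).
  - by apply: Hd; rewrite p0 (le_trans nm)// ge_min lexx.
  - apply: le_trans (_ : _ <= amp k / 4 / (s + 1) * s) _.
      by rewrite ler_wpM2r// (le_trans nm)// ge_min lexx orbT.
    rewrite mulrAC ler_pdivrMr// ler_wpM2l//; last by lra.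
    by rewrite divr_ge0// ltW.
pose S := fix S k : R := if k is k'.+1 then S k' + amp k' * (T (k', S k'))%:R else 0.
have S0 k : 0 <= S k.
  by elim: k => [|k IH] //=; rewrite addr_ge0// mulr_ge0// ltW.
exists (fun k => T (k, S k)) => k.
have -> : \sum_(j < k) amp j * (T (nat_of_ord j, S j))%:R = S k.
  by elim: k => [|k IH]; rewrite ?big_ord0// big_ord_recr /= IH.
exact: HT (k, S k) (S0 k).
Qed.

(** At distance at most pi / N k, the k-th term changes by amp k at least, the terms before
    it by amp k / 4 at most, and those after it by 2 amp k / 7 at most.  The map [sel] is the
    real or the imaginary part, and c the cosine or the sine. *)
Lemma lacunary_oscillation (c : R -> R) (sel : C -> R) (N : nat -> nat)
    (Lam : C -> C) k (t : R) :
  (forall x y, `|c x - c y| <= `|x - y|) ->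
  (forall x, exists2 e : R, `|e| = pi / 2 & 1 <= `|c (x + e) - c x|) ->
  (forall x, sel (expi x) = c x) ->
  (forall n s, sel (lacunary_sum N n (expi s)) =
     \sum_(j < n) amp j * sel (expi s ^+ N j)) ->
  (forall n s, `|sel (Lam (expi s)) - sel (lacunary_sum N n (expi s))| <= 8 / 7 * amp n) ->
  (0 < N k)%N -> pi / (N k)%:R * \sum_(j < k) amp j * (N j)%:R <= amp k / 4 ->
  exists2 s : R, `|s - t| <= pi / (N k)%:R &
    amp k / 4 <= `|sel (Lam (expi s)) - sel (Lam (expi t))|.
Proof.
move=> cL cO selc selS selL Nk Hk.
have pi0 : 0 < (pi : R) := pi_gt0 R.
have N0 : 0 < (N k)%:R :> R by rewrite ltr0n.
have [e ep e1] := cO ((N k)%:R * t).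
pose s := t + e / (N k)%:R.
have st : `|s - t| <= pi / (N k)%:R.
  rewrite /s addrAC subrr add0r normrM ep normfV gtr0_norm// ler_pM2r ?invr_gt0//.
  by lra.
exists s => //.
have kt : 1 <= `|c ((N k)%:R * s) - c ((N k)%:R * t)|.
  by rewrite /s mulrDr [(N k)%:R * (e / _)]mulrC divfK ?gt_eqF.
have low : `|\sum_(j < k) amp j * (c ((N j)%:R * s) - c ((N j)%:R * t))| <= amp k / 4.
  apply: le_trans Hk; apply: (le_trans (ler_norm_sum _ _ _)).
  rewrite mulr_sumr; apply: ler_sum => j _.
  rewrite normrM gtr0_norm// mulrCA ler_wpM2l ?(ltW (amp_gt0 _))//.
  apply: (le_trans (cL _ _)); rewrite -mulrBr normrM ger0_norm// mulrC.
  by rewrite ler_wpM2r.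
have E x : sel (lacunary_sum N k.+1 (expi x)) =
    \sum_(j < k) amp j * c ((N j)%:R * x) + amp k * c ((N k)%:R * x).
  rewrite selS big_ord_recr /= expiX selc; congr (_ + _).
  by apply: eq_bigr => j _; rewrite expiX selc.
have dist x : `|sel (Lam (expi x)) - (\sum_(j < k) amp j * c ((N j)%:R * x) +
    amp k * c ((N k)%:R * x))| <= 8 / 7 * amp k.+1 by rewrite -E; exact: selL.
have hs := dist s; have ht := dist t.
have aS : 8 / 7 * amp k.+1 = amp k / 7 by rewrite /amp exprS; field.
rewrite aS in hs ht.
have {}low : `|\sum_(j < k) amp j * c ((N j)%:R * s) -
    \sum_(j < k) amp j * c ((N j)%:R * t)| <= amp k / 4.
  move: low; rewrite (eq_bigr _ (fun j _ => mulrBr _ _ _)).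
  by rewrite sumrB.
have big : amp k <= `|amp k * c ((N k)%:R * s) - amp k * c ((N k)%:R * t)|.
  by rewrite -mulrBr normrM gtr0_norm// ler_peMr// ltW.
move: hs ht low big.
set A := \sum_(_ < _) _; set B := amp k * c (_ * s); set A' := \sum_(_ < _) _.
set B' := amp k * c (_ * t); set X := sel _; set Y := sel _ => hs ht low big.
have ak := amp_gt0 k.
have := ler_normB (B - B' + (A - A') - (X - Y)) (A - A' - (X - Y)).
have -> : B - B' + (A - A') - (X - Y) - (A - A' - (X - Y)) = B - B' by ring.
have h1 : `|B - B' + (A - A') - (X - Y)| <= amp k / 7 + amp k / 7.
  have -> : B - B' + (A - A') - (X - Y) = - (X - (A + B)) + (Y - (A' + B')) by ring.
  by apply: (le_trans (ler_normD _ _)); rewrite normrN lerD.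
have := ler_normB (A - A') (X - Y).
by lra.
Qed.

(** Q k d is any condition that holds for all small scales d; the k-th oscillation takes
    place at a scale satisfying Q k. *)
Theorem lacunary_function (Q : nat -> R -> Prop) :
  (forall k, exists2 d : R, 0 < d & forall d', 0 < d' <= d -> Q k d') ->
  exists (N : nat -> nat) (Lam : C -> C), [/\
    forall w, mod[w] <= 1 -> forall n, mod[Lam w - lacunary_sum N n w] <= 4 * amp n,
    (forall k, Q k (pi / (N k)%:R)) &
    forall k t,
    (exists2 s : R, `|s - t| <= pi / (N k)%:R & amp k / 4 <=
       `|complex.Re (Lam (expi s)) - complex.Re (Lam (expi t))|) /\
    (exists2 s : R, `|s - t| <= pi / (N k)%:R & amp k / 4 <=
       `|complex.Im (Lam (expi s)) - complex.Im (Lam (expi t))|)].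
Proof.
move=> /lacunary_exponents[N HN]; have [Lam HL] := lacunary_limit N.
exists N, Lam; split.
- move=> w w1 n; apply: (le_trans (mod_le_ReIm _)).
  by have [h1 h2] := HL w w1 n; have := amp_gt0 n; lra.
- by move=> k; have [] := HN k.
move=> k t; have [Nk _ Hk] := HN k.
split.
- apply: (lacunary_oscillation t cos_lip quarter_period _ _ _ Nk Hk) => //.
    move=> n s; rewrite /lacunary_sum; elim/big_ind2 : _ => //.
      by move=> x1 x2 y1 y2 <- <-; rewrite Re_add.
    by move=> j _; rewrite Re_mul /= mul0r subr0.
  by move=> n s; rewrite -Re_sub; apply: (proj1 (HL _ _ n)); rewrite mod_expi.
- apply: (lacunary_oscillation t sin_lip quarter_period_sin _ _ _ Nk Hk) => //.
    move=> n s; rewrite /lacunary_sum; elim/big_ind2 : _ => //.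
      by move=> x1 x2 y1 y2 <- <-; rewrite Im_add.
    by move=> j _; rewrite Im_mul /= mul0r addr0.
  by move=> n s; rewrite -Im_sub; apply: (proj2 (HL _ _ n)); rewrite mod_expi.
Qed.

End Lacunary.

(** * The space A^p and steep functions *)

Section Space.
Variable R : realType.
Local Notation C := (Cx R).
Variables (Omega J : set C) (p : nat).
Hypothesis bcd : bounded_convex_domain Omega.
Hypothesis Jprop : J `<` boundary Omega.
Hypothesis Jopen : relatively_open J (boundary Omega).
Implicit Types (z w : C) (f g : Ap Omega J p).

Let oO : open Omega := dom_open bcd.
Let cO : seg_convex Omega := dom_convex bcd.
Let V := Omega `|` J.

Lemma V_closure : V `<=` closure Omega.
Proof.
move=> z [Oz|Jz]; first exact: subset_closure.
by have [Jb _] := Jprop; have := Jb z Jz; rewrite (boundaryE bcd) => -[].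
Qed.

Lemma omega_V : Omega `<=` V. Proof. by move=> z; left. Qed.

Local Notation E l h := (extension Omega (derive1n l h)).

Lemma ap_hol f : hol Omega f.
Proof. by move=> z Oz; apply/derivableCP/ap_holomorphic. Qed.

Lemma ext_val l (h : C -> C) (k : C -> C) : (forall z, V z -> ccont V k z) ->
  (forall z, Omega z -> k z = derive1n l h z) -> forall z, V z -> E l h z = k z.
Proof.
by move=> kc kE z Vz; apply: (extensionE V_closure omega_V Vz kc kE).
Qed.

Lemma ccont_ext (A : set C) (k k' : C -> C) z : A z -> (forall w, A w -> k w = k' w) ->
  ccont A k z -> ccont A k' z.
Proof.
move=> Az kk kc e /kc[d d0 Hd]; exists d => // w Aw wd.
by rewrite -!kk//; exact: Hd.
Qed.

Lemma ap_ext f l : (l <= p)%N ->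
  (forall z, V z -> ccont V (E l f) z) /\
  (forall z, Omega z -> E l f z = derive1n l f z).
Proof.
move=> lp; have [k /within_contP kc kE] := ap_extends f lp.
have EV := ext_val kc kE; split => z Vz; last by rewrite EV ?kE//; exact: omega_V.
by apply: (@ccont_ext _ k) (kc z Vz) => // w Vw; rewrite EV.
Qed.

Lemma ccontB (A : set C) (k k' : C -> C) z : ccont A k z -> ccont A k' z ->
  ccont A (fun w => k w - k' w) z.
Proof.
move=> kc kc' e e0; have e2 : 0 < e / 2 by rewrite divr_gt0.
have [d d0 Hd] := kc _ e2; have [d' d0' Hd'] := kc' _ e2.
exists (Num.min d d'); first by rewrite lt_min d0.
move=> w Aw; rewrite lt_min => /andP[/(Hd w Aw) h1 /(Hd' w Aw) h2].
have -> : k w - k' w - (k z - k' z) = (k w - k z) - (k' w - k' z) by ring.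
by apply: (le_lt_trans (modB _ _)); lra.
Qed.

Lemma ap_extB f g l z : (l <= p)%N -> V z -> E l (g \- f) z = E l g z - E l f z.
Proof.
move=> lp Vz; have [fc fE] := ap_ext f lp; have [gc gE] := ap_ext g lp.
apply: (@ext_val l (g \- f) (fun z => E l g z - E l f z)) => // w Vw.
  by apply: ccontB; [exact: gc|exact: fc].
have -> : g \- f = (fun z => g z + -1 * f z) by apply/funext => y /=; rewrite mulN1r.
by rewrite (derive1n_lin _ _ oO (ap_hol g) (ap_hol f))// gE// fE// mulN1r.
Qed.

Lemma dist_le (A : set C) z w : A w -> dist z A <= mod[z - w].
Proof. by move=> Aw; apply: ge_inf; [exists 0 => _ [v _ <-]; exact: mod_ge0|exists w]. Qed.

Lemma rest_neq0 : boundary Omega `\` J !=set0.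
Proof.
by apply/set0P/eqP; rewrite setD_eq0; have [] := Jprop.
Qed.

Lemma le_dist z (r : R) :
  (forall w, (boundary Omega `\` J) w -> r <= mod[z - w]) -> r <= dist z (boundary Omega `\` J).
Proof.
move=> H; apply: lb_le_inf; last by move=> _ [w bw <-]; exact: H.
by have [w bw] := rest_neq0; exists mod[z - w], w.
Qed.

Lemma dist_lip z w : dist w (boundary Omega `\` J) - mod[z - w] <= dist z (boundary Omega `\` J).
Proof.
apply: le_dist => v bv; have := dist_le w bv; have := mod_tri z w v.
by rewrite (modC w z); lra.
Qed.

Lemma dist_gt0 z : J z -> 0 < dist z (boundary Omega `\` J).
Proof.
have [W oW JE] := Jopen; move=> Jz.
have [r r0 Hr] : exists2 r : R, 0 < r & forall w, mod[w - z] < r -> W w.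
  by apply: (proj1 (openCP W) oW); move: Jz; rewrite JE => -[].
apply: (lt_le_trans r0); apply: le_dist => w [bw Jw]; rewrite leNgt; apply/negP => wr.
by apply: Jw; rewrite JE; split => //; apply: Hr; rewrite modC.
Qed.

Lemma boundary_J z : boundary Omega z -> 0 < dist z (boundary Omega `\` J) -> J z.
Proof.
move=> bz dz; apply: contrapT => Jz.
have := @dist_le (boundary Omega `\` J) z z (conj bz Jz).
by rewrite subrr mod0 leNgt dz.
Qed.

(** Compactness arguments about Delta m can be run on the whole closure of Omega, as no
    point of Delta m comes near the boundary points outside J. *)
Lemma far_from_rest m w x : (0 < m)%N -> closure Omega x -> ~ V x ->
  mod[w - x] < m%:R^-1 -> ~ Delta Omega J m w.
Proof.
move=> m0 cx Vx wx [_ dw _]; have bx : (boundary Omega `\` J) x.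
  rewrite (boundaryE bcd); split; last by move=> Jx; apply: Vx; right.
  by split => // Ox; apply: Vx; left.
by have := dist_le w bx; lra.
Qed.

Lemma delta_bounded m (k : C -> C) : (0 < m)%N -> (forall z, V z -> ccont V k z) ->
  exists2 B : R, 0 <= B & forall z, Delta Omega J m z -> mod[k z] <= B.
Proof.
move=> m0 kc.
have [||d d0 Hd] := @compact_uniform R (closure Omega)
  (fun d z => Delta Omega J m z -> mod[k z] <= d^-1) (dom_compact bcd).
- move=> z d d' /andP[d'0 d'd] H /H/le_trans; apply.
  by rewrite lef_pV2 ?posrE//; apply: lt_le_trans d'd.
- move=> x cx; have [Vx|Vx] := pselect (V x); last first.
    exists m%:R^-1; first by rewrite invr_gt0 ltr0n.
    by move=> w wx Dw; case: (far_from_rest m0 cx Vx wx Dw).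
  have [d d0 Hd] := kc x Vx 1 ltr01.
  have k1 : 0 < mod[k x] + 1 by have := mod_ge0 (k x); lra.
  exists (Num.min d (mod[k x] + 1)^-1); first by rewrite lt_min d0 invr_gt0.
  move=> w; rewrite lt_min => /andP[wd _] [Vw _ _].
  apply: le_trans (_ : _ <= mod[k x] + 1) _.
    by have := Hd w Vw wd; have := mod_triB (k w) (k x); lra.
  rewrite -[leLHS]invrK lef_pV2 ?posrE ?invr_gt0 ?lt_min ?d0 ?invr_gt0//.
  by rewrite ge_min lexx orbT.
exists d^-1; first by rewrite invr_ge0 ltW.
by move=> z Dz; apply: Hd => //; apply: V_closure; case: Dz.
Qed.

Lemma seminorm_le l m (h : C -> C) (B : R) : 0 <= B ->
  (forall z, Delta Omega J m z -> mod[E l h z] <= B) -> Ap_seminorm Omega J l m h <= B.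
Proof.
move=> B0 H; rewrite /Ap_seminorm.
have [D0|/set0P/negP/negPn/eqP ->] := pselect (Delta Omega J m !=set0); last first.
  by rewrite image_set0 sup0.
apply: ge_sup; last by move=> _ [z Dz <-]; exact: H.
by have [z Dz] := D0; exists mod[E l h z], z.
Qed.

Lemma le_seminorm f g l m z : (l <= p)%N -> (0 < m)%N -> Delta Omega J m z ->
  mod[E l g z - E l f z] <= Ap_seminorm Omega J l m (g \- f).
Proof.
move=> lp m0 Dz; have Vz : V z by case: Dz.
have [fc _] := ap_ext f lp; have [gc _] := ap_ext g lp.
have [B B0 HB] := delta_bounded m0 (fun w Vw => ccontB (gc w Vw) (fc w Vw)).
rewrite -ap_extB//; apply: ub_le_sup; last by exists z.
by exists B => _ [w Dw <-]; rewrite ap_extB//; [exact: HB|case: Dw].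
Qed.

Variable phi : C -> C.
Variable rho : C -> R.
Hypothesis rho_sub : forall z w, rho (z - w) = rho z - rho w.
Hypothesis rho_le : forall z, `|rho z| <= mod[z].

(** [eta] and [m] do not depend on t: [m] keeps the points phi(e^is) away
    from the boundary points outside J, so that one seminorm controls the inequality at all t. *)
Definition steep (n : nat) (f : C -> C) := exists (eta : R) (m : nat),
  [/\ 0 < eta, (0 < m)%N & forall t : R, J (phi (expi t)) ->
    Delta Omega J n.+1 (phi (expi t)) -> exists s : R,
    [/\ J (phi (expi s)), Delta Omega J m (phi (expi s)),
        `|s - t| < n.+1%:R^-1 &
        n.+1%:R * (`|s - t| + mod[phi (expi s) - phi (expi t)]) + eta <=
        `|rho (E p f (phi (expi s))) - rho (E p f (phi (expi t)))|]].

Lemma perturbed_gap (a b c d x eta : R) : x + eta <= `|a - b| ->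
  `|c - a| <= eta / 4 -> `|d - b| <= eta / 4 -> x + eta / 2 <= `|c - d|.
Proof.
move=> big h1 h2.
have := ler_normD (c - d) (- (c - a) + (d - b)).
have -> : c - d + (- (c - a) + (d - b)) = a - b by ring.
have := ler_normD (- (c - a)) (d - b); rewrite normrN.
by lra.
Qed.

Lemma steep_open n : Ap_open [set f : Ap Omega J p | steep n f].
Proof.
move=> f [eta [m [eta0 m0 H]]].
exists (maxn m n.+1), (eta / 4); first by rewrite divr_gt0.
move=> g gf; exists (eta / 2), m; split => //; first by rewrite divr_gt0.
move=> t Jt Dt; have [s [Js Ds st big]] := H t Jt Dt; exists s; split => //.
have close m' z : (0 < m' <= maxn m n.+1)%N -> Delta Omega J m' z ->
    `|rho (E p g z) - rho (E p f z)| <= eta / 4.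
  move=> m01 Dz; rewrite -rho_sub; apply: (le_trans (rho_le _)).
  have /andP[m'0 _] := m01; apply: (le_trans (le_seminorm f g (leqnn p) m'0 Dz)).
  by apply/ltW/gf.
have := close _ _ _ Ds; rewrite m0 leq_max leqnn => /(_ isT) h1.
have := close _ _ _ Dt; rewrite leq_max leqnn orbT => /(_ isT) h2.
exact: perturbed_gap big h1 h2.
Qed.

Lemma slope_contra (a b l h Z N eta : R) : 0 <= Z -> `|l| + 1 <= N -> 0 < eta ->
  N * (`|h| + Z) + eta <= `|a - b| -> `|a - b - l * h| <= 1 * `|h| -> False.
Proof.
move=> Z0 lN eta0 big; rewrite mul1r => small; have h0 := normr_ge0 h.
have : `|a - b| <= (`|l| + 1) * `|h|.
  by have := ler_normD (a - b - l * h) (l * h); rewrite subrK normrM; lra.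
have : (`|l| + 1) * `|h| <= N * (`|h| + Z).
  by have := normr_ge0 l => l0; apply: ler_pM => //; lra.
lra.
Qed.

Lemma steep_not_derivable (f : C -> C) t : (forall n, steep n f) -> J (phi (expi t)) ->
  ~ derivable (fun s : R => rho (E p f (phi (expi s)))) t 1.
Proof.
move=> Hf Jt dv; have /is_deriveRP := derivableP dv.
set l := derive _ t 1 => /(_ 1 ltr01)[d d0 Hd].
set z := phi (expi t) in Jt *.
pose D := dist z (boundary Omega `\` J).
have D0 : 0 < D by exact: dist_gt0.
pose x := `|l| + 1 + d^-1 + D^-1 + mod[z].
have d1 : 0 < d^-1 by rewrite invr_gt0.
have D1 : 0 < D^-1 by rewrite invr_gt0.
have l0 := normr_ge0 l; have z0 := mod_ge0 z.
have x0 : 0 <= x by rewrite /x; lra.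
set n := Num.bound x.
have nx : x <= n.+1%:R.
  by apply: ltW; apply: lt_trans (archi_boundP x0) _; rewrite ltr_nat.
have n0 : 0 < n.+1%:R :> R by rewrite ltr0n.
have inv_le (y : R) : 0 < y -> y^-1 <= x -> n.+1%:R^-1 <= y.
  move=> y0 yx; rewrite -[leRHS]invrK lef_pV2 ?posrE ?invr_gt0//.
  exact: le_trans yx nx.
have [eta [m [eta0 m0 H]]] := Hf n.
have [|s [_ _ st big]] := H t Jt.
  split; [by right| |by apply: le_trans nx; rewrite /x; lra].
  by apply: inv_le => //; rewrite /x -/D; lra.
have sd : `|s - t| < d.
  by apply: (lt_le_trans st); apply: inv_le => //; rewrite /x; lra.
apply: (slope_contra (mod_ge0 _) _ eta0 big (Hd s sd)).
by apply: le_trans nx; rewrite /x; lra.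
Qed.

End Space.

(** * Density *)

Section Density.
Variable R : realType.
Local Notation C := (Cx R).
Variables (Omega J : set C) (p : nat).
Hypothesis bcd : bounded_convex_domain Omega.
Hypothesis Jprop : J `<` boundary Omega.
Implicit Types (z w : C) (f g : Ap Omega J p).

Let oO : open Omega := dom_open bcd.
Let cO : seg_convex Omega := dom_convex bcd.
Let V := Omega `|` J.
Let VC : V `<=` closure Omega := V_closure bcd Jprop.

Local Notation E l h := (extension Omega (derive1n l h)).

Lemma finite_radius (Q : nat -> R -> Prop) n :
  (forall l d d', 0 < d' <= d -> Q l d -> Q l d') ->
  (forall l, (l <= n)%N -> exists2 d : R, 0 < d & Q l d) ->
  exists2 d : R, 0 < d & forall l, (l <= n)%N -> Q l d.
Proof.
move=> mono; elim: n => [|n IH] H.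
  by have [d d0 Qd] := H 0%N (leqnn _); exists d => // l; rewrite leqn0 => /eqP ->.
have [l ln|d d0 Hd] := IH; first by apply: H; exact: leqW.
have [d' d'0 Hd'] := H n.+1 (leqnn _).
have m0 : 0 < Num.min d d' by rewrite lt_min d0.
exists (Num.min d d') => // l; rewrite leq_eqVlt => /orP[/eqP ->|ln].
  by apply: mono Hd'; rewrite m0 ge_min lexx orbT.
by apply: mono (Hd l ln); rewrite m0 ge_min lexx.
Qed.

Lemma Delta_mono m n : (0 < m <= n)%N -> Delta Omega J m `<=` Delta Omega J n.
Proof.
move=> /andP[m0 mn] z [Vz dz zm]; have n0 : (0 < n)%N := leq_trans m0 mn.
split => //; last by apply: (le_trans zm); rewrite ler_nat.
by apply: le_trans dz; rewrite lef_pV2 ?posrE ?ltr0n// ler_nat.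
Qed.

Lemma one_sub_powX (d : R) l : 0 <= d <= 1 -> 0 <= 1 - (1 - d) ^+ l <= l%:R * d.
Proof.
move=> /andP[d0 d1]; elim: l => [|l /andP[IH1 IH2]].
  by rewrite expr0 subrr mul0r lexx.
rewrite exprS -natr1; set x := (1 - d) ^+ l in IH1 IH2 *.
have x0 : 0 <= x by rewrite exprn_ge0// subr_ge0.
by apply/andP; split; nra.
Qed.

Lemma scaled_close (c : R) (s w x : C) (e b K : R) : 0 <= 1 - c <= b ->
  mod[s - x] < Num.min 1 (e / 4) -> mod[w - x] < Num.min 1 (e / 4) ->
  mod[x] + 1 <= K -> b * K <= e / 2 -> mod[(c%:C)%C * s - w] <= e.
Proof.
move=> /andP[c0 cb]; rewrite !lt_min => /andP[s1 s4] /andP[w1 w4] xK bK.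
have -> : (c%:C)%C * s - w = (s - x) - (w - x) - ((1 - c)%:C)%C * s.
  by rewrite rmorphB rmorph1; ring.
apply: (le_trans (modB _ _)); rewrite modM modR ger0_norm//.
have := modB (s - x) (w - x).
have sK : mod[s] <= K by have := mod_triB s x; lra.
have : (1 - c) * mod[s] <= b * K by apply: ler_pM => //; exact: mod_ge0.
lra.
Qed.

Lemma dilate_uniform a (k : C -> C) l m (e : R) : Omega a -> (0 < m)%N -> 0 < e ->
  (forall z, V z -> ccont V k z) ->
  exists2 d : R, 0 < d & forall d', 0 < d' <= d -> d' < 1 ->
    forall z, Delta Omega J m z ->
    mod[((1 - d')%:C)%C ^+ l * k (seg a z (1 - d')) - k z] <= e.
Proof.
move=> Oa m0 e0 kc.
have [||d d0 Hd] := @compact_uniform R (closure Omega)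
  (fun d z => forall d', 0 < d' <= d -> d' < 1 -> Delta Omega J m z ->
    mod[((1 - d')%:C)%C ^+ l * k (seg a z (1 - d')) - k z] <= e) (dom_compact bcd).
- move=> z d d' /andP[d'0 d'd] H x /andP[x0 xd']; apply: H.
  by rewrite x0 (le_trans xd').
- move=> x cx; have [Vx|Vx] := pselect (V x); last first.
    exists m%:R^-1; first by rewrite invr_gt0 ltr0n.
    by move=> w wx d' _ _ Dw; case: (far_from_rest bcd m0 cx Vx wx Dw).
  have [|d d0 Hd] := kc x Vx (Num.min 1 (e / 4)); first by rewrite lt_min ltr01 divr_gt0.
  pose A := mod[a - x] + 1; have A0 : 0 < A by rewrite ltr_wpDl ?mod_ge0.
  pose K := mod[k x] + 1; have K0 : 0 < K by rewrite ltr_wpDl ?mod_ge0.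
  pose L := l%:R + 1 : R; have L0 : 0 < L by rewrite ltr_wpDl ?ler0n.
  exists (Num.min (Num.min 1 (d / 2)) (Num.min (d / 4 / A) (e / 2 / (L * K)))).
    by rewrite !lt_min ltr01 !divr_gt0// mulr_gt0.
  move=> w; rewrite !lt_min => /andP[/andP[w1 wd] _] d' /andP[d'0].
  rewrite !le_min => /andP[_ /andP[d'A d'K]] d'1 [Vw _ _].
  have awA : mod[a - w] <= A.
    by have := mod_tri x a w; rewrite (modC x) /A; lra.
  have sw : mod[seg a w (1 - d') - w] < d / 2.
    have -> : seg a w (1 - d') - w = (d'%:C)%C * (a - w).
      by rewrite /seg rmorphB rmorph1; ring.
    rewrite modM modR gtr0_norm//; move: d'A; rewrite ler_pdivlMr// => d'A.
    have : d' * mod[a - w] <= d' * A by rewrite ler_wpM2l// ltW.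
    lra.
  have Os : Omega (seg a w (1 - d')).
    by apply: (dom_star bcd Oa (VC Vw)); lra.
  rewrite -rmorphXn.
  apply: (@scaled_close _ _ _ (k x) e (l%:R * d') K).
  + by apply: one_sub_powX; lra.
  + apply: (Hd _ (or_introl Os)); have := mod_tri w (seg a w (1 - d')) x; lra.
  + by apply: (Hd _ Vw); lra.
  + by [].
  + move: d'K; rewrite ler_pdivlMr ?mulr_gt0// => d'K.
    apply: le_trans d'K; rewrite mulrAC mulrC ler_wpM2l ?(ltW d'0)//.
    by rewrite ler_wpM2r ?(ltW K0)// lerDl.
- exists d => // d' d'd d'1 z Dz; apply: Hd => //; apply: VC; by case: Dz.
Qed.

Lemma closure_seg : seg_convex (closure Omega).
Proof.
move=> a b t ca cb t01; apply/closureCP => e e0.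
have [a' Oa' aa] := proj1 (closureCP _ _) ca e e0.
have [b' Ob' bb] := proj1 (closureCP _ _) cb e e0.
exists (seg a' b' t); first exact: cO.
have -> : seg a' b' t - seg a b t = seg (a' - a) (b' - b) t - 0.
  by rewrite /seg; ring.
have := @cball_convex R 0 e (a' - a) (b' - b) t.
by rewrite /cball /= !subr0; apply.
Qed.

Lemma dilate_lipschitz a (k k' : C -> C) (r : R) : Omega a -> 0 <= r < 1 ->
  (forall z, Omega z -> cder k z (k' z)) -> cont_on Omega k' ->
  exists2 K : R, 0 <= K & forall z w, closure Omega z -> closure Omega w ->
    mod[k (seg a w r) - k (seg a z r)] <= K * mod[w - z].
Proof.
move=> Oa r01 dk kc; have /andP[r0 r1] := r01.
have dil x y : mod[seg a y r - seg a x r] <= mod[y - x].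
  have -> : seg a y r - seg a x r = (r%:C)%C * (y - x) by rewrite /seg; ring.
  by rewrite modM modR ger0_norm// ler_piMl ?mod_ge0// ltW.
have [||d d0 Hd] := @compact_uniform R (closure Omega)
  (fun d z => mod[k' (seg a z r)] <= d^-1) (dom_compact bcd).
- move=> z d d' /andP[d'0 d'd] /le_trans; apply.
  by rewrite lef_pV2 ?posrE//; apply: lt_le_trans d'd.
- move=> x cx; have Ox : Omega (seg a x r) by exact: dom_star.
  have [d d0 Hd] := kc _ Ox 1 ltr01.
  have k1 : 0 < mod[k' (seg a x r)] + 1 by rewrite ltr_wpDl ?mod_ge0.
  exists (Num.min d (mod[k' (seg a x r)] + 1)^-1); first by rewrite lt_min d0 invr_gt0.
  move=> w; rewrite lt_min => /andP[wd _].
  apply: le_trans (_ : _ <= mod[k' (seg a x r)] + 1) _.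
    have := Hd (seg a w r) I (le_lt_trans (dil _ _) wd).
    by have := mod_triB (k' (seg a w r)) (k' (seg a x r)); lra.
  rewrite -[leLHS]invrK lef_pV2 ?posrE ?invr_gt0 ?lt_min ?d0 ?invr_gt0//.
  by rewrite ge_min lexx orbT.
have d1 : 0 <= d^-1 by rewrite invr_ge0 ltW.
exists (2 * d^-1); first by rewrite mulr_ge0.
move=> z w cz cw.
apply: le_trans (_ : _ <= 2 * d^-1 * mod[seg a w r - seg a z r]) _; last first.
  by rewrite ler_wpM2l ?mulr_ge0.
have E t : seg (seg a z r) (seg a w r) t = seg a (seg z w t) r by rewrite /seg; ring.
apply: (cder_mod_le (f := k')) => t t01; rewrite E.
  by apply: dk; exact: (dom_star bcd Oa (closure_seg cz cw t01) r01).
exact: Hd _ (closure_seg cz cw t01).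
Qed.

Lemma ext_bound (k : C -> C) (K : R) z : V z -> ccont V k z ->
  (forall w, Omega w -> mod[k w] <= K) -> mod[k z] <= K.
Proof.
move=> Vz kc kK; rewrite leNgt; apply/negP => Kk.
have [|d d0 Hd] := kc (mod[k z] - K); first by rewrite subr_gt0.
have [w Ow wz] := proj1 (closureCP _ _) (VC Vz) d d0.
have := Hd w (or_introl Ow) wz; rewrite modC.
by have := kK w Ow; have := mod_triB (k z) (k w); lra.
Qed.

Variable phi : C -> C.
Hypothesis riemann : extended_riemann_map Omega phi.

Lemma expi_disc (t : R) : mod[expi t] <= 1.
Proof. by rewrite mod_expi. Qed.

Lemma riemann_inverse : exists psi : C -> C,
  [/\ hol Omega psi, (forall w, closure Omega w -> ccont (closure Omega) psi w),
      (forall w, closure Omega w -> mod[psi w] <= 1) &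
      (forall t, psi (phi (expi t)) = expi t)].
Proof.
have [hphi [phiO _ phiS] [psi []]] := riemann; rewrite closure_disc.
move=> /within_contP phic /within_contP psic phiK psiK.
have psiD w : Omega w -> unit_disc (psi w) /\ phi (psi w) = w.
  move=> Ow; have [z z1 zw] := phiS w Ow.
  have [_ E] := phiK z (ltW z1).
  by rewrite -zw E.
exists psi; split => //.
- apply: (@hol_inverse R (@unit_disc R) Omega phi psi) => //.
  + apply/openCP => z z1; exists (1 - mod[z]); first by rewrite subr_gt0.
    move=> w wz; rewrite /unit_disc /=; have := mod_triB w z; lra.
  + by move=> z z1; apply/derivableCP; exact: hphi.
  + by move=> z z1; have [] := phiK z (ltW z1).
  + move=> w Ow e e0.
    have [d d0 Hd] := psic w (subset_closure Ow) e e0.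
    have [r r0 Hr] := proj1 (openCP _) oO w Ow.
    exists (Num.min d r); first by rewrite lt_min d0.
    move=> v _; rewrite lt_min => /andP[vd vr].
    by apply: Hd => //; apply: subset_closure; exact: Hr.
- by move=> w /psiK[].
- by move=> t; have [] := phiK (expi t) (expi_disc t).
Qed.

Lemma riemann_boundary t : boundary Omega (phi (expi t)).
Proof.
have [hphi [phiO _ phiS] [psi []]] := riemann; rewrite closure_disc.
move=> phic psic phiK psiK; rewrite (boundaryE bcd).
have [cphi psiphi] : closure Omega (phi (expi t)) /\ psi (phi (expi t)) = expi t.
  exact: phiK (expi_disc t).
split=> // /phiS[z z1 zt].
have [_] := phiK z (ltW z1); rewrite zt psiphi => tz.
by have : mod[z] < 1 := z1; rewrite -tz mod_expi ltxx.
Qed.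

(** Any scale that suits this bound may serve as the scale of an oscillation: this is how
    the exponents of the lacunary series come to depend on phi. *)
Lemma riemann_uniform (e : R) : 0 < e -> exists2 d : R, 0 < d &
  forall s t : R, `|s - t| <= d -> `|s - t| + mod[phi (expi s) - phi (expi t)] <= e.
Proof.
move=> e0; have [hphi _ [psi []]] := riemann.
move=> /within_contP phic _ _ _; have e2 : 0 < e / 2 by rewrite divr_gt0.
have cD : compact (closure (@unit_disc R)).
  apply: (closed_bounded_compact (B := 1)); first exact: closed_closure.
  by move=> z; rewrite closure_disc.
have [d d0 Hd] := compact_unif_cont cD phic e2.
exists (Num.min (e / 2) (d / 3)); first by rewrite lt_min e2 divr_gt0.
move=> s t; rewrite le_min => /andP[st1 st2].
have Dx x : closure (@unit_disc R) (expi x) by rewrite closure_disc; exact: expi_disc.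
have := Hd (expi t) (expi s) (Dx t) (Dx s) _.
have := expi_lip s t => h /(_ _)/ltW h'.
have : mod[phi (expi s) - phi (expi t)] <= e / 2 by apply: h'; lra.
lra.
Qed.

Lemma amp_small (e : R) : 0 < e -> exists n, amp R n < e.
Proof.
move=> e0; have [n Hn] := pow_half_small e0; exists n; apply: le_lt_trans Hn.
rewrite /amp lerXn2r ?nnegrE// lef_pV2 ?posrE//.
by rewrite ler_nat.
Qed.

Lemma amp_le1 n : amp R n <= 1.
Proof. by rewrite /amp exprn_ile1// invf_le1// ler1n. Qed.

Lemma lacunary_sum_cder N n (k : C -> C) z l : cder k z l ->
  exists m, cder (fun w => lacunary_sum N n (k w)) z m.
Proof.
move=> dk; eexists.
apply: (@cder_sum R n (fun j w => ((amp R j)%:C)%C * k w ^+ N j)) => j _.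
by apply: cderZ; apply: cderX; exact: dk.
Qed.

(** G l is the continuous extension of the l-th derivative of H: the function Lam o psi for
    l = p, a Lipschitz extension for l < p. *)
Lemma oscillating_primitive : exists H (G : nat -> C -> C) (K : R) (del : nat -> R),
  [/\ hol Omega H,
      forall l, (l <= p)%N -> [/\ forall z, V z -> ccont V (G l) z,
         forall z, Omega z -> G l z = derive1n l H z &
         forall z, V z -> mod[G l z] <= K],
      forall k s t, `|s - t| <= del k ->
        `|s - t| + mod[phi (expi s) - phi (expi t)] <= amp R k / k.+1%:R &
      forall k t, (exists2 s : R, `|s - t| <= del k & amp R k / 4 <=
         `|complex.Re (G p (phi (expi s))) - complex.Re (G p (phi (expi t)))|) /\
       (exists2 s : R, `|s - t| <= del k & amp R k / 4 <=
         `|complex.Im (G p (phi (expi s))) - complex.Im (G p (phi (expi t)))|)].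
Proof.
have [psi [hpsi psic psi1 psiK]] := riemann_inverse.
have [|N [Lam [LamS LamQ LamO]]] := @lacunary_function R (fun k d =>
  forall s t, `|s - t| <= d ->
    `|s - t| + mod[phi (expi s) - phi (expi t)] <= amp R k / k.+1%:R).
  move=> k; have [|d d0 Hd] := @riemann_uniform (amp R k / k.+1%:R).
    by rewrite divr_gt0// amp_gt0.
  exists d => // d' /andP[_ d'd] s t st; apply: Hd; exact: le_trans d'd.
have Oc := @subset_closure _ Omega.
pose h := Lam \o psi.
have hh : hol Omega h.
  apply: (weierstrass oO cO) => e e0.
  have [|n Hn] := @amp_small (e / 4); first by rewrite divr_gt0.
  exists (fun w => lacunary_sum N n (psi w)).
    by move=> z /hpsi[l dl]; exact: lacunary_sum_cder dl.
  move=> z /Oc/psi1 z1; apply: (le_trans (LamS _ z1 n)); lra.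
have h4 z : closure Omega z -> mod[h z] <= 4.
  move=> /psi1 z1; have := LamS _ z1 0%N.
  by rewrite /lacunary_sum big_ord0 subr0 /amp expr0 mulr1.
have hc z : closure Omega z -> ccont (closure Omega) h z.
  move=> cz e e0.
  have [|n Hn] := @amp_small (e / 12); first by rewrite divr_gt0.
  have [l dl] := lacunary_sum_cder N n (cder_id (psi z)).
  have [|d d0 Hd] := cder_cont dl (_ : 0 < e / 3); first by rewrite divr_gt0.
  have [d' d'0 Hd'] := psic z cz d d0.
  exists d' => // w cw wd; have := Hd _ I (Hd' w cw wd).
  have := LamS _ (psi1 z cz) n; have := LamS _ (psi1 w cw) n.
  rewrite /h /=; set a := Lam _; set b := lacunary_sum _ _ _.
  set a' := Lam _; set b' := lacunary_sum _ _ _ => ab ab' bb'.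
  have -> : a - a' = (a - b) - (a' - b') + (b - b') by ring.
  apply: (le_lt_trans (modD _ _)); have := modB (a - b) (a' - b'); lra.
have [B B0 OB] := dom_bounded bcd.
have [H [K [hH Hp HK HL]]] := @iterated_primitive R Omega h p B 4 oO cO OB hh
  (fun z Oz => h4 z (Oc z Oz)).
have gex l : exists g : C -> C, (l < p)%N -> (forall z, ccont setT g z) /\
    forall z, Omega z -> g z = derive1n l H z.
  have [lp|] := boolP (l < p)%N; last by exists (fun=> 0).
  have O0 : Omega !=set0 by have [[]] := bcd.
  have [g gc gE] := lipschitz_extension O0 (fun z w Oz Ow => HL l z w lp Oz Ow).
  by exists g.
have [g Hg] := choice gex.
pose G l := if (l < p)%N then g l else h.
have Gp : G p = h by rewrite /G ltnn.
have GG l : (l <= p)%N -> (forall z, V z -> ccont V (G l) z) /\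
    forall z, Omega z -> G l z = derive1n l H z.
  rewrite leq_eqVlt => /orP[/eqP ->|lp].
    rewrite Gp; split=> [z Vz|z Oz]; last by rewrite Hp.
    exact: ccontW VC (hc z (VC Vz)).
  have [gc gE] := Hg l lp; rewrite /G lp; split=> // z _.
  exact: ccontW (gc z).
exists H, G, K, (fun k => pi / (N k)%:R); split => //.
- move=> l lp; have [Gc GE] := GG l lp; split => // z Vz.
  apply: (ext_bound Vz (Gc z Vz)) => w Ow; rewrite GE//; exact: HK.
- by move=> k t; rewrite Gp /h /= psiK; have [[s1 h1 h1'] [s2 h2 h2']] := LamO k t;
    split; [exists s1|exists s2]; rewrite ?psiK.
Qed.

(** With c = amp k / (k + 1), the oscillation eps amp k / 4 of the second term exceeds
    (n + 1) c + c plus the change K c of the first term as soon as k is large; [x] is a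
    lower bound for k + 1 that ensures this and c <= 1 / (2 (n + 1)). *)
Lemma steep_criterion (rho : C -> R) (g A B : C -> C) (eps K : R) (del : nat -> R) :
  (forall z w, rho (z - w) = rho z - rho w) -> (forall z, `|rho z| <= mod[z]) ->
  (forall (c : R) z, rho ((c%:C)%C * z) = c * rho z) ->
  0 < eps -> 0 <= K ->
  (forall z, V z -> E p g z = A z + (eps%:C)%C * B z) ->
  (forall z w, V z -> V w -> mod[A w - A z] <= K * mod[w - z]) ->
  (forall k s t, `|s - t| <= del k ->
    `|s - t| + mod[phi (expi s) - phi (expi t)] <= amp R k / k.+1%:R) ->
  (forall k t, exists2 s : R, `|s - t| <= del k & amp R k / 4 <=
    `|rho (B (phi (expi s))) - rho (B (phi (expi t)))|) ->
  forall n, steep Omega J p phi rho n g.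
Proof.
move=> rhoB rho1 rhoZ eps0 K0 Eg AK HQ HO n.
have [n1 n1E] : exists n1 : R, n1 = n.+1%:R by exists n.+1%:R.
have n10 : 0 < n1 by rewrite n1E ltr0n.
have n11 : 1 <= n1 by rewrite n1E ler1n.
pose x := 4 * (n1 + 1 + K) / eps + 2 * n1.
have x0 : 0 <= x.
  by rewrite addr_ge0// ?divr_ge0 ?(ltW eps0)//; [lra|rewrite mulr_ge0// ltW].
set k := Num.bound x.
have kx : x < k.+1%:R by apply: lt_trans (archi_boundP x0) _; rewrite ltr_nat.
pose c := amp R k / k.+1%:R.
have k0 : 0 < k.+1%:R :> R by rewrite ltr0n.
have c0 : 0 < c by rewrite divr_gt0// amp_gt0.
have cn : c <= (2 * n1)^-1.
  apply: le_trans (_ : _ <= 1 / k.+1%:R) _.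
    by rewrite ler_wpM2r ?invr_ge0 ?(ltW k0)//; exact: amp_le1.
  rewrite div1r lef_pV2 ?posrE//; last by rewrite mulr_gt0.
  apply/ltW; apply: le_lt_trans kx; rewrite /x lerDr divr_ge0 ?(ltW eps0)//.
  by lra.
have ce : c * (4 * (n1 + 1 + K)) <= eps * amp R k.
  rewrite /c mulrAC ler_pdivrMr// [eps * _]mulrC -mulrA.
  rewrite ler_wpM2l ?(ltW (amp_gt0 _ _))// [eps * _]mulrC -ler_pdivrMr//; apply/ltW; apply: le_lt_trans kx.
  by rewrite /x lerDl mulr_ge0// ltW.
have HQc s t : `|s - t| <= del k ->
  `|s - t| + mod[phi (expi s) - phi (expi t)] <= c := HQ k s t.
clearbody c k.
exists c, (2 * n.+1)%N; split => //.
move=> t Jt [Vt dt mt].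
have [s st big] := HO k t.
have Q := HQc s t st.
exists s.
set zs := phi (expi s) in Q big *; set zt := phi (expi t) in Q big Vt Jt dt mt *.
have zz := mod_ge0 (zs - zt); have ss := normr_ge0 (s - t).
have half : (2 * n1)^-1 = n1^-1 / 2 by rewrite invfM mulrC.
have n1i : 0 < n1^-1 by rewrite invr_gt0.
rewrite -n1E in dt mt *.
have ds : (2 * n1)^-1 <= dist zs (boundary Omega `\` J).
  have := dist_lip Jprop zs zt; move: cn; rewrite half; lra.
have Js : J zs.
  apply: (boundary_J (riemann_boundary s)); apply: lt_le_trans ds.
  by rewrite half divr_gt0.
have Vs : V zs by right.
split => //.
- split => //; rewrite natrM -n1E//.
  have : n1^-1 <= 1 by rewrite invf_le1.
  have := mod_triB zs zt; move: cn; rewrite half; lra.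
- by move: cn; rewrite half; lra.
rewrite (Eg _ Vs) (Eg _ Vt) -rhoB.
have -> : A zs + (eps%:C)%C * B zs - (A zt + (eps%:C)%C * B zt) =
  (eps%:C)%C * (B zs - B zt) - (A zt - A zs) by ring.
rewrite rhoB rhoZ rhoB.
have hA : `|rho (A zt - A zs)| <= K * c.
  apply: (le_trans (rho1 _)); rewrite modC; apply: (le_trans (AK _ _ Vt Vs)).
  by rewrite ler_wpM2l//; lra.
have hB : eps * (amp R k / 4) <= `|eps * (rho (B zs) - rho (B zt))|.
  by rewrite normrM gtr0_norm// ler_pM2l.
have hn : n1 * (`|s - t| + mod[zs - zt]) <= n1 * c by rewrite ler_pM2l.
have := ler_normB (eps * (rho (B zs) - rho (B zt)) - rho (A zt - A zs)) (- rho (A zt - A zs)).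
rewrite opprK subrK normrN.
move: hn hA hB ce; clear; lra.
Qed.

Lemma perturbation f M (e : R) : 0 < e -> exists2 g : Ap Omega J p, Ap_ball f M e g &
  forall n, steep Omega J p phi (@complex.Re R) n g /\
            steep Omega J p phi (@complex.Im R) n g.
Proof.
move=> e0.
have [H [G [K [del [hH HG HQ HO]]]]] := oscillating_primitive.
have [a Oa] : Omega !=set0 by have [[]] := bcd.
have [M' M'0 MM'] : exists2 M', (0 < M')%N & (M <= M')%N by exists M.+1.
have e4 : 0 < e / 4 by rewrite divr_gt0.
have [l d d' /andP[d'0 d'd]|l lp|d d0 Hd] := @finite_radius (fun l d =>
  forall d', 0 < d' <= d -> d' < 1 -> forall z, Delta Omega J M' z ->
  mod[((1 - d')%:C)%C ^+ l * E l f (seg a z (1 - d')) - E l f z] <= e / 4) p.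
- by move=> Hl x /andP[x0 xd]; apply: Hl; rewrite x0 (le_trans xd).
- exact: dilate_uniform Oa M'0 e4 (proj1 (ap_ext bcd Jprop f lp)).
pose d' := Num.min d 2^-1.
have d'0 : 0 < d' by rewrite lt_min d0 /=; lra.
have d'd : d' <= d by rewrite ge_min lexx.
have d'1 : d' <= 2^-1 by rewrite ge_min lexx orbT.
pose r := 1 - d'; have r01 : 0 <= r < 1 by rewrite /r; lra.
have near l z : (l <= p)%N -> Delta Omega J M' z ->
    mod[(r%:C)%C ^+ l * E l f (seg a z r) - E l f z] <= e / 4.
  by move=> lp Dz; apply: Hd => //; [rewrite d'0|lra].
clearbody r; clear d d' d0 Hd d'0 d'd d'1.
(* K bounds the extended derivatives of H; K1 is a positive bound *)
pose K1 := Num.max K 0 + 1.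
have K10 : 0 < K1 by rewrite ltr_wpDl// le_max lexx orbT.
have KK1 : K <= K1.
  by apply: (@le_trans _ _ (Num.max K 0)); rewrite ?le_max ?lexx// /K1 lerDl.
pose eps := e / 4 / K1; have eps0 : 0 < eps by rewrite divr_gt0.
pose b := a - (r%:C)%C * a.
have segE z : seg a z r = b + (r%:C)%C * z by rewrite /seg /b; ring.
have dilO z : closure Omega z -> Omega (b + (r%:C)%C * z).
  by move=> cz; rewrite -segE; exact: (dom_star bcd Oa cz r01).
have Oc := @subset_closure _ Omega.
have dilO' z : Omega z -> Omega (b + (r%:C)%C * z) by move=> /Oc; exact: dilO.
have hf := ap_hol f.
have hdil := hol_dilate hf dilO'.
pose g0 z := f (b + (r%:C)%C * z) + (eps%:C)%C * H z.
have hg0 : hol Omega g0 by exact: hol_lin.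
(* elements of A^p vanish outside Omega *)
pose g1 z := if `[< Omega z >] then g0 z else 0.
have g01 z : Omega z -> g0 z = g1 z by move=> Oz; rewrite /g1 asboolT.
pose F l z := (r%:C)%C ^+ l * E l f (seg a z r) + (eps%:C)%C * G l z.
have Fc l z : (l <= p)%N -> V z -> ccont V (F l) z.
  move=> lp Vz; have [fc _] := ap_ext bcd Jprop f lp.
  have [Gc _ _] := HG l lp.
  have sc : ccont V (fun z => E l f (seg a z r)) z.
    have Vs : V (seg a z r) by left; exact: (dom_star bcd Oa (VC Vz) r01).
    move=> x /(fc _ Vs)[d d0 Hd]; exists d => // w Vw wd; apply: Hd.
      by left; exact: (dom_star bcd Oa (VC Vw) r01).
    have -> : seg a w r - seg a z r = (r%:C)%C * (w - z) by rewrite /seg; ring.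
    apply: le_lt_trans wd; rewrite modM modR ger0_norm; last by case/andP: r01.
    by rewrite ler_piMl ?mod_ge0//; case/andP: r01 => _ /ltW.
  have scale (c : C) (k : C -> C) : ccont V k z -> ccont V (fun w => c * k w) z.
    move=> kc x x0; have c1 : 0 < mod[c] + 1 by rewrite ltr_wpDl ?mod_ge0.
    have [|d d0 Hd] := kc (x / (mod[c] + 1)); first by rewrite divr_gt0.
    exists d => // w Vw /(Hd w Vw); rewrite ltr_pdivlMr// -mulrBr modM.
    have := mod_ge0 (k w - k z); have := mod_ge0 c; nra.
  have := ccontB (scale ((r%:C)%C ^+ l) _ sc) (scale (- (eps%:C)%C) _ (Gc z Vz)).
  by apply: ccont_ext => // w _; rewrite /F mulNr opprK.
have FE l z : (l <= p)%N -> Omega z -> F l z = derive1n l g1 z.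
  move=> lp Oz; have [_ fE] := ap_ext bcd Jprop f lp; have [_ GE _] := HG l lp.
  rewrite -(derive1n_ext l oO g01 hg0 Oz) (derive1n_lin _ _ oO hdil hH Oz).
  rewrite (derive1n_dilate l oO oO hf dilO' Oz) /F GE// fE ?segE//.
  exact: dilO'.
have g1h : holomorphic_on Omega g1.
  by move=> z Oz; apply/derivableCP; exact: (hol_ext oO g01 hg0).
have g1e l : (l <= p)%N -> extends_continuously Omega J (derive1n l g1).
  move=> lp; exists (F l); last by move=> z Oz; exact: FE.
  by apply/within_contP => z; exact: Fc.
have g1o z : ~ Omega z -> g1 z = 0 by move=> Oz; rewrite /g1 asboolF.
pose g : Ap Omega J p := MkAp g1h g1e g1o.
have gE l z : (l <= p)%N -> V z -> E l g z = F l z.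
  move=> lp; apply: (ext_val bcd Jprop (k := F l)) => w.
    exact: Fc.
  exact: FE.
exists g.
  move=> l m lp /andP[m0 mM]; apply: le_lt_trans (_ : e / 2 < e); last by lra.
  apply: seminorm_le => [|z Dz]; first by rewrite divr_ge0// ltW.
  have Vz : V z by case: Dz.
  rewrite (ap_extB bcd Jprop f g lp Vz) (gE l z lp Vz) /F addrAC.
  apply: (le_trans (modD _ _)).
  have Dz' : Delta Omega J M' z.
    by apply: (Delta_mono _ Dz); rewrite m0 (leq_trans mM).
  have h1 := near l z lp Dz'.
  have h2 : mod[(eps%:C)%C * G l z] <= e / 4.
    rewrite modM modR gtr0_norm// /eps mulrAC ler_pdivrMr// ler_pM2l//.
    by have [_ _ GK] := HG l lp; exact: le_trans (GK z Vz) KK1.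
  by apply: (le_trans (lerD h1 h2)); lra.
have [K2 K20 HK2] := dilate_lipschitz Oa r01 (fun z Oz => hol_derive1 (hol_derive1n p oO hf) Oz)
   (hol_cont (hol_derive oO (hol_derive1n p oO hf))).
have [_ fpE] := ap_ext bcd Jprop f (leqnn p).
have AK z w : V z -> V w -> mod[(r%:C)%C ^+ p * E p f (seg a w r) -
    (r%:C)%C ^+ p * E p f (seg a z r)] <= K2 * mod[w - z].
  move=> Vz Vw; rewrite -mulrBr modM modX modR.
  rewrite !fpE; [|exact: (dom_star bcd Oa (VC Vz) r01)|exact: (dom_star bcd Oa (VC Vw) r01)].
  apply: le_trans (HK2 z w (VC Vz) (VC Vw)); rewrite ler_piMl ?mod_ge0//.
  by case/andP: r01 => r0 r1; rewrite ger0_norm// exprn_ile1// ltW.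
move=> n; split.
- apply: (@steep_criterion _ g (fun z => (r%:C)%C ^+ p * E p f (seg a z r)) (G p)
    eps K2 del (@Re_sub R) (@Re_le_mod R)) => //.
  + by move=> c z; rewrite Re_mul /= mul0r subr0.
  + by move=> z; exact: gE.
  + by move=> k t; have [] := HO k t.
- apply: (@steep_criterion _ g (fun z => (r%:C)%C ^+ p * E p f (seg a z r)) (G p)
    eps K2 del (@Im_sub R) (@Im_le_mod R)) => //.
  + by move=> c z; rewrite Im_mul /= mul0r addr0.
  + by move=> z; exact: gE.
  + by move=> k t; have [] := HO k t.
Qed.

End Density.

Theorem corollary7p2 (R : realType) (Omega J : set (Cx R)) (p : nat)
    (phi : Cx R -> Cx R) :
  bounded_convex_domain Omega ->
  J `<` boundary Omega ->
  relatively_open J (boundary Omega) ->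
  extended_riemann_map Omega phi ->
  let L := closure (@unit_disc R) `&` phi @^-1` J in
  exists G : set (Ap Omega J p),
    [/\ Gdelta G, dense G &
        G `<=` [set f : Ap Omega J p |
          let u := fun z => extension Omega (derive1n p f) (phi z) in
          nowhere_differentiable_on L (fun z => complex.Re (u z)) /\
          nowhere_differentiable_on L (fun z => complex.Im (u z))]].
Proof.
move=> bcd Jprop Jopen riemann L.
pose S (rho : Cx R -> R) n := [set f : Ap Omega J p | steep Omega J p phi rho n f].
have oS rho n : (forall z w, rho (z - w) = rho z - rho w) ->
    (forall z, `|rho z| <= mod[z]) -> open (S rho n).
  by move=> h1 h2; exact: steep_open.
exists (\bigcap_n (S (@complex.Re R) n `&` S (@complex.Im R) n)); split.
- exists (fun n => S (@complex.Re R) n `&` S (@complex.Im R) n) => // n.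
  apply: openI; apply: oS.
  + exact: Re_sub.
  + exact: Re_le_mod.
  + exact: Im_sub.
  + exact: Im_le_mod.
- move=> W [f Wf] oW.
  have [M [e e0 ballW]] : exists M, exists2 e : R, 0 < e & Ap_ball f M e `<=` W.
    exact: oW.
  have [g gf gS] := perturbation bcd Jprop riemann f M e0.
  by exists g; split; [exact: ballW|move=> n _; exact: gS].
- move=> f fS u; split => t [_ Jt].
  + move=> dv.
    exact: (steep_not_derivable Jprop Jopen (fun n => (fS n I).1) Jt dv).
  + move=> dv.
    exact: (steep_not_derivable Jprop Jopen (fun n => (fS n I).2) Jt dv).
Qed.
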